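(* Let $(M,N)$ be a weighted manifold pair. The action of $\mathbb{R}_{>0}$ on the subset $\delta_{\mathcal W}(M,N)-(N\times\mathbb{R})$ of the weighted deformation space is free and proper. Hence, the quotient by this action, $$\widehat{\mathrm{Bl}}_{\mathcal W}(M,N)=(M-N)\sqcup S(\nu_{\mathcal W}(M,N))\sqcup(M-N),$$ inherits a manifold structure, with a $\mathbb{Z}_2$-action interchanging the two copies of $M-N$ and preserving $S(\nu_{\mathcal W}(M,N))$.
   Context: Weightings. A weight sequence of order $r$ is a sequence of integers $0\le w_1\le\dots\le w_n\le r$. For a chart $U$ with coordinates $x_1,\dots,x_n$, let $C^\infty(U)_{(i)}$ be the ideal generated by monomials $x^s$ with $\sum_a s_aw_a\ge i$. An order $r$ weighting on an $n$-dimensional manifold $M$ is a filtration $C^\infty_M=C^\infty_{M,(0)}\supseteq C^\infty_{M,(1)}\supseteq\cdots$ of the structure sheaf by ideal sheaves such that every point has an open neighborhood $U$ with coordinates $x_a$ in which the filtration of $C^\infty(U)$ is given by this local model for a weight sequence of order $r$ (which may depend on the connected component of $N$). $C^\infty_{M,(1)}$ is the vanishing ideal of a closed submanifold $N$; $(M,N)$ is then a weighted manifold pair. Write $C^\infty(M)_{(i)}$ for global sections ($=C^\infty(M)$ if $i\le0$). Weighted normal bundle. $\nu_{\mathcal W}(M,N)=\mathrm{Hom}_{\mathrm{alg}}(\mathrm{gr}(C^\infty(M)),\mathbb{R})$, where $\mathrm{gr}(C^\infty(M))=\bigoplus_i C^\infty(M)_{(i)}/C^\infty(M)_{(i+1)}$.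 It is a graded bundle over $N$: a manifold with a smooth action $\kappa_t$ of the monoid $(\mathbb{R},\cdot)$ (here dual to multiplication by $t^i$ on the degree $i$ part), with $N$ embedded as the zero section $\kappa_0(\nu_{\mathcal W}(M,N))$. For a graded bundle $E\to N$, $S(E)=(E-N)/\mathbb{R}_{>0}$ is its sphere bundle. Weighted deformation space. $\delta_{\mathcal W}(M,N)=\mathrm{Hom}_{\mathrm{alg}}(\mathrm{Rees}(C^\infty(M)),\mathbb{R})$ with $\mathrm{Rees}(C^\infty(M))=\{\sum_{i\in\mathbb{Z}}z^{-i}f_i:\ f_i\in C^\infty(M)_{(i)}\}\subseteq C^\infty(M)[z,z^{-1}]$. It carries the unique manifold structure of dimension $\dim M+1$ for which evaluations on elements of the Rees algebra are smooth; evaluation on $z$ is a surjective submersion $\pi:\delta_{\mathcal W}(M,N)\to\mathbb{R}$ with $\pi^{-1}(0)=\nu_{\mathcal W}(M,N)$ and $\pi^{-1}(\mathbb{R}^\times)=M\times\mathbb{R}^\times$. There is an embedding $N\times\mathbb{R}\to\delta_{\mathcal W}(M,N)$, given by $N\times\mathbb{R}^\times\subseteq M\times\mathbb{R}^\times$ and, at $t=0$, by the zero section $N\subseteq\nu_{\mathcal W}(M,N)$. The group $\mathbb{R}^\times$ acts smoothly on $\delta_{\mathcal W}(M,N)$, the action of $u$ being defined by the algebra morphism $\sum z^{-i}f_i\mapsto\sum u^iz^{-i}f_i$ of the Rees algebra; thus $u\cdot(m,t)=(m,u^{-1}t)$ on $M\times\mathbb{R}^\times$ and $u$ acts as $\kappa_u$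 on $\nu_{\mathcal W}(M,N)$. The $\mathbb{R}_{>0}$-action is the restriction, and $\mathbb{Z}_2=\mathbb{R}^\times/\mathbb{R}_{>0}$. *)

(* Defs.v *)
From HB Require Import structures.
From mathcomp Require Import all_boot all_order all_algebra generic_quotient.
From mathcomp Require Import all_classical all_reals all_analysis.
Set Implicit Arguments.
Unset Strict Implicit.
Unset Printing Implicit Defensive.
Import Order.TTheory GRing.Theory Num.Theory numFieldNormedType.Exports.
Local Open Scope classical_set_scope.
Local Open Scope ring_scope.
Local Open Scope quotient_scope.

Definition subelt T (A : set T) (x : T) (Ax : A x) : A :=
  exist (fun y => y \in A) x (mem_set Ax).

Section Manifolds.
Context {R : realType}.

Definition iter_partial n (s : seq 'I_n) (f : 'rV[R]_n -> R) : 'rV[R]_n -> R :=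
  foldr (fun i g x => 'D_(delta_mx 0 i) g x) f s.

(* C^oo on an open set: all iterated partial derivatives exist and are
   continuous.  The values of f outside U are irrelevant. *)
Definition smooth_on n (U : set 'rV[R]_n) (f : 'rV[R]_n -> R) : Prop :=
  forall (s : seq 'I_n) x, U x ->
    {for x, continuous (iter_partial s f)} /\
    forall i, derivable (iter_partial s f) x (delta_mx 0 i).

(* A sheaf of real functions on X is encoded by total functions: F U f means
   that the restriction of f to U is a section over the open set U. *)
Definition fun_family (X : Type) := set X -> set (X -> R).

Record is_fun_sheaf (X : topologicalType) (F : fun_family X) : Prop := {
  sheaf_ext : forall U f g, open U -> (forall x, U x -> f x = g x) ->
    F U f -> F U g;
  sheaf_res : forall U V f, open U -> open V -> V `<=` U -> F U f -> F V f;
  sheaf_glue : forall (Us : set (set X)) f,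
    (forall U, Us U -> open U /\ F U f) -> F (\bigcup_(U in Us) U) f }.

(* A chart with domain U, coordinate map phi and inverse psi, for the sheaf C
   of smooth functions on X. *)
Record is_chart n (X : topologicalType) (C : fun_family X)
    (U : set X) (phi : X -> 'rV[R]_n) (psi : 'rV[R]_n -> X) : Prop := {
  chart_dom : open U;
  chart_im : open (phi @` U);
  chart_K : forall x, U x -> psi (phi x) = x;
  chart_cont : forall x, U x -> {for x, continuous phi};
  chart_inv_cont : forall y, (phi @` U) y -> {for y, continuous psi};
  chart_smooth : forall V f, open V -> V `<=` U ->
    (C V f <-> smooth_on (phi @` V) (f \o psi)) }.

(* Manifolds are given by their sheaf of smooth functions. *)
Record is_manifold n (X : topologicalType) (C : fun_family X) : Prop := {
  manifold_hausdorff : hausdorff_space X;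
  manifold_countable : @second_countable X;
  manifold_sheaf : is_fun_sheaf C;
  manifold_charts : forall p, exists U (phi : X -> 'rV[R]_n) psi,
    U p /\ is_chart C U phi psi }.

Definition smooth_map (X Y : topologicalType) (CX : fun_family X)
    (CY : fun_family Y) (q : X -> Y) : Prop :=
  continuous q /\
  forall V g, open V -> CY V g -> CX (q @^-1` V) (g \o q).

Definition is_submersion m n (X Y : topologicalType) (CX : fun_family X)
    (CY : fun_family Y) (q : X -> Y) : Prop :=
  smooth_map CX CY q /\
  forall p, exists U (phi : X -> 'rV[R]_m) psi V (phi' : Y -> 'rV[R]_n) psi',
    [/\ U p, V (q p), is_chart CX U phi psi, is_chart CY V phi' psi' &
        differentiable (phi' \o q \o psi) (phi p) /\
        range ('d (phi' \o q \o psi) (phi p)) = setT].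

Definition sub_smooth (X : topologicalType) (CX : fun_family X) (A : set X) :
    fun_family A :=
  fun U f => forall x : A, U x -> exists V g,
    [/\ open V, V (\val x), CX V g & \forall y \near x, f y = g (\val y)].

(* The smooth structure generated by a family of functions e: the smooth
   functions are locally smooth functions of finitely many members of e. *)
Definition generated_smooth (X : topologicalType) (I : Type)
    (e : I -> X -> R) : fun_family X :=
  fun U f => forall x, U x -> exists k (a : 'I_k -> I) (F : 'rV[R]_k -> R),
    smooth_on setT F /\ \forall y \near x, f y = F (\row_i e (a i) y).

End Manifolds.
Arguments fun_family : clear implicits.

Section Actions.
Context {R : realType}.

Record mul_action (T : Type) := MulAction {
  act : forall u : R, u != 0 -> T -> T;
  act1 : forall x, act (oner_neq0 R) x = x;
  actM : forall u v (u0 : u != 0) (v0 : v != 0) x,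
    act (mulf_neq0 u0 v0) x = act u0 (act v0 x) }.

(* The restriction of an action to the positive reals. *)
Definition act_pos T (a : mul_action T) (t : R) (t0 : 0 < t) : T -> T :=
  act a (lt0r_neq0 t0).

Definition free_action T (a : mul_action T) : Prop :=
  forall t (t0 : 0 < t) x, act_pos a t0 x = x -> t = 1.

(* (t, x) |-> (t x, x) from R_{>0} x T to T x T is a proper map. *)
Definition proper_action (T : topologicalType) (a : mul_action T) : Prop :=
  forall K : set (T * T), compact K ->
    compact [set p : R * T | exists t0 : 0 < p.1, K (act_pos a t0 p.2, p.2)].

Definition orbit_rel T (a : mul_action T) : rel T :=
  fun x y => `[< exists t (t0 : 0 < t), y = act_pos a t0 x >].

Lemma act_posM T (a : mul_action T) s t (s0 : 0 < s) (t0 : 0 < t)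
    (st0 : 0 < s * t) x :
  act_pos a st0 x = act_pos a s0 (act_pos a t0 x).
Proof. by rewrite /act_pos -actM; congr (act a _ x); exact: bool_irrelevance. Qed.

Lemma act_pos1 T (a : mul_action T) t (t0 : 0 < t) x :
  t = 1 -> act_pos a t0 x = x.
Proof.
move=> t1; move: t0; rewrite t1 => t0; rewrite -[RHS](act1 a) /act_pos.
by congr (act a _ x); exact: bool_irrelevance.
Qed.

Lemma orbit_rel_equiv T (a : mul_action T) : equiv_class_of (orbit_rel a).
Proof.
split=> [x|x y|y x z].
- by apply/asboolP; exists 1, ltr01; rewrite act_pos1.
- have sym u v : orbit_rel a u v -> orbit_rel a v u.
    move=> /asboolP[t [t0 ->]]; apply/asboolP.
    have ti0 : 0 < t^-1 by rewrite invr_gt0.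
    exists t^-1, ti0; rewrite -(act_posM a ti0 t0 (mulr_gt0 ti0 t0)).
    by rewrite act_pos1 // mulVf // lt0r_neq0.
  by apply/idP/idP; exact: sym.
- move=> /asboolP[s [s0 ->]] /asboolP[t [t0 ->]]; apply/asboolP.
  by exists (t * s), (mulr_gt0 t0 s0); rewrite (act_posM a t0 s0).
Qed.

Canonical orbit_equiv T (a : mul_action T) :=
  EquivRelPack (orbit_rel_equiv a).

(* The quotient T / R_{>0}. *)
Definition orbit_space (T : choiceType) (a : mul_action T) :=
  {eq_quot (orbit_rel a)}.

Section Quotient.
Variables (T : topologicalType) (a : mul_action T).

Definition orbit_topspace : topologicalType := quotient_topology (orbit_space a).

Definition orbit_proj (x : T) : orbit_topspace := \pi_(orbit_space a) x.

Definition orbit_smooth (C : fun_family R T) : fun_family R orbit_topspace :=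
  fun U g => C (orbit_proj @^-1` U) (g \o orbit_proj).

End Quotient.
End Actions.

(* Z_2 = R^x / R_{>0} is encoded as (bool, (+)), the class of u being (u < 0). *)
Definition is_Z2_action (X : Type) (rho : bool -> X -> X) : Prop :=
  rho false =1 id /\ forall b c, rho (b (+) c) =1 rho b \o rho c.

Section Weightings.
Context {R : realType} {M : topologicalType}.

(* A decreasing filtration of the sheaf C by sheaves of ideals. *)
Record ideal_filtration (C : fun_family R M) := {
  fil :> nat -> fun_family R M;
  fil_sheaf : forall i, is_fun_sheaf (fil i);
  fil_zero : forall U f, open U -> (fil 0%N U f <-> C U f);
  fil_decr : forall i U f, open U -> fil i.+1 U f -> fil i U f;
  fil0 : forall i U, open U -> fil i U (fun=> 0);
  filD : forall i U f g, open U -> fil i U f -> fil i U g ->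
    fil i U (fun x => f x + g x);
  filZ : forall i U c f, open U -> fil i U f -> fil i U (fun x => c * f x);
  filM : forall i U h f, open U -> C U h -> fil i U f ->
    fil i U (fun x => h x * f x) }.

Definition weight_sequence n (r : nat) (w : 'I_n -> nat) : Prop :=
  (forall a b : 'I_n, (a <= b)%N -> (w a <= w b)%N) /\
  forall a, (w a <= r)%N.

(* The ideal of C(U) generated by the monomials x^s in the coordinates
   x_a = phi _ 0 a with \sum_a s_a w_a >= i. *)
Definition weighted_ideal n (C : fun_family R M) (U : set M)
    (phi : M -> 'rV[R]_n) (w : 'I_n -> nat) (i : nat) : set (M -> R) :=
  [set f | exists m (g : 'I_m -> M -> R) (s : 'I_m -> 'I_n -> nat),
    (forall k, C U (g k) /\ (i <= \sum_a s k a * w a)%N) /\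
    forall x, U x ->
      f x = \sum_k g k x * \prod_a (phi x 0 a) ^+ s k a].

(* That N is a submanifold follows from the local model: in a weighted chart
   it is the common zero locus of the coordinates of positive weight. *)
Record is_weighted_pair n (r : nat) (C : fun_family R M)
    (W : ideal_filtration C) (N : set M) : Prop := {
  weighting_charts : forall p, exists U (phi : M -> 'rV[R]_n) psi w,
    [/\ U p, is_chart C U phi psi, weight_sequence r w &
        forall i f, W i U f <-> weighted_ideal C U phi w i f];
  weighting_closed : closed N;
  weighting_vanishing : forall U f, open U ->
    (W 1%N U f <-> C U f /\ forall p, U p -> N p -> f p = 0) }.

End Weightings.

Section DeformationSpace.
Context {R : realType} {M : topologicalType} {C : fun_family R M}.
Variables (W : ideal_filtration C) (N : set M).

(* Global sections of filtration degree i in Z. *)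
Definition glob (i : int) : set (M -> R) :=
  W (if i is Posz k then k else 0%N) setT.

(* The Rees algebra.  The Laurent polynomial \sum_i z^-i f_i is encoded by the
   finitely supported family i |-> f_i. *)
Definition rees : set (int -> M -> R) :=
  [set f | finite_set [set i | f i <> fun=> 0] /\ forall i, glob i (f i)].

Definition laurent1 (i : int) (x : M) : R := (i == 0)%:R.

Definition laurentM (f g : int -> M -> R) (k : int) (x : M) : R :=
  \sum_(i \in [set: int]) f i x * g (k - i) x.

(* Unital algebra morphisms rees -> R; the operations of the Rees algebra are
   those of Laurent polynomials, and are used relationally. *)
Record rees_hom (phi : rees -> R) : Prop := {
  hom1 : forall a : rees, \val a = laurent1 -> phi a = 1;
  homD : forall a b c : rees,
    \val c = (fun i x => \val a i x + \val b i x) -> phi c = phi a + phi b;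
  homZ : forall l (a c : rees),
    \val c = (fun i x => l * \val a i x) -> phi c = l * phi a;
  homM : forall a b c : rees,
    \val c = laurentM (\val a) (\val b) -> phi c = phi a * phi b }.

(* The weighted deformation space, with the coarsest topology for which the
   evaluations are continuous. *)
Definition delta : set (prod_topology (fun _ : rees => R)) :=
  [set phi | rees_hom phi].

Definition ev (a : rees) (phi : delta) : R := \val phi a.

(* Smoothness of the evaluations is read as: they generate the structure.
   Merely asking that they be smooth would not determine it. *)
Definition delta_smooth : fun_family R delta := generated_smooth ev.

Lemma rees_scale_subproof (u : R) (a : rees) :
  rees (fun i x => u ^ i * \val a i x).
Proof.
have [afin aW] := set_valP a; split=> [|i]; last first.
  by apply: filZ (aW i); exact: openT.
apply: sub_finite_set afin => i /=; apply: contra_not => ai0.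
apply/funext => x; rewrite (_ : \val a i x = 0) ?mulr0 //.
exact: (congr1 (@^~ x) ai0).
Qed.

(* \sum_i z^-i f_i |-> \sum_i u^i z^-i f_i *)
Definition rees_scale (u : R) (a : rees) : rees :=
  subelt (rees_scale_subproof u a).

Lemma rees_scale1 a : rees_scale 1 a = a.
Proof.
by apply/val_inj/funext => i; apply/funext => x /=; rewrite exp1rz mul1r.
Qed.

Lemma rees_scaleM u v a : rees_scale (u * v) a = rees_scale v (rees_scale u a).
Proof.
apply/val_inj/funext => i; apply/funext => x /=.
by rewrite expfzMl mulrCA mulrA.
Qed.

Lemma rees_hom_scale u phi : u != 0 ->
  rees_hom phi -> rees_hom (fun a => phi (rees_scale u a)).
Proof.
move=> u0 [h1 hD hZ hM]; split=> [a ea|a b c ec|l a c ec|a b c ec].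
- apply: h1; apply/funext => i; apply/funext => x /=.
  by rewrite ea /laurent1; case: eqP => [->|]; rewrite ?expr0z ?mulr1 ?mulr0.
- by apply: hD; apply/funext => i; apply/funext => x /=; rewrite ec mulrDr.
- by apply: hZ; apply/funext => i; apply/funext => x /=; rewrite ec mulrCA.
- apply: hM; apply/funext => k; apply/funext => x /=; rewrite ec /laurentM.
  rewrite [LHS]mulr_fsumr; apply: eq_fsbigr => i _.
  by rewrite mulrACA -expfzDr // subrKC.
Qed.

Definition delta_scale (u : R) (u0 : u != 0) (phi : delta) : delta :=
  subelt (A := delta) (rees_hom_scale u0 (set_valP phi)).

(* phi is the point (p, t) of delta: the evaluation at p of the coefficients
   and at t of z.  For t <> 0, p is any point of M.  For t = 0 and p in N, since
   0 ^ i is (i == 0), this is f |-> f_0 p, which is the point p of the zero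
   section of the weighted normal bundle. *)
Definition is_point (p : M) (t : R) (phi : delta) : Prop :=
  forall a : rees, \val phi a = \sum_(i \in [set: int]) t ^ (- i) * \val a i p.

(* The image of N x R in delta. *)
Definition center : set delta :=
  [set phi | exists p t, N p /\ is_point p t phi].

Lemma center_scale (u : R) (u0 : u != 0) phi :
  center phi -> center (delta_scale u0 phi).
Proof.
move=> [p [t [Np pt]]]; exists p, (u^-1 * t); split=> // a; rewrite /= pt.
apply: eq_fsbigr => i _ /=.
by rewrite mulrA expfzMl exprz_inv opprK (mulrC (t ^ _)).
Qed.

Lemma delta_scale1 phi : delta_scale (oner_neq0 R) phi = phi.
Proof. by apply/val_inj/funext => a /=; rewrite rees_scale1. Qed.

Lemma delta_scaleM u v (u0 : u != 0) (v0 : v != 0) phi :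
  delta_scale (mulf_neq0 u0 v0) phi = delta_scale u0 (delta_scale v0 phi).
Proof. by apply/val_inj/funext => a /=; rewrite rees_scaleM. Qed.

Definition delta_minus : set delta := [set phi | ~ center phi].

Lemma delta_minus_scale_subproof (u : R) (u0 : u != 0) (phi : delta_minus) :
  delta_minus (delta_scale u0 (\val phi)).
Proof.
have := set_valP phi; rewrite /delta_minus /= => nc.
move=> /(center_scale (invr_neq0 u0)).
have ui1 : u^-1 * u = 1 by rewrite mulVf.
rewrite -delta_scaleM; move: (mulf_neq0 _ _); rewrite ui1 => one0.
by rewrite (bool_irrelevance one0 (oner_neq0 R)) delta_scale1.
Qed.

Definition delta_minus_scale (u : R) (u0 : u != 0) (phi : delta_minus) : delta_minus :=
  subelt (@delta_minus_scale_subproof u u0 phi).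

Lemma delta_minus_scale1 phi : delta_minus_scale (oner_neq0 R) phi = phi.
Proof. by apply/val_inj; rewrite /= delta_scale1. Qed.

Lemma delta_minus_scaleM u v (u0 : u != 0) (v0 : v != 0) phi :
  delta_minus_scale (mulf_neq0 u0 v0) phi =
  delta_minus_scale u0 (delta_minus_scale v0 phi).
Proof. by apply/val_inj; rewrite /= delta_scaleM. Qed.

Definition delta_minus_act : mul_action delta_minus :=
  MulAction delta_minus_scale1 delta_minus_scaleM.

Definition delta_minus_smooth : fun_family R delta_minus :=
  sub_smooth delta_smooth (A := delta_minus).

(* The associated graded algebra: the quotient of \bigoplus_i C_(i), which is
   again the set of finitely supported families, by \bigoplus_i C_(i+1).  Its
   components of negative degree vanish. *)
Definition gr_rel : rel rees := fun a b =>
  `[< forall i, glob (i + 1) (fun x => \val a i x - \val b i x) >].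

Lemma gr_rel_equiv : equiv_class_of gr_rel.
Proof.
have sym a b : gr_rel a b -> gr_rel b a.
  move=> /asboolP ab; apply/asboolP => i.
  have := filZ (-1) openT (ab i); congr (glob _ _); apply/funext => x.
  by rewrite mulN1r opprB.
split=> [a|a b|b a c].
- apply/asboolP => i; under eq_fun do rewrite subrr.
  by apply: fil0; exact: openT.
- by apply/idP/idP; exact: sym.
- move=> /asboolP ab /asboolP bc; apply/asboolP => i.
  have := filD openT (ab i) (bc i); congr (glob _ _); apply/funext => x.
  by rewrite addrA subrK.
Qed.

Canonical gr_equiv := EquivRelPack gr_rel_equiv.

Definition gr := {eq_quot gr_rel}.

Definition gr_class (a : rees) : gr := \pi_gr a.

Definition gr_scale (u : R) (c : gr) : gr := gr_class (rees_scale u (repr c)).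

Lemma gr_scaleE u a : gr_scale u (gr_class a) = gr_class (rees_scale u a).
Proof.
apply/eqmodP; have /asboolP ab : gr_rel (repr (gr_class a)) a.
  by apply/eqmodP; rewrite reprK.
apply/asboolP => i; have := filZ (u ^ i) openT (ab i).
by congr (glob _ _); apply/funext => x /=; rewrite mulrBr.
Qed.

Lemma gr_class_repr c : gr_class (repr c) = c.
Proof. exact: reprK. Qed.

(* Algebra morphisms gr -> R, for the algebra structure on gr that makes the
   surjection gr_class an algebra morphism. *)
Definition normal_bundle : set (gr -> R) :=
  [set psi : gr -> R | rees_hom (psi \o gr_class)].

Lemma normal_scale_subproof (u : R) (u0 : u != 0) (psi : normal_bundle) :
  normal_bundle (\val psi \o gr_scale u).
Proof.
rewrite /normal_bundle /=; have := rees_hom_scale u0 (set_valP psi).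
by congr rees_hom; apply/funext => a /=; rewrite gr_scaleE.
Qed.

(* The graded bundle action, dual to multiplication by u^i in degree i. *)
Definition normal_scale (u : R) (u0 : u != 0) (psi : normal_bundle) : normal_bundle :=
  subelt (normal_scale_subproof u0 psi).

Lemma normal_scale1 psi : normal_scale (oner_neq0 R) psi = psi.
Proof.
apply/val_inj/funext => c; rewrite /= -[c]gr_class_repr gr_scaleE.
by rewrite rees_scale1.
Qed.

Lemma normal_scaleM u v (u0 : u != 0) (v0 : v != 0) psi :
  normal_scale (mulf_neq0 u0 v0) psi = normal_scale u0 (normal_scale v0 psi).
Proof.
apply/val_inj/funext => c; rewrite /= -[c]gr_class_repr !gr_scaleE.
by rewrite rees_scaleM.
Qed.

(* N as the zero section of the weighted normal bundle. *)
Definition zero_section : set normal_bundle :=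
  [set psi | exists2 p, N p & forall a, \val psi (gr_class a) = \val a 0 p].

Definition normal_minus : set normal_bundle := [set psi | ~ zero_section psi].

Lemma zero_section_scale (u : R) (u0 : u != 0) psi :
  zero_section psi -> zero_section (normal_scale u0 psi).
Proof.
move=> [p Np h]; exists p => // a.
by rewrite [LHS]/= gr_scaleE h /= expr0z mul1r.
Qed.

Lemma normal_minus_scale_subproof (u : R) (u0 : u != 0) (psi : normal_minus) :
  normal_minus (normal_scale u0 (\val psi)).
Proof.
have := set_valP psi; rewrite /normal_minus /= => nc.
move=> /(zero_section_scale (invr_neq0 u0)).
have ui1 : u^-1 * u = 1 by rewrite mulVf.
rewrite -normal_scaleM; move: (mulf_neq0 _ _); rewrite ui1 => one0.
by rewrite (bool_irrelevance one0 (oner_neq0 R)) normal_scale1.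
Qed.

Definition normal_minus_scale (u : R) (u0 : u != 0) (psi : normal_minus) : normal_minus :=
  subelt (@normal_minus_scale_subproof u u0 psi).

Lemma normal_minus_scale1 psi : normal_minus_scale (oner_neq0 R) psi = psi.
Proof. by apply/val_inj; rewrite /= normal_scale1. Qed.

Lemma normal_minus_scaleM u v (u0 : u != 0) (v0 : v != 0) psi :
  normal_minus_scale (mulf_neq0 u0 v0) psi =
  normal_minus_scale u0 (normal_minus_scale v0 psi).
Proof. by apply/val_inj; rewrite /= normal_scaleM. Qed.

Definition normal_minus_act : mul_action normal_minus :=
  MulAction normal_minus_scale1 normal_minus_scaleM.

Definition sphere_bundle := orbit_space normal_minus_act.

Definition sphere_proj (psi : normal_minus) : sphere_bundle :=
  \pi_sphere_bundle psi.

(* The inclusion of the weighted normal bundle as the fiber over 0. *)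
Definition normal_incl (psi : normal_bundle) : delta :=
  subelt (A := delta) (set_valP psi : rees_hom (\val psi \o gr_class)).

Definition blowup : topologicalType := orbit_topspace delta_minus_act.

Definition blowup_proj : delta_minus -> blowup := orbit_proj delta_minus_act.

Definition blowup_smooth : fun_family R blowup :=
  orbit_smooth (a := delta_minus_act) delta_minus_smooth.

End DeformationSpace.

Arguments delta_minus {R M C} W N _.
Arguments normal_minus {R M C} W N _.
Arguments delta_minus_smooth {R M C} W N U f.
Arguments blowup_smooth {R M C} W N U f.
Arguments delta_minus_act {R M C} W N.
Arguments blowup_proj {R M C} W N phi.

(* Main.v *)
(* A character of the algebra of smooth functions is the evaluation at a point.
   Hence a point x of the deformation space has a base point p in M and a height
   t = x(z), and it is the evaluation at (p, t) when t <> 0.  Over a weighted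
   chart, x is determined by t and the values y_b of x on z^-w_b x_b; every (y, t)
   with (t^w_b y_b)_b in the chart occurs, by passing to the limit when t = 0.  The
   action of u multiplies y_b by u^w_b and t by u^-1.

   A point lies off N x R iff some homogeneous element of positive degree does not
   vanish there.  This gives freeness; and since such elements recover the factor u
   from x and u x, it gives properness and separates the orbits.

   Where eps y_a > 0 with w_a > 0 and eps = +-1, every orbit meets the slice
   y_a = eps exactly once.  On the slice, t can take the place of y_a, which gives
   coordinates v of the quotient, and (s, v) with s^w_a = eps y_a are coordinates
   upstairs in which the projection is (s, v) |-> v.  The sign of t distinguishes
   the three pieces of the quotient. *)

From HB Require Import structures.
From mathcomp Require Import all_boot all_order all_algebra generic_quotient.
From mathcomp Require Import all_classical all_reals all_analysis.
From mathcomp Require Import zify ring lra.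
Require Import Defs.
Set Implicit Arguments.
Unset Strict Implicit.
Unset Printing Implicit Defensive.
Import Order.TTheory GRing.Theory Num.Theory numFieldNormedType.Exports.
Local Open Scope classical_set_scope.
Local Open Scope ring_scope.

(** * Smooth functions on open subsets of R^n *)

Section Calculus.
Context {R : realType}.

(** The deformation space is never given a manifold structure as a whole. Charts are built only off
    the center, and directly in a form adapted to the action: s = (eps y_a)^(1/w_a) scales by u, y_b
    by u^w_b and t by u^-1, so t s and y_b / s^w_b are invariant, and these are the coordinates v.

    Two obstacles shape the work. Elements of the Rees algebra are made of global sections, while
    weighted coordinates are local; so coordinates and coefficients are cut off by bump functions,
    and a bump function, having degree 0, shows that a value on z^-i f depends only on f near the
    base point. Secondly, a generated smooth function is F of evaluations with F smooth on all of
    R^k, whereas a chart yields F on an open set only; so F is extended from its germ at each point.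

    Properness and the Hausdorff property are one statement about limits of pairs (u, z), applied to
    an ultrafilter and to the filter of pairs with z near x and u z near y. An element that is
    nonzero at x keeps u bounded, and one that is nonzero at y keeps u away from 0. *)

Fixpoint Ck n k (U : set 'rV[R]_n) (f : 'rV[R]_n -> R) : Prop :=
  (forall x, U x -> {for x, continuous f}) /\
  if k is k'.+1 then forall i : 'I_n,
    (forall x, U x -> derivable f x (delta_mx 0 i)) /\
    Ck k' U (fun x => 'D_(delta_mx 0 i) f x)
  else True.

Lemma CkS n k (U : set 'rV[R]_n) f : Ck k.+1 U f -> Ck k U f.
Proof.
elim: k f => [|k IH] f; first by case.
move=> [cf df]; split=> // i; have [df1 df2] := df i.
by split=> //; exact: IH.
Qed.

(** [iter_partial] applies the last index of the list first, so taking one derivative of [f] itself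
    corresponds to [rcons]. In the form [Ck] the closure properties can be proved by induction on
    the order. *)
Lemma smooth_onP n (U : set 'rV[R]_n) f :
  smooth_on U f <-> forall k, Ck k U f.
Proof.
split=> [sf k|Cf s].
  elim: k f sf => [|k IH] f sf.
    by split=> // x Ux; exact: (sf [::] x Ux).1.
  split=> [x Ux|i]; first exact: (sf [::] x Ux).1.
  split=> [x Ux|]; first exact: (sf [::] x Ux).2.
  by apply: IH => s x Ux; have := sf (rcons s i) x Ux; rewrite /iter_partial foldr_rcons.
elim/last_ind: s f Cf => [|s i IH] f Cf x Ux.
  have [cf df] := Cf 1%N; split; first exact: cf.
  by move=> i; exact: (df i).1.
have -> : iter_partial (rcons s i) f =
   iter_partial s (fun x => 'D_(delta_mx 0 i) f x) by rewrite /iter_partial foldr_rcons.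
by apply: IH => // k; have [_ /(_ i)[]] := Cf k.+1.
Qed.

Lemma continuous_at_eq (X Y : topologicalType) (U : set X) (f g : X -> Y) x :
  open U -> U x -> (forall y, U y -> f y = g y) ->
  {for x, continuous f} -> {for x, continuous g}.
Proof.
move=> oU Ux fg cf; rewrite /prop_for /continuous_at -fg //.
apply: cvg_trans cf; apply: near_eq_cvg.
by apply: filterS (open_nbhs_nbhs (conj oU Ux)) => y /fg /esym.
Qed.

Lemma Ck_eq n k (U : set 'rV[R]_n) f g : open U ->
  (forall x, U x -> f x = g x) -> Ck k U f -> Ck k U g.
Proof.
move=> oU; elim: k f g => [|k IH] f g fg.
  by move=> [cf _]; split=> // x Ux; apply: continuous_at_eq fg (cf x Ux).
move=> [cf df].
have nfg x : U x -> \forall y \near x, f y = g y.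
  by move=> Ux; apply: filterS (open_nbhs_nbhs (conj oU Ux)) => y; exact: fg.
split=> [x Ux|i]; first exact: continuous_at_eq fg (cf x Ux).
have [d1 d2] := df i; split=> [x Ux|].
  by apply: near_eq_derivable (d1 x Ux); exact: nfg.
apply: IH d2 => x Ux; apply: near_eq_derive; exact: nfg.
Qed.

Lemma Ck_cst n k (U : set 'rV[R]_n) c : Ck k U (fun=> c).
Proof.
elim: k c => [|k IH] c; first by split=> // x _; exact: cst_continuous.
split=> [x _|i]; first exact: cst_continuous.
split=> [x _|]; first exact: derivable_cst.
have -> // : (fun x => 'D_(delta_mx 0 i : 'rV[R]_n) (fun=> c) x) = (fun=> 0 : R).
by apply/funext => x; exact: derive_cst.
Qed.

Lemma CkD n k (U : set 'rV[R]_n) f g : open U ->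
  Ck k U f -> Ck k U g -> Ck k U (fun x => f x + g x).
Proof.
move=> oU; elim: k f g => [|k IH] f g [cf df] [cg dg].
  by split=> // x Ux; exact: (continuousD (cf x Ux) (cg x Ux)).
split=> [x Ux|i]; first by exact: (continuousD (cf x Ux) (cg x Ux)).
have [f1 f2] := df i; have [g1 g2] := dg i; split=> [x Ux|].
  by apply: derivableD; [exact: f1|exact: g1].
apply: Ck_eq (IH _ _ f2 g2) => // x Ux.
by rewrite -deriveD //; [exact: f1|exact: g1].
Qed.

Lemma CkM n k (U : set 'rV[R]_n) f g : open U ->
  Ck k U f -> Ck k U g -> Ck k U (fun x => f x * g x).
Proof.
move=> oU; elim: k f g => [|k IH] f g Cf Cg.
  move: Cf Cg => [cf _] [cg _].
  by split=> // x Ux; exact: (continuousM (cf x Ux) (cg x Ux)).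
have := Cf; have := Cg; move=> [cg dg] [cf df].
split=> [x Ux|i]; first by exact: (continuousM (cf x Ux) (cg x Ux)).
have [f1 f2] := df i; have [g1 g2] := dg i; split=> [x Ux|].
  by apply: derivableM; [exact: f1|exact: g1].
have H1 := IH _ _ (CkS Cf) g2; have H2 := IH _ _ (CkS Cg) f2.
apply: Ck_eq (CkD oU H1 H2) => // x Ux.
by rewrite (deriveM (f1 x Ux) (g1 x Ux)).
Qed.

Lemma Ck_sum n k (U : set 'rV[R]_n) (I : Type) (s : seq I) (P : pred I) F :
  open U -> (forall i, P i -> Ck k U (F i)) ->
  Ck k U (fun x => \sum_(i <- s | P i) F i x).
Proof.
move=> oU CF; elim: s => [|a s IH].
  by apply: Ck_eq (@Ck_cst _ _ _ 0) => // x _; rewrite big_nil.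
case Pa : (P a).
  by apply: Ck_eq (CkD oU (CF _ Pa) IH) => // x _; rewrite big_cons Pa.
by apply: Ck_eq IH => // x _; rewrite big_cons Pa.
Qed.

Lemma coord_derive n (i j : 'I_n) (x v : 'rV[R]_n) :
  is_derive x v (fun y : 'rV[R]_n => y 0 i) (v 0 i).
Proof.
have d := @differentiable_coord R 1%N n x 0 i.
apply: DeriveDef; first exact: diff_derivable.
rewrite deriveE //.
have lin : linear (fun y : 'rV[R]_n => y 0 i) by move=> a u w; rewrite !mxE.
pose L : {linear 'rV[R]_n -> R} := HB.pack (fun y : 'rV[R]_n => y 0 i)
  (GRing.isLinear.Build _ _ _ _ _ lin).
have -> : (fun y : 'rV[R]_n => y 0 i) = L by [].
by rewrite diff_lin //; exact: coord_continuous.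
Qed.

Lemma Ck_coord n k (U : set 'rV[R]_n) i : Ck k U (fun y => y 0 i).
Proof.
case: k => [|k]; first by split=> // x _; exact: coord_continuous.
split=> [x _|j]; first exact: coord_continuous.
split=> [x _|]; first by apply: diff_derivable; exact: differentiable_coord.
have -> : (fun x => 'D_(delta_mx 0 j : 'rV[R]_n) (fun y : 'rV[R]_n => y 0 i) x) =
  (fun=> (delta_mx 0 j : 'rV[R]_n) 0 i); last exact: Ck_cst.
by apply/funext => x; have := coord_derive i j x (delta_mx 0 j) => /@derive_val.
Qed.

Lemma is_derive_line n (f : 'rV[R]_n -> R) (y v : 'rV[R]_n) (s : R) :
  derivable f (s *: v + y) v ->
  is_derive s 1 (fun t : R => f (t *: v + y)) ('D_v f (s *: v + y)).
Proof.
have e : (fun h : R => h^-1 *: (f ((h *: (1 : R) + s) *: v + y) - f (s *: v + y)))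
   = (fun h : R => h^-1 *: (f (h *: v + (s *: v + y)) - f (s *: v + y))).
  by apply/funext => h; rewrite scalerDl addrA [h *: 1]mulr1.
by move=> df; apply: DeriveDef; rewrite /derivable /derive /= e.
Qed.

(** Increments of either sign occur: the two cases are the mean value theorem on [0, c] and on
    [c, 0]. *)
Lemma MVT_line n (f : 'rV[R]_n -> R) (y v : 'rV[R]_n) (c : R) :
  (forall s : R, `|s| <= `|c| -> derivable f (s *: v + y) v) ->
  exists2 s : R, `|s| <= `|c| & f (c *: v + y) - f y = c * 'D_v f (s *: v + y).
Proof.
move=> df; set g := fun t : R => f (t *: v + y).
have dg (s : R) : `|s| <= `|c| -> is_derive s 1 g ('D_v f (s *: v + y)).
  by move=> sc; apply: is_derive_line; exact: df.
have gc (a b : R) : (forall s : R, s \in `[a, b]%R -> `|s| <= `|c|) ->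
    {within `[a, b], continuous g}.
  move=> ab; apply: derivable_within_continuous => s /ab /dg.
  by move=> [].
have g0 : g 0 = f y by rewrite /g scale0r add0r.
case: (leP 0 c) => c0.
  have I (s : R) : s \in `[0, c]%R -> `|s| <= `|c|.
    by rewrite in_itv /= => /andP[s0 sc]; rewrite !ger0_norm.
  have [|||s sI e] := @MVT_segment R g (fun s => 'D_v f (s *: v + y)) 0 c.
  - exact: c0.
  - by move=> s; rewrite in_itv /= => /andP[s0 sc]; apply/dg/I; rewrite in_itv /= !ltW.
  - exact: gc.
  by exists s; [exact: I|rewrite -g0 e subr0 mulrC].
have I (s : R) : s \in `[c, 0]%R -> `|s| <= `|c|.
  by rewrite in_itv /= => /andP[s0 sc]; rewrite !ler0_norm ?lerN2 // ltW.
have [|||s sI e] := @MVT_segment R g (fun s => 'D_v f (s *: v + y)) c 0.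
- exact: ltW.
- by move=> s; rewrite in_itv /= => /andP[s0 sc]; apply/dg/I; rewrite in_itv /= !ltW.
- exact: gc.
exists s; first exact: I.
by rewrite -g0 -[LHS]opprK opprB e sub0r mulrN opprK mulrC.
Qed.

Lemma linear_pack (V W : lmodType R) (f : V -> W) :
  linear f -> exists L : {linear V -> W}, forall v, L v = f v.
Proof.
move=> lin; pose L : {linear V -> W} := HB.pack f (GRing.isLinear.Build _ _ _ _ _ lin).
by exists L.
Qed.

Lemma is_diff_bound (V W : normedModType R) (f : V -> W) (L : {linear V -> W}) x :
  continuous L ->
  (forall e : R, 0 < e -> \forall h \near (0 : V),
     `|f (h + x) - f x - L h| <= e * `|h|) ->
  is_diff x f L.
Proof.
move=> Lc Lb; have key : f \o shift x = cst (f x) + L +o_ 0 id.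
  apply/eqaddoP => e e0; apply: filterS (Lb e e0) => h /=.
  by rewrite -[(_ - _) h]/(f (h + x) - (f x + L h)) opprD addrA.
have dE := diff_unique Lc key.
by apply: DiffDef => //; apply/diff_locallyP; rewrite dE.
Qed.

(** The increment is split into n steps along the coordinate axes. On each step the mean value
    theorem produces a partial derivative at a point near x, and continuity of the partials compares
    it with the one at x. *)
Lemma C1_differentiable n (U : set 'rV[R]_n) (f : 'rV[R]_n -> R) x :
  open U -> U x -> Ck 1 U f -> differentiable f x.
Proof.
move=> oU Ux [_ Df].
have lin : linear (fun h : 'rV[R]_n => \sum_i h 0 i * 'D_(delta_mx 0 i : 'rV[R]_n) f x).
  move=> a u w; rewrite scaler_sumr -big_split /=; apply: eq_bigr => i _.
  by rewrite !mxE mulrDl [a *: (_ : R)]mulrA.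
have [L LE] : exists L : {linear 'rV[R]_n -> R},
    forall h, L h = \sum_i h 0 i * 'D_(delta_mx 0 i : 'rV[R]_n) f x.
  exact: linear_pack lin.
have Lc : continuous L.
  move=> h.
  have CL : Ck 0 setT L.
    apply: (@Ck_eq _ _ _ (fun h => \sum_i h 0 i * 'D_(delta_mx 0 i : 'rV[R]_n) f x)).
    - exact: openT.
    - by move=> y _; rewrite LE.
    apply: Ck_sum => [|i _]; first exact: openT.
    by apply: CkM; [exact: openT|exact: Ck_coord|exact: Ck_cst].
  by apply: CL.1.
suff key : is_diff x f L by [].
apply: is_diff_bound Lc _ => e e0.
  (* There are n steps, each of cost at most e' |h|; dividing by n.+1 keeps e' positive when n =
     0. *)
  pose e' := e / n.+1%:R.
  have e'0 : 0 < e' by rewrite divr_gt0.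
  have : \forall y \near x, U y /\ forall i : 'I_n,
      `|'D_(delta_mx 0 i : 'rV[R]_n) f x - 'D_(delta_mx 0 i : 'rV[R]_n) f y| <= e'.
    apply: filterI; first exact: open_nbhs_nbhs.
    apply: (@filter_forall _ _ _ (nbhs x)) => i.
    have [_ [dc _]] := Df i; have := dc x Ux.
    by move/cvgrPdist_le => /(_ _ e'0).
  move=> /nbhs_ballP[d /= d0 dP].
  apply/nbhs_ballP; exists d => // h /=; rewrite -ball_normE /= sub0r normrN => hd.
  have xB (z : 'rV[R]_n) : (forall i, `|z 0 i| <= `|h|) -> ball x d (z + x).
    move=> zh; rewrite -ball_normE /= opprD addrCA subrr addr0 normrN.
    apply: le_lt_trans hd; rewrite {1}/Num.Def.normr/= mx_normrE.
    apply: bigmax_le => // -[i j] _ /=; rewrite ord1; exact: zh.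
  have hi i : `|h 0 i| <= `|h|.
    rewrite {2}/Num.Def.normr/= mx_normrE.
    exact: (le_bigmax _ (fun ij : 'I_1 * 'I_n => `|h ij.1 ij.2|) (0, i)).
  (* [hh j] keeps the first j coordinates of h, so consecutive points differ along one axis and all
     stay in the sup-norm ball around x. *)
  pose hh (j : nat) : 'rV[R]_n := \row_i (if (i < j)%N then h 0 i else 0).
  have hhS (j : 'I_n) : hh j.+1 = h 0 j *: delta_mx 0 j + hh j.
    apply/rowP => i; rewrite !mxE eqxx ltnS leq_eqVlt /=.
    have [->|ij] := eqVneq i j; first by rewrite eqxx ltnn mulr1 addr0.
    by rewrite -(inj_eq val_inj) /= in ij; rewrite (negPf ij) mulr0 add0r.
  have hhn : hh n = h by apply/rowP => i; rewrite mxE ltn_ord.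
  have hh0 : hh 0%N = 0 by apply/rowP => i; rewrite !mxE.
  have step (j : 'I_n) : `|f (hh j.+1 + x) - f (hh j + x) -
       h 0 j * 'D_(delta_mx 0 j : 'rV[R]_n) f x| <= e' * `|h|.
    rewrite hhS -[_ + hh j + x]addrA.
    have Bs (s : R) : `|s| <= `|h 0 j| -> ball x d (s *: (delta_mx 0 j : 'rV[R]_n) + (hh j + x)).
      move=> sh; rewrite addrA; apply: xB => i; rewrite !mxE eqxx /=.
      have [->|ij] := eqVneq i j.
        by rewrite ltnn addr0 mulr1 (le_trans sh).
      by rewrite mulr0 add0r; case: ifP => _; rewrite ?normr0.
    have [s /Bs /dP[Us Ds]|s sh ->] := @MVT_line n f (hh j + x) (delta_mx 0 j) (h 0 j).
      by have [/(_ _ Us)] := Df j.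
    rewrite -mulrBr normrM mulrC ler_pM //.
    by have [_ /(_ j)] := dP _ (Bs _ sh); rewrite distrC.
  have -> : f (h + x) - f x - L h = \sum_(j < n) (f (hh j.+1 + x) - f (hh j + x) -
       h 0 j * 'D_(delta_mx 0 j : 'rV[R]_n) f x).
    rewrite sumrB LE; congr (_ - _).
    rewrite -(big_mkord xpredT (fun j => f (hh j.+1 + x) - f (hh j + x))).
    by rewrite telescope_sumr // hhn hh0 add0r.
  apply: le_trans (ler_norm_sum _ _ _) _.
  apply: le_trans (ler_sum _ (fun j _ => step j)) _.
  rewrite sumr_const card_ord -mulr_natl mulrA ler_wpM2r // /e'.
  by rewrite mulrA ler_pdivrMr // mulrC; apply: ler_wpM2l; rewrite ?ler_nat // ltW.
Qed.

Lemma Ck_le n k l (U : set 'rV[R]_n) f : (k <= l)%N -> Ck l U f -> Ck k U f.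
Proof.
elim: l => [|l IH]; first by rewrite leqn0 => /eqP ->.
by rewrite leq_eqVlt => /orP[/eqP -> //|kl] /CkS; exact: IH.
Qed.

Lemma Ck_differentiable n k (U : set 'rV[R]_n) (f : 'rV[R]_n -> R) x :
  open U -> U x -> Ck k.+1 U f -> differentiable f x.
Proof. by move=> oU Ux Cf; apply: C1_differentiable oU Ux _; exact: Ck_le Cf. Qed.

Lemma row_continuous_at (X : topologicalType) m (g : X -> 'rV[R]_m) x :
  (forall j, {for x, continuous (fun y => g y 0 j)}) -> {for x, continuous g}.
Proof.
move=> cg A [P PA sPA]; apply: filterS sPA _.
apply: (@filter_forall _ _ _ (nbhs x)) => i.
apply: (@filter_forall _ _ _ (nbhs x)) => j.
by have := PA i j; rewrite ord1; exact: cg.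
Qed.

Lemma row_differentiable (V : normedModType R) m (g : V -> 'rV[R]_m) x :
  (forall j, differentiable (fun y => g y 0 j) x) -> differentiable g x.
Proof.
move=> dg.
have -> : g = \sum_(j < m) (fun y => g y 0 j *: (delta_mx 0 j : 'rV[R]_m)).
  by apply/funext => y; rewrite fct_sumE -row_sum_delta.
by apply: differentiable_sum => j; apply: differentiableZl.
Qed.

Lemma derive_comp_row (V : normedModType R) m (f : 'rV[R]_m -> R) (g : V -> 'rV[R]_m) x v :
  differentiable f (g x) -> (forall j, differentiable (fun y => g y 0 j) x) ->
  'D_v (f \o g) x =
  \sum_j 'D_(delta_mx 0 j : 'rV[R]_m) f (g x) * 'D_v (fun y => g y 0 j) x.
Proof.
move=> df dg; have dgx := row_differentiable dg.
rewrite deriveE; last exact: differentiable_comp.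
have -> : 'd (f \o g) x v = 'd f (g x) ('D_v g x).
  by rewrite diff_comp //= [in RHS]deriveE.
rewrite derive_mx; last exact: diff_derivable.
rewrite [X in 'd _ _ X]row_sum_delta linear_sum; apply: eq_bigr => j _.
by rewrite linearZ mxE [in RHS]mulrC ['D__ f _]deriveE.
Qed.

Lemma Ck_comp n m k (U : set 'rV[R]_n) (V : set 'rV[R]_m) f g : open U -> open V ->
  (forall x, U x -> V (g x)) -> Ck k V f -> (forall j, Ck k U (fun x => g x 0 j)) ->
  Ck k U (f \o g).
Proof.
move=> oU oV UV; elim: k f => [|k IH] f Cf Cg.
  split=> // x Ux; apply: continuous_comp; last exact/Cf.1/UV.
  by apply: row_continuous_at => j; apply: (Cg j).1.
split=> [x Ux|i].
  apply: continuous_comp; last exact/Cf.1/UV.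
  by apply: row_continuous_at => j; apply: (Cg j).1.
have dg x j : U x -> differentiable (fun y => g y 0 j) x.
  by move=> Ux; apply: Ck_differentiable oU Ux (Cg j).
have df x : U x -> differentiable f (g x).
  by move=> /UV Vgx; apply: Ck_differentiable oV Vgx Cf.
split=> [x Ux|].
  apply/diff_derivable/differentiable_comp; last exact: df.
  by apply: row_differentiable => j; exact: dg.
have S : Ck k U (fun x => \sum_j 'D_(delta_mx 0 j : 'rV[R]_m) f (g x) *
      'D_(delta_mx 0 i : 'rV[R]_n) (fun y => g y 0 j) x).
  apply: Ck_sum => // j _; apply: CkM => //.
    apply: (IH (fun y => 'D_(delta_mx 0 j : 'rV[R]_m) f y)).
      by have [_ /(_ j)[]] := Cf.
    by move=> l; exact: CkS.
  by have [_ /(_ i)[]] := Cg j.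
apply: Ck_eq S => // x Ux; rewrite derive_comp_row //; first exact: df.
by move=> j; exact: dg.
Qed.

(* [fs] lists the successive derivatives of [fs 0] on [V]. *)
Lemma Ck_comp1 n k (U : set 'rV[R]_n) (V : set R) (fs : nat -> R -> R) g j :
  open U -> (forall l y, V y -> is_derive y 1 (fs l) (fs l.+1 y)) ->
  (forall x, U x -> V (g x)) -> Ck k U g -> Ck k U (fun x => fs j (g x)).
Proof.
move=> oU dfs UV; elim: k j => [|k IH] j Cg.
  split=> // x Ux; apply: (@continuous_comp _ _ _ g (fs j)); first exact: Cg.1.
  apply/differentiable_continuous/derivable1_diffP.
  by have [] := dfs j _ (UV _ Ux).
have df x : U x -> differentiable (fs j) (g x).
  by move=> /UV Vgx; apply/derivable1_diffP; have [] := dfs j _ Vgx.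
have dg x : U x -> differentiable g x by move=> Ux; apply: Ck_differentiable Cg.
split=> [x Ux|i].
  apply: (@continuous_comp _ _ _ g (fs j)); first exact: Cg.1.
  exact/differentiable_continuous/df.
split=> [x Ux|].
  by apply/diff_derivable/(@differentiable_comp _ _ _ _ g (fs j)); [exact: dg|exact: df].
have S : Ck k U (fun x => fs j.+1 (g x) * 'D_(delta_mx 0 i : 'rV[R]_n) g x).
  apply: CkM => //; first by apply: IH; exact: CkS.
  by have [_ /(_ i)[]] := Cg.
apply: Ck_eq S => // x Ux.
have dgx := dg _ Ux; have dfx := df _ Ux.
rewrite [RHS]deriveE; last exact: (@differentiable_comp _ _ _ _ g (fs j)).
rewrite (@diff_comp _ _ _ _ g (fs j)) //=.
rewrite [in LHS]deriveE // deriv1E; last by have [] := dfs j _ (UV _ Ux).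
by rewrite derive1E; have [_ ->] := dfs j _ (UV _ Ux); rewrite mulrC.
Qed.

Lemma smooth_onW n (U V : set 'rV[R]_n) f : V `<=` U -> smooth_on U f -> smooth_on V f.
Proof. by move=> VU sf s x /VU; exact: sf. Qed.

Lemma smooth_on_continuous n (U : set 'rV[R]_n) f x :
  smooth_on U f -> U x -> {for x, continuous f}.
Proof. by move=> sf Ux; have [] := sf [::] x Ux. Qed.

Lemma smooth_on_local n (U : set 'rV[R]_n) f :
  (forall x, U x -> exists V, [/\ open V, V x & smooth_on V f]) -> smooth_on U f.
Proof. by move=> H s x /H[V [_ Vx sV]]; exact: sV. Qed.

(** The successive derivatives of y^-1, in the form that [smooth_comp1] takes; shifted by one they
    also serve for the logarithm. *)
Lemma is_derive_invX l (y : R) : y != 0 ->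
  is_derive y 1 (fun y => (-1) ^+ l * l`!%:R * y^-1 ^+ l.+1)
    ((-1) ^+ l.+1 * l.+1`!%:R * y^-1 ^+ l.+2).
Proof.
move=> y0; have dV : is_derive y 1 (fun y : R => y^-1) (- y ^- 2).
  apply: DeriveDef; first exact: derivableV.
  by rewrite deriveV // derive_id /GRing.scale /= mulr1.
have := @is_deriveX _ _ (fun y : R => y^-1) l.+1 y 1 _ dV.
move=> /(is_deriveZ ((-1) ^+ l * l`!%:R)).
set F := (F in is_derive _ _ F _ -> _).
have -> : F = (fun y : R => (-1) ^+ l * l`!%:R * y^-1 ^+ l.+1).
  by apply/funext => z; rewrite /F /= exprfctE.
move=> H; apply: (@is_derive_eq _ _ _ _ _ _ _ _ H).
transitivity ((-1) ^+ l * l`!%:R * ((l.+1%:R * y^-1 ^+ l) * - y ^- 2)); first by [].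
by rewrite -exprVn factS natrM !exprS; ring.
Qed.

Section Closure.
Variables (n : nat) (U : set 'rV[R]_n).
Hypothesis oU : open U.

Lemma smooth_on_eq f g : (forall x, U x -> f x = g x) -> smooth_on U f -> smooth_on U g.
Proof. by move=> fg /smooth_onP Cf; apply/smooth_onP => k; apply: Ck_eq fg (Cf k). Qed.

Lemma smooth_cst c : smooth_on U (fun=> c).
Proof. by apply/smooth_onP => k; exact: Ck_cst. Qed.

Lemma smooth_coord i : smooth_on U (fun y => y 0 i).
Proof. by apply/smooth_onP => k; exact: Ck_coord. Qed.

Lemma smoothD f g : smooth_on U f -> smooth_on U g -> smooth_on U (fun x => f x + g x).
Proof. by move=> /smooth_onP Cf /smooth_onP Cg; apply/smooth_onP => k; exact: CkD. Qed.

Lemma smoothM f g : smooth_on U f -> smooth_on U g -> smooth_on U (fun x => f x * g x).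
Proof. by move=> /smooth_onP Cf /smooth_onP Cg; apply/smooth_onP => k; exact: CkM. Qed.

Lemma smoothN f : smooth_on U f -> smooth_on U (fun x => - f x).
Proof.
move=> sf; apply: smooth_on_eq (smoothM (smooth_cst (-1)) sf) => x _.
by rewrite mulN1r.
Qed.

Lemma smoothB f g : smooth_on U f -> smooth_on U g -> smooth_on U (fun x => f x - g x).
Proof. by move=> sf sg; exact: (smoothD sf (smoothN sg)). Qed.

Lemma smooth_sum (I : Type) (s : seq I) (P : pred I) F :
  (forall i, P i -> smooth_on U (F i)) ->
  smooth_on U (fun x => \sum_(i <- s | P i) F i x).
Proof.
by move=> sF; apply/smooth_onP => k; apply: Ck_sum => // i /sF /smooth_onP.
Qed.

Lemma smooth_prod (I : Type) (s : seq I) (P : pred I) F :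
  (forall i, P i -> smooth_on U (F i)) ->
  smooth_on U (fun x => \prod_(i <- s | P i) F i x).
Proof.
move=> sF; elim: s => [|a s IH].
  by apply: smooth_on_eq (smooth_cst 1) => // x _; rewrite big_nil.
case Pa : (P a).
  by apply: smooth_on_eq (smoothM (sF _ Pa) IH) => // x _; rewrite big_cons Pa.
by apply: smooth_on_eq IH => // x _; rewrite big_cons Pa.
Qed.

Lemma smoothX f k : smooth_on U f -> smooth_on U (fun x => f x ^+ k).
Proof.
move=> sf; elim: k => [|k IH].
  by apply: smooth_on_eq (smooth_cst 1) => // x _; rewrite expr0.
by apply: smooth_on_eq (smoothM sf IH) => // x _; rewrite exprS.
Qed.

Lemma smooth_comp m (V : set 'rV[R]_m) f g : open V ->
  (forall x, U x -> V (g x)) -> smooth_on V f ->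
  (forall j, smooth_on U (fun x => g x 0 j)) -> smooth_on U (f \o g).
Proof.
move=> oV UV /smooth_onP Cf Cg; apply/smooth_onP => k.
by apply: (Ck_comp oU oV UV) => // j; have /smooth_onP := Cg j.
Qed.

Lemma smooth_comp1 (V : set R) (fs : nat -> R -> R) g :
  (forall l y, V y -> is_derive y 1 (fs l) (fs l.+1 y)) ->
  (forall x, U x -> V (g x)) -> smooth_on U g -> smooth_on U (fun x => fs 0%N (g x)).
Proof.
move=> dfs UV /smooth_onP Cg; apply/smooth_onP => k.
exact: Ck_comp1 oU dfs UV (Cg k).
Qed.

Lemma smooth_expR g : smooth_on U g -> smooth_on U (fun x => expR (g x)).
Proof.
by move=> sg; apply: (@smooth_comp1 setT (fun=> expR)).
Qed.

Lemma smoothV g : (forall x, U x -> g x != 0) -> smooth_on U g ->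
  smooth_on U (fun x => (g x)^-1).
Proof.
move=> g0 sg.
pose fs l (y : R) := (-1) ^+ l * l`!%:R * y^-1 ^+ l.+1.
apply: (@smooth_on_eq (fun x => fs 0%N (g x))) => [x _|].
  by rewrite /fs fact0 expr0 !mul1r expr1.
by apply: (@smooth_comp1 [set y | y != 0]) g0 sg => l y y0; exact: is_derive_invX.
Qed.

Lemma smooth_ln g : (forall x, U x -> 0 < g x) -> smooth_on U g ->
  smooth_on U (fun x => ln (g x)).
Proof.
move=> g0 sg.
pose fs l (y : R) := if l is l'.+1 then (-1) ^+ l' * l'`!%:R * y^-1 ^+ l'.+1 else ln y.
apply: (@smooth_comp1 [set y | 0 < y] fs) g0 sg => -[|l] y y0.
  by rewrite /fs fact0 expr0 !mul1r expr1; exact: is_derive1_ln.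
by apply: is_derive_invX; rewrite gt_eqF.
Qed.

End Closure.

End Calculus.

#[local] Opaque smooth_on.

(** * Flat functions, bump functions and extension of germs *)

Section Bump.
Context {R : realType}.

Lemma horner_le_expR (P : {poly R}) : exists2 C : R, 0 <= C &
  forall u : R, 0 <= u -> `|P.[u]| <= C * expR u.
Proof.
exists (\sum_(i < size P) `|P`_i| * i`!%:R).
  by apply: sumr_ge0 => i _; rewrite mulr_ge0.
move=> u u0; rewrite horner_coef mulr_suml.
apply: le_trans (ler_norm_sum _ _ _) _; apply: ler_sum => i _.
rewrite normrM -mulrA ler_wpM2l // normrX ger0_norm //.
case: (i : nat) => [|k]; first by rewrite expr0 fact0 mul1r -expR0 ler_expR.
rewrite mulrC -ler_pdivrMr ?ltr0n ?fact_gt0 //.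
by apply: le_trans (expR_ge1Dxn k u0); rewrite ler_wpDl.
Qed.

(** A family containing e^(-1/x), extended by 0, and closed under differentiation, which replaces P
    by X^2 (P - P'). *)
Definition flat_exp (P : {poly R}) (x : R) : R :=
  if 0 < x then P.[x^-1] * expR (- x^-1) else 0.

(** Applying the exponential bound to P X^2 at u = 1/x leaves a factor x^2 to spare. This quadratic
    bound is what makes the derivative at 0 exist and vanish. *)
Lemma flat_exp_le (P : {poly R}) : exists2 C : R, 0 <= C &
  forall x, `|flat_exp P x| <= C * x ^+ 2.
Proof.
have [C C0 CP] := horner_le_expR (P * 'X^2); exists C => // x.
rewrite /flat_exp; case: ifPn => x0; last by rewrite normr0 mulr_ge0 // sqr_ge0.
have xV : 0 <= x^-1 by rewrite invr_ge0 ltW.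
have := CP _ xV; rewrite hornerM hornerXn [`|_ * x^-1 ^+ 2|]normrM [`|_ * expR _|]normrM
  (ger0_norm (expR_ge0 _)).
rewrite (ger0_norm (exprn_ge0 2 xV)) exprVn ler_pdivrMr ?exprn_gt0 // => CPx.
by rewrite expRN ler_pdivrMr ?expR_gt0 // -mulrA [_ ^+ 2 * _]mulrC mulrA.
Qed.

Lemma is_derive_flat_exp (P : {poly R}) (x : R) :
  is_derive x 1 (flat_exp P) (flat_exp ('X^2 * (P - P^`())) x).
Proof.
have [x0|x0|x0] := ltgtP x 0.
- rewrite {2}/flat_exp ltNge (ltW x0) /=.
  apply: (@near_eq_is_derive R R R (cst 0) _ x 1 0 _ (is_derive_cst 0 x 1)).
  by near=> y; rewrite /flat_exp ltNge ifN // negbK ltW //; near: y; exact: lt_nbhsl.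
- rewrite {2}/flat_exp x0.
  suff : is_derive x 1 (fun x => P.[x^-1] * expR (- x^-1))
     (('X^2 * (P - P^`())).[x^-1] * expR (- x^-1)).
    apply: near_eq_is_derive.
    by near=> y; rewrite /flat_exp ifT //; near: y; exact: lt_nbhsr.
  have xn0 : x != 0 by rewrite gt_eqF.
  have dV : is_derive x 1 (fun y : R => y^-1) (- x ^- 2).
    apply: DeriveDef; first exact: derivableV.
    by rewrite deriveV // derive_id /GRing.scale /= mulr1.
  have d1 := is_derive1_comp (is_derive_poly P x^-1) dV.
  have dN : is_derive x 1 (fun y : R => - y^-1) (- - x ^- 2) := is_deriveN dV.
  have d2 : is_derive x 1 (fun y : R => expR (- y^-1)) (expR (- x^-1) * (- - x ^- 2)).
    exact: (@is_derive1_comp _ expR (fun y => - y^-1)).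
  have := is_deriveM d1 d2.
  move=> H; apply: (@is_derive_eq _ _ _ _ _ _ _ _ H).
  rewrite !hornerE /= -exprVn.
  transitivity (P.[x^-1] * (expR (- x^-1) * (- - x^-1 ^+2)) + expR (- x^-1) * (P^`().[x^-1] * (- x^-1 ^+ 2))).
    by [].
  by ring.
- rewrite x0 {2}/flat_exp ltxx.
  have [C C0 CP] := flat_exp_le P.
  have [L LE] : exists L : {linear R -> R}, forall h, L h = 0.
    by apply: (linear_pack (f := fun=> 0)) => a u w; rewrite scaler0 addr0.
  have dL : is_diff (0 : R) (flat_exp P) L.
    apply: is_diff_bound => [|e e0].
      rewrite (_ : (L : R -> R) = cst 0); first exact: cst_continuous.
      by apply/funext => h; rewrite LE.
    have eC : 0 < e / (C + 1) by rewrite divr_gt0 // ltr_wpDl.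
    apply/nbhs_ballP; exists (e / (C + 1)) => // h; rewrite -ball_normE /= sub0r normrN => /ltW hC.
    rewrite LE addr0 subr0 {2}/flat_exp ltxx subr0.
    apply: le_trans (CP h) _; rewrite -real_normK ?num_real // expr2 mulrA ler_wpM2r //.
    apply: le_trans (ler_wpM2l C0 hC) _.
    by rewrite mulrA ler_pdivrMr ?ltr_wpDl // mulrC ler_wpM2l ?ltW // ltrDl.
  apply: DeriveDef; first exact: diff_derivable.
  by rewrite deriveE // diff_val LE.
Unshelve. all: by end_near. Qed.

Lemma smooth_flat_exp n (U : set 'rV[R]_n) g : open U -> smooth_on U g ->
  smooth_on U (fun x => flat_exp 1 (g x)).
Proof.
move=> oU; apply: (@smooth_comp1 _ _ _ oU setT
  (fun l => flat_exp (iter l (fun P => 'X^2 * (P - P^`())) 1))) => // l y _.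
exact: is_derive_flat_exp.
Qed.

Lemma flat_exp_gt0 x : 0 < x -> 0 < flat_exp 1 x.
Proof. by move=> x0; rewrite /flat_exp x0 hornerC mul1r expR_gt0. Qed.

Lemma flat_exp_eq0 x : x <= 0 -> flat_exp 1 x = 0.
Proof. by move=> x0; rewrite /flat_exp ltNge x0. Qed.

Lemma flat_exp_ge0 x : 0 <= flat_exp 1 x.
Proof.
by case: (leP x 0) => [/flat_exp_eq0 ->|/flat_exp_gt0 /ltW].
Qed.

Definition smooth_step (x : R) : R := flat_exp 1 x / (flat_exp 1 x + flat_exp 1 (1 - x)).

Lemma smooth_step_den x : 0 < flat_exp 1 x + flat_exp 1 (1 - x).
Proof.
case: (leP x 0) => [x0|/flat_exp_gt0 x0]; last by rewrite ltr_pwDl // flat_exp_ge0.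
by rewrite ltr_wpDl ?flat_exp_ge0 // flat_exp_gt0 // subr_gt0 (le_lt_trans x0).
Qed.

Lemma smooth_step0 x : x <= 0 -> smooth_step x = 0.
Proof. by move=> x0; rewrite /smooth_step flat_exp_eq0 // mul0r. Qed.

Lemma smooth_step1 x : 1 <= x -> smooth_step x = 1.
Proof.
move=> x1; have := smooth_step_den x; rewrite /smooth_step (@flat_exp_eq0 (1 - x)) ?subr_le0 //.
by rewrite addr0 => /lt0r_neq0 /divff.
Qed.

Lemma smooth_step_itv x : 0 <= smooth_step x <= 1.
Proof.
have d0 := smooth_step_den x.
rewrite /smooth_step divr_ge0 ?flat_exp_ge0 ?(ltW d0) //=.
by rewrite ler_pdivrMr // mul1r lerDl flat_exp_ge0.
Qed.

Lemma smooth_smooth_step n (U : set 'rV[R]_n) g : open U -> smooth_on U g ->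
  smooth_on U (fun x => smooth_step (g x)).
Proof.
move=> oU sg; rewrite /smooth_step.
apply: (smoothM oU); first exact: smooth_flat_exp.
apply: (smoothV oU) => [x _|]; first by rewrite lt0r_neq0 // smooth_step_den.
apply: (smoothD oU (smooth_flat_exp oU sg)); apply: (smooth_flat_exp oU).
exact: (smoothB oU (smooth_cst 1) sg).
Qed.

(** The squared Euclidean distance is used because the sup norm is not smooth. *)
Lemma rV_bump n (q : 'rV[R]_n) (O : set 'rV[R]_n) : open O -> O q ->
  exists B : 'rV[R]_n -> R, [/\ smooth_on setT B, forall y, 0 <= B y <= 1,
    \forall y \near q, B y = 1 &
    exists2 K, compact K & K `<=` O /\ forall y, ~ K y -> B y = 0].
Proof.
move=> oO Oq.
have /nbhs_ballP[d /= d0 dO] : nbhs q O by exact: open_nbhs_nbhs.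
(* [smooth_step (2 - S)] is 1 where S <= 1 and 0 where S >= 2; and S <= 2 bounds the squared
   Euclidean distance by d^2 / 2, hence gives a point of the sup-norm ball of radius d. *)
pose S (y : 'rV[R]_n) : R := 4 / d ^+ 2 * \sum_i (y 0 i - q 0 i) ^+ 2.
have oT : open [set: 'rV[R]_n] by exact: openT.
have sS : smooth_on setT S.
  apply: (smoothM oT (smooth_cst _)); apply: (smooth_sum oT) => i _.
  exact: (smoothX oT 2 (smoothB oT (smooth_coord i) (smooth_cst (q 0 i)))).
have cS : continuous S by move=> y; apply: smooth_on_continuous sS _.
have SB y : S y <= 2 -> ball q d y.
  move=> Sy; rewrite -ball_normE /= -normrN opprB {1}/Num.Def.normr/= mx_normrE.
  apply: bigmax_lt => // -[i j] _ /=; rewrite ord1 !mxE.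
  rewrite -(@ltr_pXn2r _ 2) ?nnegrE ?(ltW d0) // real_normK ?num_real //.
  have le : (y 0 j - q 0 j) ^+ 2 <= \sum_i (y 0 i - q 0 i) ^+ 2.
    by rewrite (bigD1 j) //= lerDl sumr_ge0 // => k _; rewrite sqr_ge0.
  apply: le_lt_trans le _; move: Sy; rewrite /S.
  rewrite -ler_pdivlMl ?divr_gt0 ?exprn_gt0 // invf_div => Sy.
  apply: le_lt_trans Sy _; have : 0 < d ^+ 2 by rewrite exprn_gt0.
  by lra.
exists (fun y => smooth_step (2 - S y)); split.
- exact: (smooth_smooth_step oT (smoothB oT (smooth_cst 2) sS)).
- by move=> y; exact: smooth_step_itv.
- have S0 : S q = 0.
    by rewrite /S big1 ?mulr0 // => i _; rewrite subrr expr0n.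
  have : \forall y \near q, S y < 1.
    have S1 : nbhs (S q) [set x | x < 1] by apply: lt_nbhsl; rewrite S0.
    exact: cS q _ S1.
  apply: filterS => y Sy; rewrite smooth_step1 //.
  by rewrite lerBrDr -lerBrDl; apply: le_trans (ltW Sy) _; lra.
exists (S @^-1` [set x | x <= 2]); last split.
- apply: bounded_closed_compact.
    exists (`|q| + d); split; first exact: num_real.
    move=> M M1 y /SB; rewrite -ball_normE /= => yq.
    rewrite ltW // (lt_trans _ M1) // -[y](subKr q) (le_lt_trans (ler_normB _ _)) //.
    by rewrite ltrD2l.
  exact: closed_comp (@closed_le _ 2).
- by move=> y Sy; apply: dO; exact: SB.
- move=> y /= /negP; rewrite -ltNge => Sy.
  by rewrite smooth_step0 // subr_le0 ltW.
Qed.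

(** Multiplying by a bump function removes the arbitrary values of f outside O without changing the
    germ at q. This supplies the globally smooth F that [generated_smooth] requires. *)
Lemma smooth_extension n (O : set 'rV[R]_n) f q : open O -> O q -> smooth_on O f ->
  exists2 g, smooth_on setT g & \forall y \near q, g y = f y.
Proof.
move=> oO Oq sf; have [B [sB _ B1 [K cK [KO K0]]]] := rV_bump oO Oq.
exists (fun y => B y * f y); last by apply: filterS B1 => y ->; rewrite mul1r.
apply: smooth_on_local => y _; have [Oy|nOy] := pselect (O y).
  exists O; split; [exact: oO|exact: Oy|].
  by apply: (smoothM oO _ sf); exact: smooth_onW sB.
have oK : open (~` K).
  by apply: closed_openC; apply: compact_closed cK; exact: norm_hausdorff.
exists (~` K); split => //; first by move=> /KO.
apply: (smooth_on_eq oK (f := fun=> 0)); last exact: smooth_cst.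
by move=> z /K0 ->; rewrite mul0r.
Qed.

End Bump.

(** * Function sheaves and characters of the algebra of smooth functions *)

Section Charts.
Context {R : realType} {n : nat} {X : topologicalType} {C : fun_family R X}.

Lemma open_of_nbhs (A : set X) : (forall x, A x -> nbhs x A) -> open A.
Proof. by rewrite openE => H x /H. Qed.

Section OneChart.
Context {U : set X} {phi : X -> 'rV[R]_n} {psi : 'rV[R]_n -> X}.
Hypothesis ch : is_chart C U phi psi.

Lemma chart_imK y : (phi @` U) y -> phi (psi y) = y.
Proof. by move=> [x Ux <-]; rewrite (chart_K ch). Qed.

Lemma chart_imE (V : set X) : V `<=` U ->
  phi @` V = [set y | (phi @` U) y /\ V (psi y)].
Proof.
move=> VU; apply/seteqP; split=> [_ [x Vx <-]|y /= [Uy Vy]].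
  by split; [exists x => //; exact: VU|rewrite (chart_K ch) //; exact: VU].
by exists (psi y) => //; exact: chart_imK.
Qed.

Lemma chart_im_open (V : set X) : open V -> V `<=` U -> open (phi @` V).
Proof.
move=> oV VU; rewrite chart_imE // openE => y [Uy Vy].
apply: filterI; first by apply: open_nbhs_nbhs; split => //; exact: chart_im ch.
exact: (chart_inv_cont ch Uy (open_nbhs_nbhs (conj oV Vy))).
Qed.

Lemma chart_preim_open (V : set 'rV[R]_n) : open V -> open (U `&` phi @^-1` V).
Proof.
move=> oV; apply: open_of_nbhs => x [Ux Vx]; apply: filterI.
  by apply: open_nbhs_nbhs; split => //; exact: chart_dom ch.
exact: (chart_cont ch Ux (open_nbhs_nbhs (conj oV Vx))).
Qed.

End OneChart.

Hypothesis sC : is_fun_sheaf C.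

Lemma sheaf_local (U : set X) (f : X -> R) : open U ->
  (forall p, U p -> exists V, [/\ open V, V p & C V f]) -> C U f.
Proof.
move=> oU H.
pose Us := [set V : set X | [/\ open V, V `<=` U & C V f]].
have -> : U = \bigcup_(V in Us) V.
  apply/seteqP; split=> [p Up|p [V [_ VU _] /VU //]].
  have [V [oV Vp CV]] := H _ Up; exists (V `&` U) => //.
  have oVU : open (V `&` U) by exact: openI.
  by split=> //; apply: (sheaf_res sC oV).
by apply: (sheaf_glue sC) => V [].
Qed.

Hypothesis charts : forall p, exists U (phi : X -> 'rV[R]_n) psi,
  U p /\ is_chart C U phi psi.

(** The sheaf axioms mention no algebraic operations; sums, products and inverses of sections are
    all obtained by composing with a smooth function in charts. *)
Lemma sheaf_comp k (O : set 'rV[R]_k) F (U : set X) (f : 'I_k -> X -> R) :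
  open O -> open U -> smooth_on O F -> (forall x, U x -> O (\row_i f i x)) ->
  (forall i, C U (f i)) -> C U (fun x => F (\row_i f i x)).
Proof.
move=> oO oU sF UO Cf; apply: sheaf_local => // p Up.
have [U0 [phi [psi [U0p ch]]]] := charts p.
pose V := U `&` U0; have oV : open V by apply: openI => //; exact: chart_dom ch.
have VU0 : V `<=` U0 by move=> x [].
exists V; split => //.
have oV' := chart_im_open ch oV VU0.
apply/(chart_smooth ch _ oV VU0).
apply: (@smooth_comp _ _ _ oV' _ O F (fun y => \row_i f i (psi y)) oO) => //.
  by move=> _ [x [Ux U0x] <-]; rewrite (chart_K ch U0x); exact: UO.
move=> i; have /(chart_smooth ch _ oV VU0) : C V (f i).
  by apply: (sheaf_res sC oU oV) => // x [].
by apply: smooth_on_eq => // y _; rewrite mxE.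
Qed.

Section Closure.
Variable U : set X.
Hypothesis oU : open U.

Lemma sheaf_cst c : C U (fun=> c).
Proof.
have := @sheaf_comp 0 setT (fun=> c) U (fun _ _ => 0) openT oU (smooth_cst c).
by apply => // -[].
Qed.

Lemma sheaf_comp1 (O : set R) (F : R -> R) f : open O ->
  smooth_on [set y : 'rV[R]_1 | O (y 0 0)] (fun y => F (y 0 0)) ->
  (forall x, U x -> O (f x)) -> C U f -> C U (fun x => F (f x)).
Proof.
move=> oO sF UO Cf.
have oO1 : open [set y : 'rV[R]_1 | O (y 0 0)].
  by apply: open_comp oO => y _; exact: coord_continuous.
have := @sheaf_comp 1 _ _ U (fun=> f) oO1 oU sF.
under [X in _ -> _ -> C U X]eq_fun do rewrite mxE.
by apply=> // x Ux /=; rewrite mxE; exact: UO.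
Qed.

Lemma sheaf_comp2 (F : R -> R -> R) f g :
  smooth_on setT (fun y : 'rV[R]_2 => F (y 0 0) (y 0 1)) ->
  C U f -> C U g -> C U (fun x => F (f x) (g x)).
Proof.
move=> sF Cf Cg.
have := @sheaf_comp 2 _ _ U (fun i => if i == 0 then f else g) openT oU sF.
under [X in _ -> _ -> C U X]eq_fun do rewrite !mxE.
by apply=> // i; case: ifP.
Qed.

Lemma sheafD f g : C U f -> C U g -> C U (fun x => f x + g x).
Proof.
apply: sheaf_comp2.
by apply: (smoothD openT); exact: smooth_coord.
Qed.

Lemma sheafM f g : C U f -> C U g -> C U (fun x => f x * g x).
Proof.
apply: sheaf_comp2.
by apply: (smoothM openT); exact: smooth_coord.
Qed.

Lemma sheafV f : (forall x, U x -> f x != 0) -> C U f -> C U (fun x => (f x)^-1).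
Proof.
have oO : open [set y : R | y != 0] by exact: open_neq.
have oO1 : open [set y : 'rV[R]_1 | y 0 0 != 0].
  by apply: (open_comp (f := fun y : 'rV[R]_1 => y 0 0)) oO => y _; exact: coord_continuous.
apply: (sheaf_comp1 oO).
by apply: (smoothV oO1) => //; exact: smooth_coord.
Qed.

Lemma sheaf_sum (I : Type) (s : seq I) (P : pred I) F :
  (forall i, P i -> C U (F i)) -> C U (fun x => \sum_(i <- s | P i) F i x).
Proof.
move=> CF; elim: s => [|a s IH].
  by under eq_fun do rewrite big_nil; exact: sheaf_cst.
under eq_fun do rewrite big_cons.
by case Pa : (P a) => //; apply: sheafD => //; exact: CF.
Qed.

Lemma sheaf_prod (I : Type) (s : seq I) (P : pred I) F :
  (forall i, P i -> C U (F i)) -> C U (fun x => \prod_(i <- s | P i) F i x).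
Proof.
move=> CF; elim: s => [|a s IH].
  by under eq_fun do rewrite big_nil; exact: sheaf_cst.
under eq_fun do rewrite big_cons.
by case Pa : (P a) => //; apply: sheafM => //; exact: CF.
Qed.

Lemma sheaf_continuous f x : U x -> C U f -> {for x, continuous f}.
Proof.
move=> Ux Cf; have [U0 [phi [psi [U0x ch]]]] := charts x.
pose V := U `&` U0; have oV : open V by apply: openI => //; exact: chart_dom ch.
have VU0 : V `<=` U0 by move=> y [].
have /(chart_smooth ch _ oV VU0) sf : C V f by apply: (sheaf_res sC oU oV) => // y [].
have Vx : (phi @` V) (phi x) by exists x.
have cf := smooth_on_continuous sf Vx.
apply: (@continuous_at_eq _ _ _ (f \o psi \o phi) f x oV) => //.
  by move=> y [_ U0y] /=; rewrite (chart_K ch).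
apply: continuous_comp; first exact: chart_cont ch _ U0x.
exact: cf.
Qed.

End Closure.
End Charts.

(** * Bump functions on a manifold *)

Section Bumps.
Context {R : realType} {n : nat} {M : topologicalType} {C : fun_family R M}.
Hypothesis hM : is_manifold n C.

(** A bump function of the chart is extended by 0. The extension is smooth because the compact set K
    is closed, M being Hausdorff, so that V and the complement of K form an open cover. *)
Lemma manifold_bump p (O : set M) : open O -> O p ->
  exists2 chi : M -> R, [/\ C setT chi, forall x, 0 <= chi x <= 1 &
     \forall x \near p, chi x = 1] &
  exists K, [/\ compact K, closed K, K `<=` O & forall x, ~ K x -> chi x = 0].
Proof.
move=> oO Op; have [U [phi [psi [Up ch]]]] := manifold_charts hM p.
have sC := manifold_sheaf hM.
pose V := O `&` U; have oV : open V by apply: openI => //; exact: chart_dom ch.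
have VU : V `<=` U by move=> x [].
have Vp : (phi @` V) (phi p) by exists p.
have [B [sB B01 B1 [K' cK' [K'V BK']]]] := rV_bump (chart_im_open ch oV VU) Vp.
pose K := psi @` K'.
have KV : K `<=` V.
  by move=> _ [y /K'V + <-]; rewrite (chart_imE ch VU) => -[].
have cK : compact K.
  apply: continuous_compact cK'; apply: continuous_in_subspaceT => y /set_mem /K'V.
  by rewrite (chart_imE ch VU) => -[Uy _]; exact: chart_inv_cont ch _ Uy.
have clK : closed K by apply: compact_closed cK; exact: manifold_hausdorff hM.
have oK : open (~` K) by exact: closed_openC.
pose chi x := if `[< V x >] then B (phi x) else 0.
have chiV x : V x -> chi x = B (phi x) by move=> Vx; rewrite /chi asboolT.
have chi0 x : ~ K x -> chi x = 0.
  move=> Kx; rewrite /chi; case: asboolP => // Vx; apply: BK' => K'x; apply: Kx.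
  by exists (phi x) => //; apply: (chart_K ch); exact: VU.
exists chi; last by exists K; split => // x /KV [].
split=> [|x|].
- apply: (sheaf_local sC) => [|x _]; first exact: openT.
  have [Vx|nVx] := pselect (V x).
    exists V; split => //; apply/(chart_smooth ch _ oV VU).
    have oV' := chart_im_open ch oV VU.
    apply: (smooth_on_eq oV' (f := B)); last by apply: smooth_onW sB.
    move=> y; rewrite (chart_imE ch VU) => -[Uy Vy] /=.
    by rewrite chiV // (chart_imK ch).
  exists (~` K); split => //; first by move=> /KV.
  apply: (sheaf_ext sC oK (f := fun=> 0)).
    by move=> y /chi0 ->.
  exact: sheaf_cst sC (manifold_charts hM) _ oK 0.
- by rewrite /chi; case: asboolP => // _; rewrite lexx ler01.
- have : \forall x \near p, B (phi x) = 1 by exact: (chart_cont ch Up B1).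
  have : \forall x \near p, V x by exact: open_nbhs_nbhs.
  by apply: filterS2 => x Vx; rewrite chiV.
Qed.

End Bumps.

(** The filter on finite lists generated by the sets of lists containing a given one turns the
    near-covering form of compactness into a finite subcover. *)
Lemma compact_finite_cover (T : topologicalType) (K : set T) (f : T -> set T) :
  compact K -> (forall x, K x -> nbhs x (f x)) ->
  exists s : seq T, forall y, K y -> exists2 x, x \in s & f x y.
Proof.
move=> /compact_near_coveringP cK Kf.
pose F : set_system (seq T) :=
  filter_from setT (fun s0 : seq T => [set s : seq T | {subset s0 <= s}]).
have FF : Filter F.
  apply: filter_from_filter; first by exists [::].
  move=> s1 s2 _ _; exists (s1 ++ s2) => // s sub.
  by split=> x xs; apply: sub; rewrite mem_cat xs ?orbT.
have := cK _ F (fun s y => exists2 x, x \in s & f x y) FF.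
case=> [x Kx|s _ Ps]; last by exists s; exact: Ps.
exists (f x, [set s : seq T | x \in s]) => /=.
  split; first exact: Kf.
  by exists [:: x] => // s; apply; rewrite mem_head.
by move=> [y s] /= [fxy xs]; exists x.
Qed.

(** * Characters of the algebra of smooth functions *)

Section FunctionAlgebraHom.
Context {R : realType} {n : nat} {M : topologicalType} {C : fun_family R M}.
Hypothesis hM : is_manifold n C.

Let sC := manifold_sheaf hM.
Let charts := manifold_charts hM.

(** Every bump function equals 1 on some basic open set, so one bump function for each basic set
    that admits one is enough, and there are countably many of these. *)
Lemma bump_sequence : exists chi : nat -> M -> R,
  [/\ forall k, C setT (chi k), forall k x, 0 <= chi k x <= 1,
      forall k, exists2 K, compact K & forall x, ~ K x -> chi k x = 0 &
      forall p : M, exists k, \forall x \near p, chi k x = 1].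
Proof.
have [B /countable_injP[i injB] [oB bB]] := manifold_countable hM.
pose good b (f : M -> R) := [/\ C setT f, forall x, 0 <= f x <= 1,
  exists2 K, compact K & forall x, ~ K x -> f x = 0 & forall x, b x -> f x = 1].
(* All natural numbers serve as indices; if k is not the code of a basic set with a bump function, f
   is 0. *)
have /choice[chi chiP] : forall k, exists f : M -> R,
    [/\ C setT f, forall x, 0 <= f x <= 1,
       exists2 K, compact K & forall x, ~ K x -> f x = 0 &
       forall b g, B b -> i b = k -> good b g -> forall x, b x -> f x = 1].
  move=> k.
  have [[b [f [Bb ib [Cf f01 Kf f1]]]]|nex] :=
      pselect (exists b f, [/\ B b, i b = k & good b f]).
    exists f; split => // b' g Bb' ib' _ x b'x; apply: f1.
    by rewrite (injB b b') ?inE // ib ib'.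
  exists (fun=> 0); split.
  - exact: sheaf_cst sC charts _ openT 0.
  - by move=> x; rewrite lexx ler01.
  - by exists set0; [exact: compact0|].
  - by move=> b g Bb ib gb; case: nex; exists b, g.
exists chi; split => [k|k x|k|p].
- by have [] := chiP k.
- by have [_ /(_ x)] := chiP k.
- by have [_ _] := chiP k.
have [f [Cf f01 f1] [K [cK _ _ fK]]] := manifold_bump hM openT (I : setT p).
have [b [Bb bp] bf] := bB p _ f1.
exists (i b); have [_ _ _ Pb] := chiP (i b).
apply: filterS (open_nbhs_nbhs (conj (oB _ Bb) bp)) => x bx.
by apply: (Pb b f) => //; split => //; exists K.
Qed.

(** eta_k = chi_k (1 - chi_0) ... (1 - chi_(k-1)) telescopes to a partition of unity, and f is the
    sum of k eta_k. It is locally finite, as all terms after an index with chi_k = 1 vanish; and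
    where chi_0, ..., chi_(m-1) vanish only the terms with k >= m remain. *)
Lemma exhaustion : exists (chi : nat -> M -> R) (f : M -> R),
  [/\ C setT f, forall k, C setT (chi k),
      forall k, exists2 K, compact K & forall x, ~ K x -> chi k x = 0 &
      forall m x, (forall k, (k < m)%N -> chi k x = 0) -> m%:R <= f x].
Proof.
have [chi [Cchi chi01 chiK chi1]] := bump_sequence.
pose eta k x := chi k x * \prod_(j < k) (1 - chi j x).
have eta0 k m x : chi k x = 1 -> (k < m)%N -> eta m x = 0.
  by move=> k1 km; rewrite /eta (bigD1 (Ordinal km)) //= k1 subrr mul0r mulr0.
have eta_ge0 k x : 0 <= eta k x.
  rewrite /eta mulr_ge0 //; first by case/andP: (chi01 k x).
  by apply: prodr_ge0 => j _; rewrite subr_ge0; case/andP: (chi01 j x).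
have eta_sum m x : \sum_(k < m) eta k x = 1 - \prod_(k < m) (1 - chi k x).
  elim: m => [|m IH]; first by rewrite !big_ord0 subrr.
  by rewrite !big_ord_recr /= IH /eta; ring.
have /choice[N N1] x : exists k, chi k x = 1.
  by have [k /nbhs_singleton] := chi1 x; exists k.
pose S m x : R := \sum_(k < m) k%:R * eta k x.
have S_eq k m x : chi k x = 1 -> (k < m)%N -> S m x = S k.+1 x.
  move=> k1; elim: m => // m IH; rewrite ltnS leq_eqVlt => /orP[/eqP -> //|km].
  by rewrite /S big_ord_recr /= (eta0 k) // mulr0 addr0; exact: IH.
pose f x := S (N x).+1 x.
have fE k m x : chi k x = 1 -> (k < m)%N -> f x = S m x.
  move=> k1 km; rewrite /f (S_eq k m) //.
  have [kN|kN] := leqP k.+1 (N x).+1; first by rewrite (S_eq k).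
  by rewrite (S_eq (N x) k.+1) // ltnW.
exists chi, f; split => //.
- apply: (sheaf_local sC) => [|p _]; first exact: openT.
  have [k k1] := chi1 p.
  have /nbhs_interior pk := k1.
  exists (interior [set x | chi k x = 1]); split; [exact: open_interior|exact: nbhs_singleton pk|].
  apply: (sheaf_ext sC (open_interior _) (f := S k.+1)).
    by move=> x /interior_subset /= kx; rewrite (fE k k.+1).
  apply: (sheaf_res sC openT (open_interior _) (fun _ _ => I)).
  apply: (sheaf_sum sC charts openT) => j _.
  apply: (sheafM sC charts openT); first exact: sheaf_cst sC charts _ openT _.
  apply: (sheafM sC charts openT) => //.
  apply: (sheaf_prod sC charts openT) => l _.
  apply: (sheaf_comp2 sC charts openT (F := fun a b => a - b)).
  + by apply: (smoothB openT); exact: smooth_coord.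
  + exact: sheaf_cst sC charts _ openT 1.
  + exact: Cchi.
- move=> m x chi0; pose L := maxn m (N x).+1.
  have NL : (N x < L)%N by rewrite leq_max ltnSn orbT.
  rewrite (fE (N x) L) //.
  have : \sum_(k < L) eta k x = 1.
    rewrite eta_sum (bigD1 (Ordinal NL)) //= N1 subrr mul0r subr0 //.
  move=> e1; apply: (@le_trans _ _ (m%:R * \sum_(k < L) eta k x)); first by rewrite e1 mulr1.
  rewrite mulr_sumr; apply: ler_sum => k _.
  have [km|mk] := ltnP k m; first by rewrite /eta chi0 // !mul0r !mulr0.
  by apply: ler_wpM2r; rewrite ?ler_nat.
Qed.

(* Finitely many functions of the kernel of h have a common zero, as otherwise
   their sum of squares is invertible.  With chi = h chi among the equations the
   zeros lie in the compact support of chi; a function f >= m off the supports of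
   chi_0, ..., chi_(m-1) provides a chi with h chi <> 0. *)
Lemma hom_is_evaluation (h : (M -> R) -> R) :
  h (fun=> 1) = 1 ->
  (forall f g, C setT f -> C setT g -> h (fun x => f x + g x) = h f + h g) ->
  (forall c f, C setT f -> h (fun x => c * f x) = c * h f) ->
  (forall f g, C setT f -> C setT g -> h (fun x => f x * g x) = h f * h g) ->
  exists p, forall f, C setT f -> h f = f p.
Proof.
move=> h1 hD hZ hMu.
have Ccst c : C setT (fun=> c) by exact: sheaf_cst sC charts _ openT c.
have CD := sheafD sC charts openT.
have CM := sheafM sC charts openT.
have hc c : h (fun=> c) = c.
  rewrite -[RHS]mulr1 -h1 -(hZ c _ (Ccst 1)); congr h.
  by apply/funext => x; rewrite mulr1.
have CB c f : C setT f -> C setT (fun x => f x - c).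
  by move=> Cf; apply: (CD f (fun=> - c)).
have hB c f : C setT f -> h (fun x => f x - c) = h f - c.
  by move=> Cf; rewrite hD // hc.
have CQ f : C setT f -> C setT (fun x => (f x - h f) * (f x - h f)).
  by move=> Cf; apply: CM; exact: CB.
have hQ f : C setT f -> h (fun x => (f x - h f) * (f x - h f)) = 0.
  by move=> Cf; rewrite (hMu _ _ (CB _ _ Cf) (CB _ _ Cf)) hB // subrr mul0r.
(* A function without zeros is invertible, and h of an invertible function is not 0. *)
have no_pos g : C setT g -> h g = 0 -> exists x, g x = 0.
  move=> Cg hg; apply: contrapT => /forallNP g0.
  have Cgi : C setT (fun x => (g x)^-1).
    by apply: (sheafV sC charts openT) => // x _; apply/eqP.
  have := hMu _ _ Cg Cgi; rewrite hg mul0r.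
  have -> : (fun x => g x * (g x)^-1) = fun=> 1.
    by apply/funext => x; rewrite divff //; apply/eqP.
  by rewrite h1 => /eqP; rewrite oner_eq0.
have CS (I : Type) (s : seq I) F : (forall i, C setT (F i)) ->
    C setT (fun x => \sum_(i <- s) F i x ^+ 2).
  move=> CF; apply: (sheaf_sum sC charts openT) => i _.
  by under eq_fun do rewrite expr2; exact: CM.
have hS (I : Type) (s : seq I) F : (forall i, C setT (F i)) ->
    h (fun x => \sum_(i <- s) F i x ^+ 2) = \sum_(i <- s) h (F i) ^+ 2.
  move=> CF; elim: s => [|a s IH].
    by under eq_fun do rewrite big_nil; rewrite big_nil hc.
  under eq_fun do rewrite big_cons expr2.
  rewrite hD; [|exact: CM|exact: CS].
  by rewrite big_cons -IH hMu // expr2.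
have [chi [f [Cf Cchi chiK fm]]] := exhaustion.
have [k hk] : exists k, h (chi k) <> 0.
  apply: contrapT => /forallNP hchi.
  (* With h f < m, a common zero x of f - h f and chi_0, ..., chi_(m-1) would give m <= f x = h
     f. *)
  have [m hm] : exists m : nat, h f < m%:R.
    exists (Num.bound `|h f|).
    by apply: le_lt_trans (archi_boundP (normr_ge0 _)); exact: ler_norm.
  have Cg : C setT (fun x => (f x - h f) * (f x - h f) +
      \sum_(k <- iota 0 m) chi k x ^+ 2).
    by apply: (CD (fun x => (f x - h f) * (f x - h f))); [exact: CQ|exact: CS].
  have hg0 : h (fun x => (f x - h f) * (f x - h f) +
      \sum_(k <- iota 0 m) chi k x ^+ 2) = 0.
    rewrite (hD (fun x => (f x - h f) * (f x - h f))); [|exact: CQ|exact: CS].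
    rewrite hQ // add0r hS // big1 // => j _; rewrite (_ : h (chi j) = 0) ?expr0n //.
    exact: contrapT (hchi j).
  have [x] := no_pos _ Cg hg0; rewrite -expr2 => /eqP.
  rewrite paddr_eq0 ?sqr_ge0 //; last by apply: sumr_ge0 => *; exact: sqr_ge0.
  rewrite expf_eq0 /= subr_eq0 => /andP[/eqP fx]; rewrite psumr_eq0; last first.
    by move=> *; exact: sqr_ge0.
  move=> /allP chi0; have : m%:R <= f x.
    apply: fm => j jm; apply/eqP; rewrite -[_ == _](expf_eq0 _ 2).
    by have := chi0 j; rewrite mem_iota /= add0n jm => /(_ isT).
  by rewrite fx leNgt hm.
have [K cK K0] := chiK k.
(* A common zero of the kernel suffices, since g - h g lies in the kernel for every g. *)
suff [p hp] : exists p, forall g, C setT g -> h g = 0 -> g p = 0.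
  exists p => g Cg; have := hp _ (CB (h g) _ Cg); rewrite hB // subrr.
  by move=> /(_ erefl) /subr0_eq.
apply: contrapT => /forallNP Hno.
have /choice[F FP] p : exists g, [/\ C setT g, h g = 0 & g p <> 0].
  apply: contrapT => /forallNP Hp; apply: (Hno p) => g Cg hg.
  by apply: contrapT => gp; apply: (Hp g).
have CF p : C setT (F p) by have [] := FP p.
have [|D KD] := @compact_finite_cover _ _ (fun p => [set x | F p x != 0]) cK.
  move=> p _; have [_ _ /eqP Fp] := FP p.
  have : nbhs (F p p) [set y | y != 0] by apply: open_nbhs_nbhs; split => //; exact: open_neq.
  exact: (sheaf_continuous sC charts openT I (CF p)).
have Cg : C setT (fun x => (chi k x - h (chi k)) * (chi k x - h (chi k)) +
      \sum_(p <- D) F p x ^+ 2).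
  by apply: (CD (fun x => (chi k x - _) * _)); [exact: CQ|exact: CS].
have hg0 : h (fun x => (chi k x - h (chi k)) * (chi k x - h (chi k)) +
      \sum_(p <- D) F p x ^+ 2) = 0.
  rewrite (hD (fun x => (chi k x - _) * _)); [|exact: CQ|exact: CS].
  by rewrite hQ // add0r hS // big1 // => j _; have [_ -> _] := FP j; rewrite expr0n.
have [x] := no_pos _ Cg hg0; rewrite -expr2 => /eqP.
rewrite paddr_eq0 ?sqr_ge0 //; last by apply: sumr_ge0 => *; exact: sqr_ge0.
rewrite expf_eq0 /= subr_eq0 => /andP[/eqP chix]; rewrite psumr_eq0; last first.
  by move=> *; exact: sqr_ge0.
move=> /allP FD0; have [Kx|nKx] := pselect (K x).
  have [p Dp /=] := KD _ Kx; have := FD0 p Dp => /=.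
  by rewrite expf_eq0 /= => ->.
by apply: hk; rewrite -chix K0.
Qed.

End FunctionAlgebraHom.

(** * Homogeneous elements of the Rees algebra *)

Section FiniteSums.
Context {R : realType}.

Lemma fsum_seq (I : choiceType) (s : seq I) (F : I -> R) : uniq s ->
  (forall i, i \notin s -> F i = 0) -> \sum_(i \in [set: I]) F i = \sum_(i <- s) F i.
Proof.
move=> us F0; rewrite [RHS]fsbig_seq //; apply/esym/fsbig_widen => // i [_ /= /negP].
exact: F0.
Qed.

Lemma fsum1 (I : choiceType) (i0 : I) (F : I -> R) :
  (forall i, i != i0 -> F i = 0) -> \sum_(i \in [set: I]) F i = F i0.
Proof.
by move=> F0; rewrite (fsum_seq (s := [:: i0])) ?big_seq1 // => i; rewrite inE; exact: F0.
Qed.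

End FiniteSums.

(** * Products in the filtration *)

Section Filtration.
Context {R : realType} {n r : nat} {M : topologicalType} {C : fun_family R M}.
Context {W : ideal_filtration C} {N : set M}.
Hypotheses (hM : is_manifold n C) (hW : is_weighted_pair n r W N).

Lemma fil_le i j (U : set M) f : open U -> (i <= j)%N -> W j U f -> W i U f.
Proof.
move=> oU; elim: j => [|j IH]; first by rewrite leqn0 => /eqP ->.
by rewrite leq_eqVlt => /orP[/eqP -> //|ij] /(fil_decr oU); exact: IH.
Qed.

Lemma fil_C i (U : set M) f : open U -> W i U f -> C U f.
Proof. by move=> oU /(fil_le oU (leq0n i)) /(fil_zero W f oU). Qed.

Lemma fil_sum i (U : set M) (I : Type) (s : seq I) (P : pred I) F : open U ->
  (forall k, P k -> W i U (F k)) -> W i U (fun x => \sum_(k <- s | P k) F k x).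
Proof.
move=> oU WF; elim: s => [|a s IH].
  by under eq_fun do rewrite big_nil; exact: fil0.
under eq_fun do rewrite big_cons.
by case Pa : (P a) => //; apply: filD => //; exact: WF.
Qed.

Lemma fil_ext i (U : set M) f g : open U -> (forall x, U x -> f x = g x) ->
  W i U f -> W i U g.
Proof. by move=> oU fg; exact: (sheaf_ext (fil_sheaf W i) oU fg). Qed.

(** Multiplicativity of the filtration comes from the local model: in the product of two expansions
    the exponents, hence the weights, add up. *)
Lemma fil_mul i j f g : W i setT f -> W j setT g ->
  W (i + j)%N setT (fun x => f x * g x).
Proof.
move=> Wf Wg; apply: (sheaf_local (fil_sheaf W _)) => [|p _]; first exact: openT.
have [U [phi [psi [w [Up ch _ Wch]]]]] := weighting_charts hW p.
have oU := chart_dom ch.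
exists U; split => //.
have /Wch[m [a [s [aP fE]]]] : W i U f.
  exact: (sheaf_res (fil_sheaf W i) openT oU (fun _ _ => I) Wf).
have /Wch[m' [a' [s' [aP' gE]]]] : W j U g.
  exact: (sheaf_res (fil_sheaf W j) openT oU (fun _ _ => I) Wg).
apply: (@fil_ext _ _ (fun x => \sum_k \sum_l (a k x * a' l x) *
  \prod_b (phi x 0 b) ^+ (s k b + s' l b)) _ oU).
  move=> x Ux; rewrite fE // gE // mulr_suml; apply: eq_bigr => k _.
  rewrite mulr_sumr; apply: eq_bigr => l _.
  rewrite mulrACA -big_split /=; congr (_ * _).
  by apply: eq_bigr => b _; rewrite exprD.
apply: fil_sum => // k _; apply: fil_sum => // l _; apply/Wch.
exists 1%N, (fun=> fun x => a k x * a' l x), (fun _ b => (s k b + s' l b)%N).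
split=> [_|x Ux]; last by rewrite big_ord1.
have [Ca sa] := aP k; have [Ca' sa'] := aP' l; split.
  exact: (sheafM (manifold_sheaf hM) (manifold_charts hM) oU).
under eq_bigr do rewrite mulnDl.
by rewrite big_split /= leq_add.
Qed.

Lemma glob_C i f : glob W i f -> C setT f.
Proof. exact: fil_C openT. Qed.

Lemma globD i f g : glob W i f -> glob W i g -> glob W i (fun x => f x + g x).
Proof. exact: filD openT. Qed.

Lemma globZ i c f : glob W i f -> glob W i (fun x => c * f x).
Proof. exact: filZ openT. Qed.

Lemma glob0 i : glob W i (fun=> 0).
Proof. exact: fil0 openT. Qed.

Lemma glob_sum i (I : Type) (s : seq I) F : (forall k, glob W i (F k)) ->
  glob W i (fun x => \sum_(k <- s) F k x).
Proof. by move=> WF; apply: (@fil_sum _ _ _ s xpredT F openT) => k _; exact: WF. Qed.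

Lemma glob_le i j f : i <= j -> glob W j f -> glob W i f.
Proof.
case: i j => [i|i] [j|j] // ij; apply: (fil_le openT) => //.
Qed.

Lemma glob_neg i f : i <= 0 -> C setT f -> glob W i f.
Proof.
by move=> i0 Cf; apply: (@glob_le _ 0) => //; apply/(fil_zero W f openT).
Qed.

(** A negative degree stands for the whole algebra, that is for degree 0; when one occurs, the
    product is formed with 0 in its place and the degree is lowered to i + j. *)
Lemma globM i j f g : glob W i f -> glob W j g -> glob W (i + j) (fun x => f x * g x).
Proof.
move=> Wf Wg; case: i j Wf Wg => [i|i] [j|j] Wf Wg.
- exact: fil_mul Wf Wg.
- apply: (@glob_le _ i%:Z); first by lia.
  have := @fil_mul i 0 _ _ Wf Wg; by rewrite addn0.
- apply: (@glob_le _ j%:Z); first by lia.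
  exact: @fil_mul 0 j _ _ Wf Wg.
- apply: (@glob_le _ 0%:Z) => //.
  exact: @fil_mul 0 0 _ _ Wf Wg.
Qed.

Lemma globMC i f g : C setT f -> glob W i g -> glob W i (fun x => f x * g x).
Proof. exact: filM openT. Qed.

End Filtration.

(** * Morphisms of the Rees algebra and their homogeneous components *)

Section Rees.
Context {R : realType} {n r : nat} {M : topologicalType} {C : fun_family R M}.
Context {W : ideal_filtration C} {N : set M}.

Lemma rees_eqP (a b : rees W) : (forall i x, \val a i x = \val b i x) -> a = b.
Proof. by move=> ab; apply/val_inj/funext => i; apply/funext => x. Qed.

Lemma rees_glob (a : rees W) i : glob W i (\val a i).
Proof. by have [_] := set_valP a. Qed.

Lemma rees_supp (a : rees W) : exists2 s : seq int, uniq s &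
  forall i, i \notin s -> \val a i = fun=> 0.
Proof.
have [/finite_seqP[s sE] _] := set_valP a; exists (undup s); first exact: undup_uniq.
move=> i; rewrite mem_undup => ni; apply: contrapT => ai.
have : [set i | \val a i <> fun=> 0] i by [].
by rewrite sE /= (negPf ni).
Qed.

Lemma mono_subproof (i : int) (f : M -> R) (Wf : glob W i f) :
  rees W (fun j => if j == i then f else fun=> 0).
Proof.
split=> [|j]; last by case: eqP => [->//|_]; exact: glob0.
apply: (@sub_finite_set _ _ [set i]); last exact: finite_set1.
by move=> j /=; case: eqP => // _; case.
Qed.

(* The homogeneous element z^-i f, with the junk value 0 for f not in C_(i). *)
Definition mono (i : int) (f : M -> R) : rees W :=
  if pselect (glob W i f) is left Wf then subelt (mono_subproof Wf)
  else subelt (mono_subproof (glob0 i)).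

Lemma monoE i f : glob W i f -> \val (mono i f) = fun j => if j == i then f else fun=> 0.
Proof. by rewrite /mono; case: pselect. Qed.

Lemma rees_scale_mono (u : R) i f : glob W i f ->
  rees_scale u (mono i f) = mono i (fun x => u ^ i * f x).
Proof.
move=> Wf; apply: rees_eqP => j x /=; rewrite !monoE //; last exact: globZ.
by case: eqP => [->//|_]; rewrite mulr0.
Qed.

(** The value on z^-i f. Morphisms are studied through these forms on the homogeneous components,
    which determine them. *)
Definition dg (phi : rees W -> R) (i : int) (f : M -> R) : R := phi (mono i f).

Section Hom.
Variable phi : rees W -> R.
Hypothesis hphi : rees_hom phi.
Hypotheses (hM : is_manifold n C) (hW : is_weighted_pair n r W N).

Lemma dgD i f g : glob W i f -> glob W i g ->
  dg phi i (fun x => f x + g x) = dg phi i f + dg phi i g.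
Proof.
move=> Wf Wg; apply: (homD hphi); apply/funext => j; apply/funext => x.
rewrite !monoE //; last exact: globD.
by case: eqP => //; rewrite addr0.
Qed.

Lemma dgZ i c f : glob W i f -> dg phi i (fun x => c * f x) = c * dg phi i f.
Proof.
move=> Wf; apply: (homZ hphi); apply/funext => j; apply/funext => x.
rewrite !monoE //; last exact: globZ.
by case: eqP => //; rewrite mulr0.
Qed.

Lemma dg0 i : dg phi i (fun=> 0) = 0.
Proof.
rewrite -[RHS](mul0r (dg phi i (fun=> 0))) -dgZ; last exact: glob0.
by congr dg; apply/funext => x; rewrite mulr0.
Qed.

Lemma dgM i j f g : glob W i f -> glob W j g ->
  dg phi (i + j) (fun x => f x * g x) = dg phi i f * dg phi j g.
Proof.
move=> Wf Wg; apply: (homM hphi); apply/funext => k; apply/funext => x.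
rewrite /laurentM !monoE //; last exact: (globM hM hW).
rewrite (fsum1 (i0 := i)) => [|l li]; last by rewrite (negPf li) mul0r.
rewrite eqxx subr_eq addrC; case: eqP => // _; by rewrite mulr0.
Qed.

Lemma dg1 : dg phi 0 (fun=> 1) = 1.
Proof.
apply: (hom1 hphi); rewrite monoE.
  by apply/funext => i; apply/funext => x; rewrite /laurent1; case: eqP.
apply: glob_neg => //.
exact: (sheaf_cst (manifold_sheaf hM) (manifold_charts hM) openT 1).
Qed.

Lemma dg_sum i (I : Type) (s : seq I) F : (forall k, glob W i (F k)) ->
  dg phi i (fun x => \sum_(k <- s) F k x) = \sum_(k <- s) dg phi i (F k).
Proof.
move=> WF; elim: s => [|a s IH].
  by under eq_fun do rewrite big_nil; rewrite big_nil dg0.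
under eq_fun do rewrite big_cons.
by rewrite dgD ?big_cons ?IH //; exact: glob_sum.
Qed.

Lemma hom_seq (s : seq int) (a : rees W) : uniq s ->
  (forall i, i \notin s -> \val a i = fun=> 0) ->
  phi a = \sum_(i <- s) dg phi i (\val a i).
Proof.
elim: s a => [|i s IH] a; [move=> _ a0|rewrite cons_uniq => /andP[nis us] a0].
  rewrite big_nil -[RHS](mul0r (phi a)); apply: (homZ hphi).
  by apply/funext => i; apply/funext => x; rewrite a0 // mul0r.
have rP : rees W (fun j => if j == i then fun=> 0 else \val a j).
  split=> [|j]; last by case: eqP => _; [exact: glob0|exact: rees_glob].
  apply: sub_finite_set (set_valP a).1 => j /=; by case: eqP.
pose b := subelt rP.
rewrite (homD hphi (a := mono i (\val a i)) (b := b)); last first.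
  apply/funext => j; apply/funext => x; rewrite monoE /=; last exact: rees_glob.
  by case: eqP => [->|_]; rewrite ?addr0 ?add0r.
rewrite big_cons; congr (_ + _); rewrite (IH b) //.
  apply: eq_big_seq => j js; congr dg => /=.
  by case: eqP => // ji; rewrite -ji js in nis.
move=> j js /=; case: eqP => // /eqP ji; apply: a0.
by rewrite inE negb_or ji.
Qed.

Lemma hom_fsum (a : rees W) : phi a = \sum_(i \in [set: int]) dg phi i (\val a i).
Proof.
have [s us a0] := rees_supp a.
rewrite (hom_seq us a0) (fsum_seq us) // => i /a0 ->; exact: dg0.
Qed.

End Hom.

Lemma hom_ext (phi psi : rees W -> R) : rees_hom phi -> rees_hom psi ->
  (forall i f, glob W i f -> dg phi i f = dg psi i f) -> phi = psi.
Proof.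
move=> hphi hpsi e; apply/funext => a.
rewrite (hom_fsum hphi) (hom_fsum hpsi); apply: eq_fsbigr => i _.
by apply: e; exact: rees_glob.
Qed.

Hypotheses (hM : is_manifold n C) (hW : is_weighted_pair n r W N).

(* A morphism is the same thing as a multiplicative family of linear forms on
   the homogeneous components. *)
Lemma graded_hom (L : int -> (M -> R) -> R) :
  L 0 (fun=> 1) = 1 ->
  (forall i f g, glob W i f -> glob W i g -> L i (fun x => f x + g x) = L i f + L i g) ->
  (forall i c f, glob W i f -> L i (fun x => c * f x) = c * L i f) ->
  (forall i j f g, glob W i f -> glob W j g ->
     L (i + j) (fun x => f x * g x) = L i f * L j g) ->
  rees_hom (fun a : rees W => \sum_(i \in [set: int]) L i (\val a i)).
Proof.
move=> L1 LD LZ LM.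
have L0 i : L i (fun=> 0) = 0.
  rewrite -[RHS](mul0r (L i (fun=> 0))) -LZ; last exact: glob0.
  by congr L; apply/funext => x; rewrite mulr0.
split=> [a ea|a b c ec|l a c ec|a b c ec].
- rewrite (fsum1 (i0 := 0)) => [|i i0]; last first.
    by rewrite ea -(L0 i); congr L; apply/funext => x; rewrite /laurent1 (negPf i0).
  by rewrite ea -L1; congr L; apply/funext => x; rewrite /laurent1.
- have [s us a0] := rees_supp a; have [t ut b0] := rees_supp b.
  have uu : uniq (undup (s ++ t)) by exact: undup_uniq.
  have nin i : i \notin undup (s ++ t) -> i \notin s /\ i \notin t.
    by rewrite mem_undup mem_cat negb_or => /andP.
  rewrite !(fsum_seq uu).
  + by rewrite -big_split /=; apply: eq_bigr => i _; rewrite ec LD //; exact: rees_glob.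
  + by move=> i /nin[_ /b0 ->].
  + by move=> i /nin[/a0 -> _].
  + move=> i /nin[/a0 ai /b0 bi]; rewrite ec ai bi -[RHS](L0 i); congr L.
    by apply/funext => x; rewrite addr0.
- rewrite mulr_fsumr; apply: eq_fsbigr => i _; rewrite ec LZ //; exact: rees_glob.
- have [s us a0] := rees_supp a; have [t ut b0] := rees_supp b.
  (* All degrees in which the product can be nonzero; for i in s the list contains the translate of
     t by i, so that [shift] can reindex the convolution. *)
  pose v := undup [seq i + j | i <- s, j <- t].
  have uv : uniq v by exact: undup_uniq.
  have shift (F : int -> R) i : i \in s -> (forall j, j \notin t -> F j = 0) ->
      \sum_(k <- v) F (k - i) = \sum_(j <- t) F j.
    move=> si F0.
    have ut' : uniq [seq i + j | j <- t] by rewrite map_inj_uniq //; exact: addrI.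
    have -> : \sum_(j <- t) F j = \sum_(k <- [seq i + j | j <- t]) F (k - i).
      by rewrite big_map; apply: eq_bigr => j _; rewrite addrC addKr.
    rewrite -(fsum_seq (F := fun k => F (k - i)) uv).
      rewrite (fsum_seq ut') // => k nk; apply: F0; apply: contra nk => kt.
      by apply/mapP; exists (k - i) => //; rewrite addrC subrK.
    move=> k nk; apply: F0; apply: contra nk => kt; rewrite mem_undup.
    by apply/allpairsP; exists (i, k - i); split => //=; rewrite addrC subrK.
  have cE k x : \val c k x = \sum_(i <- s) \val a i x * \val b (k - i) x.
    by rewrite ec /laurentM (fsum_seq us) // => i /a0 ->; rewrite mul0r.
  have Wab k j : glob W k (fun x => \val a j x * \val b (k - j) x).
    rewrite -[X in glob _ X](subrKC j k).
    by apply: (globM hM hW); exact: rees_glob.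
  have LE k : L k (\val c k) = \sum_(i <- s) L i (\val a i) * L (k - i) (\val b (k - i)).
    have -> : \val c k = fun x => \sum_(i <- s) \val a i x * \val b (k - i) x.
      by apply/funext => x.
    elim: (s) => [|i s' IH].
      by under eq_fun do rewrite big_nil; rewrite big_nil.
    under eq_fun do rewrite big_cons.
    rewrite LD // ?big_cons ?IH; last exact: glob_sum.
    by rewrite -LM; [rewrite subrKC|exact: rees_glob|exact: rees_glob].
  rewrite (fsum_seq uv); last first.
    move=> k nk; rewrite LE big1_seq // => i /andP[_ si].
    have -> : \val b (k - i) = fun=> 0.
      apply: b0; apply: contra nk => kt; rewrite mem_undup.
      by apply/allpairsP; exists (i, k - i); split => //=; rewrite addrC subrK.
    by rewrite L0 mulr0.
  under eq_bigr do rewrite LE.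
  rewrite exchange_big /= (fsum_seq us) => [|i /a0 -> //].
  rewrite (fsum_seq ut) => [|j /b0 -> //].
  rewrite mulr_suml; apply: eq_big_seq => i si; rewrite -mulr_sumr; congr (_ * _).
  by apply: (shift (fun j => L j (\val b j))) => // j /b0 ->.
Qed.

End Rees.

Local Notation dspace W := (@delta _ _ _ W).

(** * Base point, height and topology of the deformation space *)

Section Points.
Context {R : realType} {n r : nat} {M : topologicalType} {C : fun_family R M}.
Context {W : ideal_filtration C} {N : set M}.
Hypotheses (hM : is_manifold n C) (hW : is_weighted_pair n r W N).

Let sC := manifold_sheaf hM.
Let charts := manifold_charts hM.

Lemma C_glob0 f : C setT f -> glob W 0 f.
Proof. exact: glob_neg. Qed.

Lemma C_cst c : C setT (fun=> c).
Proof. exact: (sheaf_cst sC charts openT c). Qed.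

Definition hm (x : dspace W) : rees_hom (\val x) := set_valP x.

Lemma delta_ext (x y : dspace W) :
  (forall i f, glob W i f -> dg (\val x) i f = dg (\val y) i f) -> x = y.
Proof. by move=> e; apply/val_inj; apply: hom_ext e; exact: hm. Qed.

Lemma base_exists (x : dspace W) : exists p, forall f, C setT f -> dg (\val x) 0 f = f p.
Proof.
apply: (hom_is_evaluation hM).
- exact: (dg1 (hm x) hM).
- by move=> f g Cf Cg; apply: (dgD (hm x)); exact: C_glob0.
- by move=> c f Cf; apply: (dgZ (hm x)); exact: C_glob0.
- move=> f g Cf Cg.
  by have := dgM (hm x) hM hW (C_glob0 Cf) (C_glob0 Cg); rewrite addr0.
Qed.

Definition base (x : dspace W) : M := sval (cid (base_exists x)).

Lemma dg_base (x : dspace W) f : C setT f -> dg (\val x) 0 f = f (base x).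
Proof. by move=> Cf; rewrite /base; case: cid => p /= ->. Qed.

Lemma C_bump p (O : set M) : open O -> O p ->
  exists chi : M -> R, [/\ C setT chi, chi p = 1 & forall x, ~ O x -> chi x = 0].
Proof.
move=> oO Op; have [chi [Cchi _ /nbhs_singleton chi1] [K [_ _ KO K0]]] :=
  manifold_bump hM oO Op.
by exists chi; split => // x nOx; apply: K0 => /KO.
Qed.

Lemma C_separates p q : (forall f, C setT f -> f p = f q) -> p = q.
Proof.
move=> H; apply: contrapT => pq; have haus := manifold_hausdorff hM.
have oq : open (~` [set q]).
  by apply: closed_openC; apply: accessible_closed_set1; exact: hausdorff_accessible.
have [chi [Cchi chi1 chi0]] := C_bump oq pq.
have := H _ Cchi; rewrite chi1 (chi0 q) => [/eqP|]; last by apply.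
by rewrite oner_eq0.
Qed.

Lemma base_unique (x : dspace W) p : (forall f, C setT f -> dg (\val x) 0 f = f p) -> base x = p.
Proof. by move=> H; apply: C_separates => f Cf; rewrite -H // dg_base. Qed.

(* The value of [x] on z, that is, pi x. *)
Definition height (x : dspace W) : R := dg (\val x) (-1) (fun=> 1).

(** z^-(i - k) f is the product of z^k and z^-i f, and x takes the value [height x] on z. *)
Lemma dg_down (x : dspace W) (k : nat) i f : glob W i f ->
  dg (\val x) (i - k%:Z) f = height x ^+ k * dg (\val x) i f.
Proof.
move=> Wf; elim: k => [|k IH]; first by rewrite subr0 expr0 mul1r.
have Wk : glob W (i - k%:Z) f by apply: glob_le Wf; lia.
have := dgM (hm x) hM hW (glob_neg (isT : (-1 : int) <= 0) (C_cst 1)) Wk.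
rewrite IH exprS -mulrA => <-; congr dg; first by lia.
by apply/funext => y; rewrite mul1r.
Qed.

(** In degree 0 the value is f at the base point, and [dg_down] links degree 0 to every other
    degree; in positive degree this requires dividing by a power of the height. *)
Lemma dg_height (x : dspace W) i f : height x != 0 -> glob W i f ->
  dg (\val x) i f = height x ^ (- i) * f (base x).
Proof.
move=> t0 Wf; have Cf := glob_C Wf; rewrite -(dg_base x Cf).
case: i Wf => k Wf.
  have := dg_down x k Wf; rewrite subrr => ->.
  by rewrite mulrA -exprnN mulVf ?mul1r // expf_neq0.
have := dg_down x k.+1 (C_glob0 Cf); rewrite sub0r -NegzE => ->.
by rewrite NegzE opprK -exprnP.
Qed.

Lemma is_pointP p t (x : dspace W) :
  is_point p t x <-> (forall i f, glob W i f -> dg (\val x) i f = t ^ (- i) * f p).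
Proof.
split=> [H i f Wf|H a].
  rewrite /dg H (fsum1 (i0 := i)) => [|j ji]; first by rewrite monoE // eqxx.
  by rewrite monoE // (negPf ji) mulr0.
rewrite (hom_fsum (hm x)); apply: eq_fsbigr => i _.
by rewrite H //; exact: rees_glob.
Qed.

Lemma is_point_height (x : dspace W) : height x != 0 -> is_point (base x) (height x) x.
Proof. by move=> t0; apply/is_pointP => i f Wf; exact: dg_height. Qed.

Lemma point_exists p t : t != 0 -> exists x : dspace W, is_point p t x.
Proof.
move=> t0.
have hp : rees_hom (fun a : rees W => \sum_(i \in [set: int]) t ^ (- i) * \val a i p).
  apply: (graded_hom hM hW (L := fun i f => t ^ (- i) * f p)).
  - by rewrite oppr0 expr0z mul1r.
  - by move=> i f g _ _; rewrite mulrDr.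
  - by move=> i c f _; rewrite mulrCA.
  - by move=> i j f g _ _; rewrite opprD expfzDr // mulrACA.
by exists (subelt (A := dspace W) hp).
Qed.

Lemma is_point_inj p t (x y : dspace W) : is_point p t x -> is_point p t y -> x = y.
Proof. by move=> px py; apply/val_inj/funext => a; rewrite px py. Qed.

Lemma is_point_base p t (x : dspace W) : is_point p t x -> base x = p.
Proof.
move=> /is_pointP px; apply: base_unique => f Cf.
by rewrite px ?oppr0 ?expr0z ?mul1r //; exact: C_glob0.
Qed.

Lemma is_point_heightE p t (x : dspace W) : is_point p t x -> height x = t.
Proof.
move=> /is_pointP px; rewrite /height px ?opprK ?expr1z ?mulr1 //.
exact: glob_neg (C_cst 1).
Qed.

Lemma is_point_dg p t (x : dspace W) i f : is_point p t x -> glob W i f ->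
  dg (\val x) i f = t ^ (- i) * f p.
Proof. by move=> /is_pointP; exact. Qed.

Lemma glob_vanish i f p : 0 < i -> glob W i f -> N p -> f p = 0.
Proof.
move=> i0 Wf Np; have W1 : glob W 1 f by apply: (glob_le _ Wf); lia.
by have [/(_ W1) [_ /(_ p I Np)]] := weighting_vanishing hW f openT.
Qed.

Lemma off_N p : ~ N p -> exists2 f, glob W 1 f & f p != 0.
Proof.
move=> nNp; have oN : open (~` N) by apply: closed_openC; exact: weighting_closed hW.
have [chi [Cchi chi1 chi0]] := C_bump oN nNp.
exists chi; last by rewrite chi1 oner_eq0.
apply/(weighting_vanishing hW chi openT); split => // q _ Nq.
by apply: chi0; apply.
Qed.

Lemma center_dg (x : dspace W) i f : center N x -> 0 < i -> glob W i f -> dg (\val x) i f = 0.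
Proof.
move=> [p [t [Np pt]]] i0 Wf; rewrite (is_point_dg pt Wf).
by rewrite (glob_vanish i0 Wf Np) mulr0.
Qed.

(** If all elements of positive degree vanish at x, then x is the point (base, height) of the
    center. The base lies in N, since otherwise some f of degree 1 is nonzero there, while f (base
    x) is the height times the value of x on z^-1 f. *)
Lemma off_center (x : dspace W) : ~ center N x ->
  exists (k : nat) f, glob W k.+1 f /\ dg (\val x) k.+1 f != 0.
Proof.
move=> nc; apply: contrapT => H; apply: nc.
have x0 (k : nat) f : glob W k.+1 f -> dg (\val x) k.+1 f = 0.
  by move=> Wf; apply/eqP; apply: contrapT => /negP xf; apply: H; exists k, f.
have Nb : N (base x).
  apply: contrapT => /off_N[f Wf]; rewrite -(dg_base x (glob_C Wf)).
  have := dg_down x 1 Wf; rewrite subrr => ->.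
  by rewrite (x0 0%N) // mulr0 eqxx.
exists (base x), (height x); split => //.
have [t0|] := eqVneq (height x) 0; last exact: is_point_height.
apply/is_pointP => i f Wf; have Cf := glob_C Wf; case: i Wf => [[|k]|k] Wf.
- by rewrite oppr0 expr0z mul1r dg_base.
- by rewrite x0 // (glob_vanish _ Wf Nb) ?mulr0.
- have := dg_down x k.+1 (C_glob0 Cf); rewrite sub0r -NegzE => ->.
  by rewrite t0 expr0n mul0r NegzE opprK -exprnP expr0n mul0r.
Qed.

Lemma dg_scale (u : R) (u0 : u != 0) (x : dspace W) i f : glob W i f ->
  dg (\val (delta_scale u0 x)) i f = u ^ i * dg (\val x) i f.
Proof. by move=> Wf; rewrite -(dgZ (hm x)) // /dg /= rees_scale_mono. Qed.

Lemma height_scale (u : R) (u0 : u != 0) (x : dspace W) : height (delta_scale u0 x) = u^-1 * height x.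
Proof. by rewrite /height dg_scale //; exact: glob_neg (C_cst 1). Qed.

Lemma base_scale (u : R) (u0 : u != 0) (x : dspace W) : base (delta_scale u0 x) = base x.
Proof.
apply: base_unique => f Cf; rewrite dg_scale ?expr0z ?mul1r ?dg_base //.
exact: C_glob0.
Qed.

(** A bump function of degree 0 that is 1 at the base point can be multiplied in without changing
    the value. *)
Lemma dg_local (x : dspace W) (O : set M) i f g : open O -> O (base x) ->
  glob W i f -> glob W i g -> (forall y, O y -> f y = g y) ->
  dg (\val x) i f = dg (\val x) i g.
Proof.
move=> oO Ox Wf Wg fg; have [chi [Cchi chi1 chi0]] := C_bump oO Ox.
have E h : glob W i h -> dg (\val x) i h = dg (\val x) i (fun y => chi y * h y).
  move=> Wh; have := dgM (hm x) hM hW (C_glob0 Cchi) Wh.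
  by rewrite add0r dg_base // chi1 mul1r.
rewrite E // (E g) //; congr dg; apply/funext => y.
have [Oy|nOy] := pselect (O y); first by rewrite fg.
by rewrite chi0 // !mul0r.
Qed.

Lemma glob_exp i k f : glob W i f -> glob W (i *+ k) (fun y => f y ^+ k).
Proof.
move=> Wf; elim: k => [|k IH].
  by under eq_fun do rewrite expr0; rewrite mulr0n; apply: C_glob0; exact: C_cst.
by under eq_fun do rewrite exprS; rewrite mulrS; exact: (globM hM hW).
Qed.

Lemma dg_exp (x : dspace W) i k f : glob W i f ->
  dg (\val x) (i *+ k) (fun y => f y ^+ k) = dg (\val x) i f ^+ k.
Proof.
move=> Wf; elim: k => [|k IH].
  by rewrite mulr0n expr0 -[RHS](dg1 (hm x) hM); congr dg; apply/funext => y; rewrite expr0.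
have -> : (fun y => f y ^+ k.+1) = fun y => f y * f y ^+ k by apply/funext => y; rewrite exprS.
by rewrite mulrS (dgM (hm x) hM hW) // ?exprS ?IH //; exact: glob_exp.
Qed.

Section Monomial.
Variables (I : Type) (w : I -> int) (xi : I -> M -> R).
Hypothesis Wxi : forall b, glob W (w b) (xi b).

Lemma glob_monomial (s : seq I) (e : I -> nat) :
  glob W (\sum_(b <- s) w b *+ e b) (fun y => \prod_(b <- s) xi b y ^+ e b).
Proof.
elim: s => [|b s IH].
  have -> : (fun y => \prod_(b <- [::]) xi b y ^+ e b) = fun=> 1.
    by apply/funext => y; rewrite big_nil.
  by rewrite big_nil; apply: C_glob0; exact: C_cst.
have -> : (fun y => \prod_(c <- b :: s) xi c y ^+ e c) =
    fun y => xi b y ^+ e b * \prod_(c <- s) xi c y ^+ e c.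
  by apply/funext => y; rewrite big_cons.
by rewrite big_cons; apply: (globM hM hW) => //; exact: glob_exp.
Qed.

Lemma dg_monomial (x : dspace W) (s : seq I) (e : I -> nat) :
  dg (\val x) (\sum_(b <- s) w b *+ e b) (fun y => \prod_(b <- s) xi b y ^+ e b) =
  \prod_(b <- s) dg (\val x) (w b) (xi b) ^+ e b.
Proof.
elim: s => [|b s IH].
  rewrite !big_nil -[RHS](dg1 (hm x) hM); congr dg; apply/funext => y; by rewrite big_nil.
have -> : (fun y => \prod_(c <- b :: s) xi c y ^+ e c) =
    fun y => xi b y ^+ e b * \prod_(c <- s) xi c y ^+ e c.
  by apply/funext => y; rewrite big_cons.
rewrite !big_cons (dgM (hm x) hM hW) ?dg_exp ?IH //.
  exact: glob_exp.
exact: glob_monomial.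
Qed.

End Monomial.

Lemma continuous_ev (a : rees W) : continuous (@ev _ _ _ W a).
Proof.
move=> x; apply: (@continuous_comp _ (prod_topology (fun _ : rees W => R)) _ set_val
  (fun f : prod_topology (fun _ : rees W => R) => f a) x).
  exact: initial_continuous.
exact: (@proj_continuous _ (fun=> R) a).
Qed.

Lemma delta_cvgP (F : set_system (dspace W)) (x : dspace W) : Filter F ->
  (forall a, @ev _ _ _ W a @ F --> ev a x) -> F --> x.
Proof.
move=> FF H A; rewrite nbhsE => -[B [[B' oB' <-] B'x] BA].
apply: filterS BA _.
have cvgF : (fun y : dspace W => \val y : prod_topology (fun _ : rees W => R)) @ F -->
    (\val x : prod_topology (fun _ : rees W => R)).
  apply/cvg_sup => a D; rewrite nbhsE => -[E [[E' oE' <-] E'x] ED].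
  by apply: filterS ED _; apply: H; apply: open_nbhs_nbhs.
by apply: cvgF; apply: open_nbhs_nbhs.
Qed.

Lemma delta_continuous_at (X : topologicalType) (g : X -> dspace W) x :
  (forall a, {for x, continuous (fun y => ev a (g y))}) -> {for x, continuous g}.
Proof. by move=> H; apply: delta_cvgP => a; exact: H. Qed.

Lemma delta_minus_cvgP (F : set_system (delta_minus W N)) (x : delta_minus W N) :
  Filter F -> (forall a, (fun y : delta_minus W N => ev a (\val y)) @ F --> ev a (\val x)) ->
  F --> x.
Proof.
move=> FF H A; rewrite nbhsE => -[B [[B' oB' <-] B'x] BA].
apply: filterS BA _.
have cvgF : (fun y : delta_minus W N => \val y) @ F --> \val x by apply: delta_cvgP.
by apply: cvgF; apply: open_nbhs_nbhs.
Qed.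

Lemma delta_minus_continuous_at (X : topologicalType) (g : X -> delta_minus W N) x :
  (forall a, {for x, continuous (fun y => ev a (\val (g y)))}) -> {for x, continuous g}.
Proof. by move=> H; apply: delta_minus_cvgP => a; exact: H. Qed.

Lemma continuous_val : continuous (fun y : delta_minus W N => \val y).
Proof. exact: initial_continuous. Qed.

Lemma continuous_dg i f : continuous (fun x : dspace W => dg (\val x) i f).
Proof. exact: continuous_ev. Qed.

(** The value on a bump function chi is chi at the base point, so a neighborhood is cut out by one
    evaluation being nonzero. *)
Lemma open_base (O : set M) : open O -> open [set x : dspace W | O (base x)].
Proof.
move=> oO; apply: open_of_nbhs => x Ox.
have [chi [Cchi chi1 chi0]] := C_bump oO Ox.
have : nbhs (dg (\val x) 0 chi) [set t : R | t != 0].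
  by apply: open_nbhs_nbhs; split; [exact: open_neq|rewrite /= dg_base // chi1 oner_eq0].
move=> /(@continuous_dg 0 chi x) H.
apply: (@filterS _ (nbhs x) _ _ _ _ H) => y /=; rewrite dg_base // => chiy.
by apply: contrapT => /chi0 chi0y; rewrite chi0y eqxx in chiy.
Qed.

End Points.

(** * Freeness and properness *)

Section FreeProper.
Context {R : realType} {n r : nat} {M : topologicalType} {C : fun_family R M}.
Context {W : ideal_filtration C} {N : set M}.
Hypotheses (hM : is_manifold n C) (hW : is_weighted_pair n r W N).

Local Notation T := (delta_minus W N).
Local Notation a := (delta_minus_act W N).

Definition dgm (x : T) (i : int) (f : M -> R) : R := dg (\val (\val x)) i f.

Lemma dgm_pos t (t0 : 0 < t) (x : T) i f : glob W i f ->
  dgm (act_pos a t0 x) i f = t ^ i * dgm x i f.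
Proof. by move=> Wf; rewrite /dgm dg_scale. Qed.

Lemma off_center_minus (x : T) :
  exists (k : nat) f, glob W k.+1 f /\ dgm x k.+1 f != 0.
Proof. by apply: (off_center hM hW); have := set_valP x. Qed.

Lemma T_ext (x y : T) : (forall i f, glob W i f -> dgm x i f = dgm y i f) -> x = y.
Proof. by move=> e; apply/val_inj/delta_ext. Qed.

Lemma continuous_dgm i f : continuous (fun x : T => dgm x i f).
Proof.
move=> x; apply: (@continuous_comp _ _ _ (fun x : T => \val x)
  (fun y : dspace W => dg (\val y) i f)); first exact: continuous_val.
exact: continuous_dg.
Qed.

Lemma T_cvgP (F : set_system T) (x : T) : Filter F ->
  (forall i f, glob W i f -> (fun y : T => dgm y i f) @ F --> dgm x i f) -> F --> x.
Proof.
move=> FF H; apply: delta_minus_cvgP => b; have [s us b0] := rees_supp b.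
have E (y : T) : ev b (\val y) = \sum_(i <- s) dgm y i (\val b i).
  by rewrite /ev (hom_seq (hm (\val y)) us b0).
rewrite E (_ : (fun y : T => _) = fun y : T => \sum_(i <- s) dgm y i (\val b i)); last first.
  by apply/funext => y; exact: E.
elim: (s) => [|i s' IH].
  rewrite big_nil (_ : (fun y : T => _) = cst 0); first exact: cvg_cst.
  by apply/funext => y; rewrite big_nil.
rewrite big_cons (_ : (fun y : T => _) =
   (fun y : T => dgm y i (\val b i)) \+ (fun y : T => \sum_(i <- s') dgm y i (\val b i))).
  by apply: cvgD IH; apply: H; exact: rees_glob.
by apply/funext => y; rewrite big_cons.
Qed.

Lemma T_continuous_at (X : topologicalType) (g : X -> T) x :
  (forall i f, glob W i f -> {for x, continuous (fun y => dgm (g y) i f)}) ->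
  {for x, continuous g}.
Proof. by move=> H; apply: T_cvgP => i f Wf; exact: H. Qed.

Lemma continuous_exprz (i : int) (u : R) : u != 0 -> {for u, continuous (fun v : R => v ^ i)}.
Proof.
move=> u0; case: i => k; rewrite /exprz; first exact: exprn_continuous.
apply: continuousV; first exact: expf_neq0.
exact: exprn_continuous.
Qed.

Lemma free_minus : free_action a.
Proof.
move=> t t0 x tx; have [k [f [Wf fx]]] := off_center_minus x.
have := dgm_pos t0 x Wf; rewrite tx => /eqP; rewrite -[X in X == _]mul1r.
move=> /eqP /(mulIf fx) /esym /eqP; rewrite -exprnP pexpr_eq1 ?ltW //=.
by move=> /eqP.
Qed.

(** A total form of the action, along which filters on [R * T] can be pushed forward; the value for
    p.1 <= 0 is a default. *)
Definition act_total (p : R * T) : T :=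
  if pselect (0 < p.1) is left p0 then act_pos a p0 p.2 else p.2.

Lemma act_totalE t (t0 : 0 < t) x : act_total (t, x) = act_pos a t0 x.
Proof.
rewrite /act_total; case: pselect => // t0'.
by rewrite (bool_irrelevance t0 t0').
Qed.

Lemma dgm_total (p : R * T) i f : 0 < p.1 -> glob W i f ->
  dgm (act_total p) i f = p.1 ^ i * dgm p.2 i f.
Proof. by case: p => t x /= t0 Wf; rewrite (act_totalE t0) dgm_pos. Qed.

(* If (u, z) tends along U to a pair with z -> x and u z -> y, homogeneous
   elements of positive degree that do not vanish at x and y force u to converge
   in R_{>0}. *)
Lemma orbit_limit (U : set_system (R * T)) (x y : T) : ProperFilter U ->
  U [set p | 0 < p.1] -> snd @ U --> x -> act_total @ U --> y ->
  exists (t : R) (t0 : 0 < t), fst @ U --> t /\ y = act_pos a t0 x.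
Proof.
move=> FU U0 Ux Uy.
have cx i f : (fun p : R * T => dgm p.2 i f) @ U --> dgm x i f.
  by apply: (cvg_comp snd (fun z : T => dgm z i f) Ux); exact: continuous_dgm.
have cy i f : glob W i f -> (fun p : R * T => p.1 ^ i * dgm p.2 i f) @ U --> dgm y i f.
  move=> Wf.
  have H : (fun p => dgm (act_total p) i f) @ U --> dgm y i f.
    by apply: (cvg_comp act_total (fun z : T => dgm z i f) Uy); exact: continuous_dgm.
  apply: cvg_trans H; apply: near_eq_cvg.
  by apply: filterS U0 => p p0; rewrite dgm_total.
have [k [f [Wf fx]]] := off_center_minus x.
have [l [g [Wg gy]]] := off_center_minus y.
(* The limit of u^(k+1), read off from the values of f at z and at u z. *)
pose c := dgm y k.+1 f / dgm x k.+1 f.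
have ck : (fun p : R * T => p.1 ^+ k.+1) @ U --> c.
  have H : (fun p : R * T => p.1 ^ k.+1 * dgm p.2 k.+1 f / dgm p.2 k.+1 f) @ U --> c.
    by apply: cvgM; [exact: cy|exact: cvgV].
  apply: cvg_trans H; apply: near_eq_cvg.
  have nz : U [set p : R * T | dgm p.2 k.+1 f != 0].
    have nz : nbhs (dgm x k.+1 f) [set z : R | z != 0].
      by apply: open_nbhs_nbhs; split => //; exact: open_neq.
    exact: (cx _ _ _ nz).
  by apply: filterS nz => p /= p0; rewrite mulfK // -exprnP.
have c0 : 0 <= c.
  apply: (cvgr_to_ge ck); apply: filterS U0 => p /= p0.
  by rewrite exprn_ge0 // ltW.
(* If u^(k+1) tended to 0, then g would vanish at y. The (k+1)-st powers of the values of g are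
   compared, so that u enters only through powers of u^(k+1). *)
have c_neq0 : c != 0.
  apply/negP => /eqP ce0.
  have H1 : (fun p : R * T => (p.1 ^ l.+1 * dgm p.2 l.+1 g) ^+ k.+1) @ U -->
      dgm y l.+1 g ^+ k.+1.
    by apply: (cvg_comp _ (fun z : R => z ^+ k.+1) (cy _ _ Wg)); exact: exprn_continuous.
  have H2 : (fun p : R * T => (p.1 ^+ k.+1) ^+ l.+1 * dgm p.2 l.+1 g ^+ k.+1) @ U -->
      c ^+ l.+1 * dgm x l.+1 g ^+ k.+1.
    apply: cvgM.
      by apply: (cvg_comp _ (fun z : R => z ^+ l.+1) ck); exact: exprn_continuous.
    by apply: (cvg_comp _ (fun z : R => z ^+ k.+1) (cx _ _)); exact: exprn_continuous.
  have E : (fun p : R * T => (p.1 ^ l.+1 * dgm p.2 l.+1 g) ^+ k.+1) =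
     (fun p : R * T => (p.1 ^+ k.+1) ^+ l.+1 * dgm p.2 l.+1 g ^+ k.+1).
    by apply/funext => p; rewrite exprMn -exprnP -!exprM mulnC.
  rewrite E in H1; have : dgm y l.+1 g ^+ k.+1 = c ^+ l.+1 * dgm x l.+1 g ^+ k.+1.
    exact: (cvg_unique (@Rhausdorff R) H1 H2).
  rewrite ce0 expr0n mul0r => /eqP; rewrite expf_eq0 /= => /eqP gy0.
  by rewrite gy0 eqxx in gy.
have {c0 c_neq0}c0 : 0 < c by rewrite lt_neqAle eq_sym c_neq0.
(* The positive (k+1)-st root of c. *)
pose t := expR (ln c / k.+1%:R).
have t0 : 0 < t by exact: expR_gt0.
have ct : fst @ U --> t.
  have H : (fun p : R * T => expR (ln (p.1 ^+ k.+1) / k.+1%:R)) @ U --> t.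
    apply: (cvg_comp (fun p : R * T => ln (p.1 ^+ k.+1) / k.+1%:R) expR); last first.
      exact: continuous_expR.
    apply: cvgMr_tmp; apply: (cvg_comp _ _ ck); exact: continuous_ln.
  apply: cvg_trans H; apply: near_eq_cvg.
  apply: filterS U0 => p /= p0.
  by rewrite lnXn // -[ln _ *+ _]mulr_natr mulfK ?pnatr_eq0 // lnK.
exists t, t0; split => //; apply: T_ext => i h Wh; rewrite dgm_pos //.
apply: (cvg_unique (@Rhausdorff R) (cy _ _ Wh)); apply: cvgM; last exact: cx.
apply: (cvg_comp _ (fun v : R => v ^ i) ct); apply: continuous_exprz.
by rewrite gt_eqF.
Qed.

(** An ultrafilter of pairs (u, z) is sent into K by (u, z) |-> (u z, z); the image converges, and
    [orbit_limit] lifts the limit to one of the pairs. *)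
Lemma proper_minus : proper_action a.
Proof.
move=> K cK; rewrite compact_ultra => U UU UP.
pose g (p : R * T) := (act_total p, p.2).
have UK : (g @ U) K.
  suff : U (g @^-1` K) by [].
  by apply: filterS UP => -[t x] [t0 /= Kx]; rewrite /g (act_totalE t0).
have U0 : U [set p | 0 < p.1] by apply: filterS UP => p [].
have [[y x] [Kyx cl]] := cK (g @ U) _ UK.
(* For an ultrafilter a cluster point of the image is a limit. *)
have gU : g @ U --> (y, x).
  move=> V nV; have [//|nUV] := in_ultra_setVsetC (g @^-1` V) UU.
  have [z [/= nVz Vz]] := cl (~` V) V nUV nV.
  by [].
have cx : snd @ U --> x.
  by apply: (cvg_comp g snd gU); exact: cvg_snd.
have cy : act_total @ U --> y.
  by apply: (cvg_comp g fst gU); exact: cvg_fst.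
have [t [t0 [ct yE]]] := orbit_limit _ U0 cx cy.
exists (t, x); split; first by exists t0; rewrite -yE.
have cp : (fun p : R * T => (p.1, p.2)) @ U --> (t, x) by exact: cvg_pair ct cx.
move=> V nV; have := cp V nV.
have -> // : (fun p : R * T => (p.1, p.2)) = id by apply/funext => -[].
Qed.

Lemma act_posK (s t : R) (s0 : 0 < s) (t0 : 0 < t) (x : T) :
  s * t = 1 -> act_pos a s0 (act_pos a t0 x) = x.
Proof. by move=> st; rewrite -(act_posM a s0 t0 (mulr_gt0 s0 t0)) act_pos1. Qed.

Lemma continuous_act u (u0 : u != 0) : continuous (act a u0).
Proof.
move=> x; apply: (@T_continuous_at T (act a u0) x) => i f Wf.
have E (z : T) : dgm (act a u0 z) i f = u ^ i * dgm z i f by rewrite /dgm dg_scale.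
rewrite (_ : (fun z : T => _) = fun z : T => u ^ i * dgm z i f).
  exact: (continuousM (@cst_continuous T R (u ^ i) x) (@continuous_dgm i f x)).
by apply/funext => z; exact: E.
Qed.

Lemma blowup_projE (x y : T) : blowup_proj W N x = blowup_proj W N y <->
  exists (t : R) (t0 : 0 < t), y = act_pos a t0 x.
Proof.
rewrite /blowup_proj /orbit_proj; split=> [/eqmodP /asboolP //|H].
by apply/eqmodP/asboolP.
Qed.

Lemma blowup_surj (z : blowup W N) : exists x, blowup_proj W N x = z.
Proof. by exists (repr z); exact: reprK. Qed.

Lemma continuous_blowup_proj : continuous (blowup_proj W N).
Proof. exact: pi_continuous. Qed.

(** The saturation of V is the union of its translates, and each of these is open. *)
Lemma open_blowup_proj (V : set T) : open V -> open (blowup_proj W N @` V).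
Proof.
move=> oV; rewrite /open /= /quotient_open.
apply: open_of_nbhs => x [z Vz /blowup_projE[t [t0 xE]]].
have ti0 : 0 < t^-1 by rewrite invr_gt0.
have zE : z = act_pos a ti0 x by rewrite xE act_posK // mulVf // gt_eqF.
have nV : nbhs (act_pos a ti0 x) V by apply: open_nbhs_nbhs; rewrite -zE.
have nx : nbhs x (act_pos a ti0 @^-1` V) := continuous_act nV.
apply: (@filterS _ (nbhs x) _ _ _ _ nx) => y /= Vy.
exists (act_pos a ti0 y) => //; apply/blowup_projE; exists t, t0.
by rewrite act_posK // mulfV // gt_eqF.
Qed.

(** If two orbits cannot be separated, the pairs (u, z) with z near x and u z near y form a proper
    filter, and [orbit_limit] shows that x and y lie in one orbit. *)
Lemma hausdorff_blowup : hausdorff_space (blowup W N).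
Proof.
move=> zx zy cl; have [x xE] := blowup_surj zx; have [y yE] := blowup_surj zy.
pose B (VV : set T * set T) : set (R * T) :=
  [set p | [/\ 0 < p.1, VV.1 p.2 & VV.2 (act_total p)]].
pose U := filter_from [set VV : set T * set T | nbhs x VV.1 /\ nbhs y VV.2] B.
have FU : ProperFilter U.
  apply: filter_from_proper.
    apply: filter_from_filter; first by exists (setT, setT); split; exact: filterT.
    move=> [V1 V2] [V1' V2'] /= [nV1 nV2] [nV1' nV2'].
    exists (V1 `&` V1', V2 `&` V2'); first by split; exact: filterI.
    by move=> p [p0 [/= ? ?] [? ?]].
  move=> [V1 V2] /= [nV1 nV2].
  have n1 : nbhs zx (blowup_proj W N @` interior V1).
    apply: open_nbhs_nbhs; split; first by apply: open_blowup_proj; exact: open_interior.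
    by exists x => //; exact: nbhs_singleton (nbhs_interior nV1).
  have n2 : nbhs zy (blowup_proj W N @` interior V2).
    apply: open_nbhs_nbhs; split; first by apply: open_blowup_proj; exact: open_interior.
    by exists y => //; exact: nbhs_singleton (nbhs_interior nV2).
  have [z [[z1 V1z1 z1E] [z2 V2z2 z2E]]] := cl _ _ n1 n2.
  have /blowup_projE[t [t0 e]] : blowup_proj W N z1 = blowup_proj W N z2.
    by rewrite z1E z2E.
  exists (t, z1); split => //=; first exact: interior_subset.
  by rewrite (act_totalE t0) -e; exact: interior_subset.
have U0 : U [set p | 0 < p.1].
  by exists (setT, setT) => [|p []//]; split; exact: filterT.
have Ux : snd @ U --> x.
  by move=> V nV; exists (V, setT) => [|p []//]; split => //; exact: filterT.
have Uy : act_total @ U --> y.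
  by move=> V nV; exists (setT, V) => [|p []//]; split => //; exact: filterT.
have [t [t0 [_ e]]] := orbit_limit FU U0 Ux Uy.
by rewrite -xE -yE; apply/blowup_projE; exists t, t0.
Qed.

End FreeProper.

(** * Weighted coordinates and slices *)

Section Adapted.
Context {R : realType} {n r : nat} {M : topologicalType} {C : fun_family R M}.
Context {W : ideal_filtration C} {N : set M}.
Hypotheses (hM : is_manifold n C) (hW : is_weighted_pair n r W N).

Let sC := manifold_sheaf hM.
Let charts := manifold_charts hM.

Record wchart := WChart {
  wt : 'I_n -> nat;
  wdom : set M;
  wcrd : 'I_n -> M -> R;
  winv : 'rV[R]_n -> M }.

Definition wrow (c : wchart) (x : M) : 'rV[R]_n := \row_b wcrd c b x.

(* A weighted chart shrunk so that its coordinates extend to global sections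
   of C_(w_b). *)
Record adapted (c : wchart) : Prop := {
  ad_open : open (wdom c);
  ad_glob : forall b, glob W (wt c b) (wcrd c b);
  ad_im : open (wrow c @` wdom c);
  ad_K : forall x, wdom c x -> winv c (wrow c x) = x;
  ad_smooth : forall f, C setT f -> smooth_on (wrow c @` wdom c) (f \o winv c);
  ad_expand : forall (i : nat) f, glob W i f ->
    exists m (g : 'I_m -> M -> R) (s : 'I_m -> 'I_n -> nat),
    (forall k, C setT (g k) /\ (i <= \sum_b s k b * wt c b)%N) /\
    forall x, wdom c x -> f x = \sum_k g k x * \prod_b wcrd c b x ^+ s k b }.

(** Coordinates and coefficients of expansions are multiplied by one bump function, which makes them
    global, and the domain is shrunk to where it equals 1, so that the expansions persist. *)
Lemma adapted_exists p : exists c, adapted c /\ wdom c p.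
Proof.
have [U0 [phi [psi [w [U0p ch _ Wch]]]]] := weighting_charts hW p.
have oU0 := chart_dom ch.
have [chi [Cchi _ chi1] [K [_ clK KU0 K0]]] := manifold_bump hM oU0 U0p.
have oK : open (~` K) by exact: closed_openC.
(* The degree survives the cutoff: over U0 by the ideal property, and off the support because the
   product is 0. *)
have cutoff i g : W i U0 g -> W i setT (fun x => chi x * g x).
  move=> Wg; apply: (sheaf_local (fil_sheaf W i)) => [|x _]; first exact: openT.
  have [Kx|nKx] := pselect (K x).
    exists U0; split => //; first exact: KU0.
    by apply: filM => //; apply: (sheaf_res sC openT).
  exists (~` K); split => //; apply: (@fil_ext _ _ _ W _ _ (fun=> 0)) => //.
    by move=> y /K0 ->; rewrite mul0r.
  exact: fil0.
pose U := U0 `&` interior [set x | chi x = 1].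
have oU : open U by apply: openI => //; exact: open_interior.
have UU0 : U `<=` U0 by move=> x [].
have Uchi x : U x -> chi x = 1 by move=> [_ /interior_subset].
pose xi b x := chi x * phi x 0 b.
pose c := WChart w U xi psi.
have rowE x : U x -> wrow c x = phi x.
  by move=> Ux; apply/rowP => b; rewrite mxE /= /xi Uchi // mul1r.
have imE : wrow c @` wdom c = phi @` U.
  by apply/seteqP; split=> _ [x Ux <-]; exists x => //=; rewrite rowE.
have Wcoord b : W (w b) U0 (fun x => phi x 0 b).
  apply/Wch; exists 1%N, (fun _ _ => 1), (fun _ b' => (b' == b : nat)).
  split=> [_|x _].
    split; first exact: (sheaf_cst sC charts oU0 1).
    by rewrite (bigD1 b) //= eqxx mul1n leq_addr.
  rewrite big_ord1 mul1r (bigD1 b) //= eqxx expr1 big1 ?mulr1 //.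
  by move=> b' /negPf ->; rewrite expr0.
exists c; split; last by split => //; exact: nbhs_singleton (nbhs_interior chi1).
split => //.
- by move=> b; apply: cutoff.
- by rewrite imE; exact: (chart_im_open ch).
- by move=> x Ux; rewrite rowE //=; apply: (chart_K ch); exact: UU0.
- move=> f Cf; rewrite imE; apply/(chart_smooth ch _ oU UU0).
  exact: (sheaf_res sC openT oU (fun _ _ => I) Cf).
- move=> i f Wf; have /Wch[m [g [s [gs fE]]]] : W i U0 f.
    exact: (sheaf_res (fil_sheaf W i) openT oU0 (fun _ _ => I) Wf).
  exists m, (fun k x => chi x * g k x), s; split=> [k|x Ux].
    have [Cg ws] := gs k; split => //.
    by apply: (fil_C openT (cutoff 0%N _ _)); apply/(fil_zero W _ oU0).
  rewrite fE; last exact: UU0.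
  apply: eq_bigr => k _; rewrite Uchi // mul1r; congr (_ * _).
  by apply: eq_bigr => b _; rewrite /= /xi Uchi // mul1r.
Qed.

Variable c : wchart.
Hypothesis hc : adapted c.

Let Om := wrow c @` wdom c.

(** The weighted dilation; at height t it takes the values y_b to the coordinates of the base
    point. *)
Definition dil (t : R) (y : 'rV[R]_n) : 'rV[R]_n := \row_b (t ^+ wt c b * y 0 b).

Definition yc (x : dspace W) : 'rV[R]_n := \row_b dg (\val x) (wt c b) (wcrd c b).

Lemma wrow_base x : wrow c (base hM hW x) = dil (height x) (yc x).
Proof.
apply/rowP => b; rewrite !mxE.
have Wb := ad_glob hc b; have := dg_down hM hW x (wt c b) Wb.
by rewrite subrr (dg_base hM hW) //; exact: glob_C Wb.
Qed.

Lemma wrow_K y : Om y -> wrow c (winv c y) = y.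
Proof. by move=> [x Ux <-]; rewrite (ad_K hc). Qed.

Lemma winv_dom y : Om y -> wdom c (winv c y).
Proof. by move=> [x Ux <-]; rewrite (ad_K hc). Qed.

Lemma base_yc x : wdom c (base hM hW x) -> base hM hW x = winv c (dil (height x) (yc x)).
Proof. by move=> Ux; rewrite -wrow_base (ad_K hc). Qed.

Lemma dil_Om x : wdom c (base hM hW x) -> Om (dil (height x) (yc x)).
Proof. by move=> Ux; rewrite -wrow_base; exists (base hM hW x). Qed.

(** By [dg_local] f may be replaced by its expansion, and z^-i x^s = z^(d - i) z^-d x^s with d >= i
    the weight of the monomial, where z^-d x^s is a product of the elements z^-w_b x_b. *)
Lemma dg_expand (x : dspace W) (i : nat) f m (g : 'I_m -> M -> R) (s : 'I_m -> 'I_n -> nat) :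
  wdom c (base hM hW x) -> glob W i f ->
  (forall k, C setT (g k) /\ (i <= \sum_b s k b * wt c b)%N) ->
  (forall z, wdom c z -> f z = \sum_k g k z * \prod_b wcrd c b z ^+ s k b) ->
  dg (\val x) i f = \sum_k g k (base hM hW x) *
    (height x ^+ (\sum_b s k b * wt c b - i) * \prod_b yc x 0 b ^+ s k b).
Proof.
move=> Ux Wf gs fE.
pose d k : int := \sum_b (wt c b)%:Z *+ s k b.
have dE k : d k = (\sum_b s k b * wt c b)%N%:Z.
  rewrite /d; elim: (index_enum _) => [|b l IH]; first by rewrite !big_nil.
  by rewrite !big_cons IH PoszD; congr (_ + _); rewrite pmulrn; lia.
have Wk k : glob W (d k) (fun z => \prod_b wcrd c b z ^+ s k b).
  exact: (glob_monomial hM hW (fun b => ad_glob hc b)).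
have Wki k : glob W i (fun z => \prod_b wcrd c b z ^+ s k b).
  by apply: glob_le (Wk k); rewrite dE; have [_] := gs k.
have Wgk k : glob W i (fun z => g k z * \prod_b wcrd c b z ^+ s k b).
  by apply: globMC => //; have [] := gs k.
rewrite (dg_local (ad_open hc) Ux Wf (glob_sum _ Wgk) fE).
rewrite (dg_sum (hm x)) //; apply: eq_bigr => k _.
have [Cg ws] := gs k.
have := dgM (hm x) hM hW (C_glob0 Cg) (Wki k); rewrite add0r => ->.
rewrite (dg_base hM hW) //; congr (_ * _).
have := dg_down hM hW x (\sum_b s k b * wt c b - i) (Wk k).
have -> : d k - (\sum_b s k b * wt c b - i)%N%:Z = i.
  by rewrite dE subzn ?leq_subr // subKn.
move=> ->; congr (_ * _); rewrite (dg_monomial hM hW (fun b => ad_glob hc b) x).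
by apply: eq_bigr => b _; rewrite mxE.
Qed.

(* On z^-i x^s with d = \sum_b s_b w_b >= i, where b ranges over the weighted
   coordinates, the value is t^(d - i) y^s. *)
Lemma eval_exists (i : int) f : glob W i f ->
  exists e : 'rV[R]_n -> R -> R,
    (forall x : dspace W, wdom c (base hM hW x) -> dg (\val x) i f = e (yc x) (height x)) /\
    forall m (V : set 'rV[R]_m) (ys : 'rV[R]_m -> 'rV[R]_n) (ts : 'rV[R]_m -> R),
      open V -> (forall b, smooth_on V (fun v => ys v 0 b)) -> smooth_on V ts ->
      (forall v, V v -> Om (dil (ts v) (ys v))) -> smooth_on V (fun v => e (ys v) (ts v)).
Proof.
have comp g m (V : set 'rV[R]_m) (ys : 'rV[R]_m -> 'rV[R]_n) (ts : 'rV[R]_m -> R) :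
    C setT g ->
    open V -> (forall b, smooth_on V (fun v => ys v 0 b)) -> smooth_on V ts ->
    (forall v, V v -> Om (dil (ts v) (ys v))) ->
    smooth_on V (fun v => g (winv c (dil (ts v) (ys v)))).
  move=> Cg oV sy st VO.
  apply: (@smooth_comp _ _ _ oV _ Om (g \o winv c) (fun v => dil (ts v) (ys v)) (ad_im hc));
    [exact: VO|exact: (ad_smooth hc)|move=> b].
  apply: (smooth_on_eq oV (f := fun v => ts v ^+ wt c b * ys v 0 b)).
    by move=> v _; rewrite mxE.
  exact: (smoothM oV (smoothX oV _ st) (sy b)).
(* [Negz i] is the degree -(i + 1), where the element is z^(i + 1) times a function of degree 0. *)
case: i => i Wf; last first.
  have Cf := glob_C Wf.
  exists (fun y t => t ^+ i.+1 * f (winv c (dil t y))); split=> [x Ux|m V ys ts oV sy st VO].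
    have := dg_down hM hW x i.+1 (C_glob0 Cf); rewrite sub0r -NegzE => ->.
    by rewrite (dg_base hM hW) // -base_yc.
  by apply: (smoothM oV); [exact: smoothX|exact: comp].
have [m [g [s [gs fE]]]] := ad_expand hc Wf.
exists (fun y t => \sum_k g k (winv c (dil t y)) *
    (t ^+ (\sum_b s k b * wt c b - i) * \prod_b y 0 b ^+ s k b)).
split=> [x Ux|m' V ys ts oV sy st VO].
  by rewrite (dg_expand Ux Wf gs fE) -base_yc.
apply: (smooth_sum oV) => k _; apply: (smoothM oV); first by apply: comp => //; have [] := gs k.
apply: (smoothM oV); first exact: smoothX.
by apply: (smooth_prod oV) => b _; exact: smoothX.
Qed.

End Adapted.

(** * Existence of points over a weighted chart *)

Section PointsOverChart.
Context {R : realType} {n r : nat} {M : topologicalType} {C : fun_family R M}.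
Context {W : ideal_filtration C} {N : set M}.
Hypotheses (hM : is_manifold n C) (hW : is_weighted_pair n r W N).
Variable c : @wchart R n M.
Hypothesis hc : @adapted R n M C W c.

Let Om := wrow c @` wdom c.

(** Carries identities from points of nonzero height to the limit at height 0. *)
Lemma eq_at0 (p q : R -> R) : {for 0, continuous p} -> {for 0, continuous q} ->
  (\forall t \near 0, t != 0 -> p t = q t) -> p 0 = q 0.
Proof.
move=> cp cq pq.
have cp' : p @ 0^' --> p 0 by apply: cvg_trans cp; apply: cvg_app; exact: nbhs_dnbhs.
have cq' : q @ 0^' --> q 0 by apply: cvg_trans cq; apply: cvg_app; exact: nbhs_dnbhs.
apply: (cvg_unique (@Rhausdorff R) cp'); apply: cvg_trans cq'.
apply: near_eq_cvg; rewrite near_withinE.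
by apply: filterS pq => t pqt /pqt.
Qed.

(* Evaluations at height 0 are limits of evaluations at points of M x R^x. *)
Lemma point_over (y : 'rV[R]_n) (t : R) : Om (dil c t y) ->
  exists x : dspace W, [/\ wdom c (base hM hW x), yc c x = y & height x = t].
Proof.
have off0 u z : u != 0 -> Om (dil c u z) -> exists x : dspace W,
    [/\ wdom c (base hM hW x), yc c x = z, height x = u &
     forall i f, glob W i f -> dg (\val x) i f = u ^ (- i) * f (winv c (dil c u z))].
  move=> u0 Oz; have [x px] := point_exists hM hW (winv c (dil c u z)) u0.
  have xd i f : glob W i f -> dg (\val x) i f = u ^ (- i) * f (winv c (dil c u z)).
    exact: is_point_dg px.
  exists x; split => //.
  - by rewrite (is_point_base hM hW px); exact: (winv_dom hc).
  - apply/rowP => b; rewrite mxE xd; last exact: ad_glob.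
    have -> : wcrd c b (winv c (dil c u z)) = dil c u z 0 b.
      by rewrite -[in RHS](wrow_K hc Oz) mxE.
    by rewrite mxE mulrA -exprnN mulVf ?mul1r // expf_neq0.
  - exact: (is_point_heightE hM px).
have [->|t0] := eqVneq t 0; last first.
  by move=> /(off0 _ _ t0)[x [Ux yx tx _]]; exists x.
move=> O0.
have cdilR : continuous (fun u : R => dil c u y).
  move=> u; apply: row_continuous_at => b.
  rewrite (_ : (fun v => _) = fun v : R => v ^+ wt c b * y 0 b); last first.
    by apply/funext => v; rewrite mxE.
  exact: (continuousM (@exprn_continuous _ (wt c b) u) (@cst_continuous _ _ (y 0 b) u)).
(* [e i f] is the continuous extension to u = 0 of the value on z^-i f at height u with y fixed; by
   [eval_exists] it is smooth in u. *)
have [e eP] : exists e : int -> (M -> R) -> R -> R, forall i f, glob W i f ->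
    {for 0, continuous (e i f)} /\ \forall u \near 0, u != 0 ->
       Om (dil c u y) /\ e i f u = u ^ (- i) * f (winv c (dil c u y)).
  pose V := [set v : 'rV[R]_1 | Om (dil c (v 0 0) y)].
  have cdil : continuous (fun v : 'rV[R]_1 => dil c (v 0 0) y).
    move=> v; apply: (@continuous_comp _ _ _ (fun v : 'rV[R]_1 => v 0 0) (fun u => dil c u y)).
      exact: coord_continuous.
    exact: cdilR.
  have oV : open V by apply: open_comp (ad_im hc) => v _; exact: cdil.
  (* R is identified with the rows of length 1, as smoothness is formulated on spaces of rows. *)
  pose rw (u : R) : 'rV[R]_1 := \row__ u.
  have crw : continuous rw.
    move=> u; apply: row_continuous_at => j.
    rewrite (_ : (fun v => _) = id) //; last by apply/funext => v; rewrite mxE.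
  have V0 : V (rw 0) by rewrite /V /= mxE.
  have nV : \forall u \near 0, V (rw u).
    by apply: crw; apply: open_nbhs_nbhs.
  suff H : forall i f, exists h : R -> R, glob W i f ->
      {for 0, continuous h} /\ \forall u \near 0, u != 0 ->
       Om (dil c u y) /\ h u = u ^ (- i) * f (winv c (dil c u y)).
    have /choice[e eP] : forall pr : int * (M -> R), exists h : R -> R, glob W pr.1 pr.2 ->
      {for 0, continuous h} /\ \forall u \near 0, u != 0 ->
       Om (dil c u y) /\ h u = u ^ (- pr.1) * pr.2 (winv c (dil c u y)).
      by move=> [i f]; exact: H.
    by exists (fun i f => e (i, f)) => i f; exact: eP (i, f).
  move=> i f; have [Wf|nWf] := pselect (glob W i f); last by exists (fun=> 0).
  have [g [gx gs]] := eval_exists hM hW hc Wf.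
  exists (fun u => g y u) => _; split.
    have S : smooth_on V (fun v : 'rV[R]_1 => g y (v 0 0)).
      apply: (gs _ V (fun=> y) (fun v => v 0 0) oV) => //.
        by move=> b; exact: smooth_cst.
      exact: smooth_coord.
    have cS := smooth_on_continuous S V0.
    have -> : (fun u => g y u) = (fun v : 'rV[R]_1 => g y (v 0 0)) \o rw.
      by apply/funext => u /=; rewrite mxE.
    by apply: continuous_comp; [exact: crw|exact: cS].
  apply: filterS nV => u; rewrite /V /= mxE => Ou u0; split => //.
  have [x [Ux yx tx xd]] := off0 _ _ u0 Ou.
  by rewrite -xd // gx // yx tx.
have E i f : glob W i f -> {for 0, continuous (e i f)} by move=> /eP[].
have F i f : glob W i f -> \forall u \near 0, u != 0 ->
    e i f u = u ^ (- i) * f (winv c (dil c u y)).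
  by move=> /eP[_]; apply: filterS => u H /H[].
(* The limits at 0. Linearity and multiplicativity hold for u != 0 and pass to the limit, so
   [graded_hom] assembles a point. *)
pose L i f := e i f 0.
have L1 : L 0 (fun=> 1) = 1.
  have W1 : glob W 0 (fun=> 1) by apply: C_glob0; exact: C_cst hM _.
  apply: (@eq_at0 _ (fun=> 1) (E _ _ W1)); first exact: cst_continuous.
  by apply: filterS (F _ _ W1) => u H /H ->; rewrite oppr0 expr0z mulr1.
have LD i f g : glob W i f -> glob W i g ->
    L i (fun x => f x + g x) = L i f + L i g.
  move=> Wf Wg; have Wfg := globD Wf Wg.
  apply: (@eq_at0 _ (fun u => e i f u + e i g u) (E _ _ Wfg)).
    exact: (continuousD (E _ _ Wf) (E _ _ Wg)).
  apply: filterS3 (F _ _ Wfg) (F _ _ Wf) (F _ _ Wg) => u H1 H2 H3 u0.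
  by rewrite H1 // H2 // H3 // mulrDr.
have LZ i a f : glob W i f -> L i (fun x => a * f x) = a * L i f.
  move=> Wf; have Waf := globZ a Wf.
  apply: (@eq_at0 _ (fun u => a * e i f u) (E _ _ Waf)).
    exact: (continuousM (@cst_continuous _ _ a _) (E _ _ Wf)).
  apply: filterS2 (F _ _ Waf) (F _ _ Wf) => u H1 H2 u0.
  by rewrite H1 // H2 // mulrCA.
have LM i j f g : glob W i f -> glob W j g ->
    L (i + j) (fun x => f x * g x) = L i f * L j g.
  move=> Wf Wg; have Wfg := globM hM hW Wf Wg.
  apply: (@eq_at0 _ (fun u => e i f u * e j g u) (E _ _ Wfg)).
    exact: (continuousM (E _ _ Wf) (E _ _ Wg)).
  apply: filterS3 (F _ _ Wfg) (F _ _ Wf) (F _ _ Wg) => u H1 H2 H3 u0.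
  by rewrite H1 // H2 // H3 // opprD expfzDr // mulrACA.
have hL := graded_hom hM hW L1 LD LZ LM.
pose x : dspace W := subelt (A := @delta _ _ _ W) hL.
have L0 i : L i (fun=> 0) = 0.
  rewrite -[RHS](mul0r (L i (fun=> 0))) -LZ; last exact: glob0.
  by congr L; apply/funext => z; rewrite mulr0.
have xd i f : glob W i f -> dg (\val x) i f = L i f.
  move=> Wf; rewrite /dg /= (fsum1 (i0 := i)) => [|j ji]; first by rewrite monoE // eqxx.
  by rewrite monoE // (negPf ji).
exists x; split.
- suff -> : base hM hW x = winv c (dil c 0 y) by exact: (winv_dom hc).
  apply: base_unique => f Cf; have W0 := C_glob0 (W := W) Cf; rewrite xd //.
  rewrite /L (@eq_at0 (e 0 f) (fun u => f (winv c (dil c u y))) (E _ _ W0)) //.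
    apply: (@continuous_comp _ _ _ (fun u : R => dil c u y) (f \o winv c)); first exact: cdilR.
    exact: (smooth_on_continuous (ad_smooth hc Cf) O0).
  by apply: filterS (F _ _ W0) => u H /H ->; rewrite oppr0 expr0z mul1r.
- apply/rowP => b; rewrite mxE xd; last exact: ad_glob.
  have Wb := ad_glob hc b.
  apply: (@eq_at0 _ (fun=> y 0 b) (E _ _ Wb)); first exact: cst_continuous.
  have [_ Fb] := eP _ _ Wb; apply: filterS Fb => u H u0; have [Ou ->] := H u0.
  have -> : wcrd c b (winv c (dil c u y)) = dil c u y 0 b.
    by rewrite -[in RHS](wrow_K hc Ou) mxE.
  by rewrite mxE mulrA -exprnN mulVf ?mul1r // expf_neq0.
- have Wm : glob W (-1) (fun=> 1) by apply: glob_neg => //; exact: C_cst hM _.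
  rewrite /height xd // /L (@eq_at0 (e (-1) (fun=> 1)) id (E _ _ Wm)) //.
  by apply: filterS (F _ _ Wm) => u H /H ->; rewrite opprK expr1z mulr1.
Qed.

End PointsOverChart.

(** * Slices and conical charts off the center *)

Section SliceChart.
Context {R : realType} {n r : nat} {M : topologicalType} {C : fun_family R M}.
Context {W : ideal_filtration C} {N : set M}.
Hypotheses (hM : is_manifold n C) (hW : is_weighted_pair n r W N).

Local Notation T := (delta_minus W N).
Local Notation act0 := (delta_minus_act W N).

Variable c : @wchart R n M.
Hypothesis hc : @adapted R n M C W c.

Let Om := wrow c @` wdom c.

Lemma chart_inj (x y : dspace W) : wdom c (base hM hW x) -> wdom c (base hM hW y) ->
  yc c x = yc c y -> height x = height y -> x = y.
Proof.
move=> Ux Uy yxy txy; apply: delta_ext => i f Wf.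
have [e [ex _]] := eval_exists hM hW hc Wf.
by rewrite !ex // yxy txy.
Qed.

Lemma yc_pos t (t0 : 0 < t) (x : T) b :
  yc c (\val (act_pos act0 t0 x)) 0 b = t ^+ wt c b * yc c (\val x) 0 b.
Proof. by rewrite !mxE; exact: (dgm_pos t0 x (ad_glob hc b)). Qed.

Lemma height_pos t (t0 : 0 < t) (x : T) :
  height (\val (act_pos act0 t0 x)) = t^-1 * height (\val x).
Proof. exact: (height_scale hM). Qed.

Lemma base_pos t (t0 : 0 < t) (x : T) :
  base hM hW (\val (act_pos act0 t0 x)) = base hM hW (\val x).
Proof. exact: base_scale. Qed.

(** Every monomial of positive degree contains a coordinate of positive weight; if all y_b with w_b
    > 0 vanished, so would every element of positive degree. *)
Lemma off_center_yc (x : T) : wdom c (base hM hW (\val x)) ->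
  exists b, (0 < wt c b)%N /\ yc c (\val x) 0 b != 0.
Proof.
move=> Ux; have [k [f [Wf fx]]] := off_center_minus hM hW x.
apply: contrapT => H; move: fx; rewrite /dgm.
have [m [g [s [gs fE]]]] := ad_expand hc Wf.
rewrite (dg_expand hc Ux Wf gs fE) big1 ?eqxx // => l _.
have [_ ws] := gs l.
have [b [wb sb]] : exists b, (0 < wt c b)%N /\ (0 < s l b)%N.
  apply: contrapT => H'; move: ws; rewrite big1 // => b _; apply/eqP.
  by rewrite muln_eq0; apply: contrapT => /negP; rewrite negb_or -!lt0n => /andP[??]; apply: H'; exists b.
rewrite [\prod_b _](bigD1 b) // (_ : yc c (\val x) 0 b = 0).
  by rewrite expr0n gtn_eqF //= mul0r !mulr0.
by apply/eqP; apply: contrapT => /negP yb; apply: H; exists b.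
Qed.

Variables (a : 'I_n) (eps : R).
Hypotheses (wa : (0 < wt c a)%N) (eps2 : eps * eps = 1).
Variable x0 : T.

(* The slice {y_a = eps}: t takes the place of the coordinate y_a. *)
Definition ysl (v : 'rV[R]_n) : 'rV[R]_n := \row_b if b == a then eps else v 0 b.
Definition tsl (v : 'rV[R]_n) : R := v 0 a.
Definition slice_dom : set 'rV[R]_n := [set v | Om (dil c (tsl v) (ysl v))].
Definition cone_dom : set T :=
  [set x | wdom c (base hM hW (\val x)) /\ 0 < eps * yc c (\val x) 0 a].

Lemma smooth_ysl m (V : set 'rV[R]_m) (g : 'rV[R]_m -> 'rV[R]_n) b : open V ->
  (forall b, smooth_on V (fun z => g z 0 b)) -> smooth_on V (fun z => ysl (g z) 0 b).
Proof.
move=> oV sg; case ba : (b == a).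
  apply: (smooth_on_eq oV (f := fun=> eps)); last exact: smooth_cst.
  by move=> z _; rewrite mxE ba.
by apply: (smooth_on_eq oV _ (sg b)) => z _; rewrite mxE ba.
Qed.

Lemma open_slice_dom : open slice_dom.
Proof.
apply: open_comp (ad_im hc) => v _; apply: row_continuous_at => b.
have S : smooth_on setT (fun v : 'rV[R]_n => v 0 a ^+ wt c b * ysl v 0 b).
  apply: (smoothM openT (smoothX openT _ (smooth_coord _))).
  by apply: (smooth_ysl (g := id) b openT) => b'; exact: smooth_coord.
rewrite (_ : (fun _ => _) = fun v : 'rV[R]_n => v 0 a ^+ wt c b * ysl v 0 b).
  exact: (smooth_on_continuous S I).
by apply/funext => w; rewrite mxE.
Qed.

(** The point is off the center because eps is a nonzero value of z^-w_a x_a, which has positive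
    degree. Outside [slice_dom] the default is [x0]. *)
Lemma slice_exists v : exists x : T, slice_dom v ->
  [/\ wdom c (base hM hW (\val x)), yc c (\val x) = ysl v & height (\val x) = tsl v].
Proof.
have [Vv|nVv] := pselect (slice_dom v); last by exists x0.
have [x [Ux yx tx]] := point_over hM hW hc Vv.
have xP : delta_minus W N x.
  move=> cx; have wa' : (0 : int) < wt c a by [].
  have := center_dg hW cx wa' (ad_glob hc a).
  have -> : dg (\val x) (wt c a) (wcrd c a) = eps.
    have : yc c x 0 a = eps by rewrite yx mxE eqxx.
    by rewrite mxE.
  by move=> e0; move/eqP: eps2; rewrite e0 mul0r eq_sym oner_eq0.
by exists (subelt (A := delta_minus W N) xP).
Qed.

Definition slice (v : 'rV[R]_n) : T := sval (cid (slice_exists v)).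

Lemma sliceP v : slice_dom v ->
  [/\ wdom c (base hM hW (\val (slice v))), yc c (\val (slice v)) = ysl v &
      height (\val (slice v)) = tsl v].
Proof. by rewrite /slice; case: cid => x /= H /H. Qed.

Definition vpart (z : 'rV[R]_n.+1) : 'rV[R]_n := \row_b z 0 (lift ord0 b).

(** Index 0 is z and the others are z^-w_b x_b. Over the chart these finitely many evaluations
    suffice to express smooth functions. *)
Definition generators (j : 'I_n.+1) : rees W :=
  if unlift ord0 j is Some b then mono (wt c b) (wcrd c b) else mono (-1) (fun=> 1).

Definition ty (x : dspace W) : 'rV[R]_n.+1 := \row_j ev (generators j) x.

Lemma ty0 x : ty x 0 ord0 = height x.
Proof. by rewrite mxE /generators unlift_none. Qed.

Lemma tyS x b : ty x 0 (lift ord0 b) = yc c x 0 b.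
Proof. by rewrite mxE /generators liftK mxE. Qed.

Definition root_of (q : 'rV[R]_n.+1) : R :=
  expR (ln (eps * q 0 (lift ord0 a)) / (wt c a)%:R).

(* (t, y) |-> (s, v), where s is the positive solution of s^w_a = eps y_a. *)
Definition to_cone (q : 'rV[R]_n.+1) : 'rV[R]_n.+1 := \row_j
  if unlift ord0 j is Some b then
    (if b == a then q 0 ord0 * root_of q
     else q 0 (lift ord0 b) / root_of q ^+ wt c b)
  else root_of q.

Definition cone_chart (x : T) : 'rV[R]_n.+1 := to_cone (ty (\val x)).
Definition cone_inv (z : 'rV[R]_n.+1) : T := act_total (z 0 ord0, slice (vpart z)).
Definition cone_im : set 'rV[R]_n.+1 := [set z : 'rV[R]_n.+1 | 0 < z 0 ord0 /\ slice_dom (vpart z)].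
Definition rt (x : T) : R := root_of (ty (\val x)).

Lemma rt_gt0 x : 0 < rt x.
Proof. exact: expR_gt0. Qed.

Lemma rtX x : cone_dom x -> rt x ^+ wt c a = eps * yc c (\val x) 0 a.
Proof.
move=> [_ ya]; rewrite /rt /root_of -expRM_natr tyS -mulrA mulVf.
  by rewrite mulr1 lnK.
by rewrite pnatr_eq0 -lt0n.
Qed.

Lemma cone_chart0 x : cone_chart x 0 ord0 = rt x.
Proof. by rewrite mxE unlift_none. Qed.

Lemma cone_chartS x b : vpart (cone_chart x) 0 b =
  if b == a then height (\val x) * rt x else yc c (\val x) 0 b / rt x ^+ wt c b.
Proof. by rewrite [LHS]mxE [LHS]mxE liftK ty0 tyS. Qed.

Lemma rt_pos t (t0 : 0 < t) x : cone_dom x -> rt (act_pos act0 t0 x) = t * rt x.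
Proof.
move=> [_ ya]; rewrite /rt /root_of !tyS yc_pos mulrCA [in LHS]lnM ?posrE ?exprn_gt0 //.
rewrite mulrDl expRD lnXn // -[ln t *+ _]mulr_natr mulfK ?lnK //.
by rewrite pnatr_eq0 -lt0n.
Qed.

Lemma cone_dom_pos t (t0 : 0 < t) x : cone_dom x -> cone_dom (act_pos act0 t0 x).
Proof.
move=> [Ux ya]; split; first by rewrite base_pos.
by rewrite yc_pos mulrCA mulr_gt0 // exprn_gt0.
Qed.

(** Under u the root s is multiplied by u, the height by u^-1 and y_b by u^w_b, so these factors
    cancel in t s and in y_b / s^w_b. *)
Lemma vpart_pos t (t0 : 0 < t) x : cone_dom x ->
  vpart (cone_chart (act_pos act0 t0 x)) = vpart (cone_chart x).
Proof.
move=> Dx; apply/rowP => b; rewrite !cone_chartS rt_pos // height_pos yc_pos.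
have tn0 : t != 0 by rewrite gt_eqF.
case: ifP => _; first by rewrite mulrACA mulVf // mul1r.
by rewrite exprMn invfM mulrACA mulfV ?mul1r // expf_neq0.
Qed.

Lemma eps_neq0 : eps != 0.
Proof. by apply/eqP => e0; move/eqP: eps2; rewrite e0 mul0r eq_sym oner_eq0. Qed.

(** Translating x by s^-1 divides y_a by s^w_a = eps y_a, which leaves eps because eps^2 = 1; the
    other coordinates of the translate are those of v by definition, and [chart_inj] identifies the
    points. *)
Lemma slice_cone x : cone_dom x -> slice_dom (vpart (cone_chart x)) /\
  exists (ti0 : 0 < (rt x)^-1), slice (vpart (cone_chart x)) = act_pos act0 ti0 x.
Proof.
move=> Dx; have ti0 : 0 < (rt x)^-1 by rewrite invr_gt0 rt_gt0.
have rn0 : rt x != 0 by rewrite gt_eqF // rt_gt0.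
have [Ux ya] := Dx.
have hE : height (\val (act_pos act0 ti0 x)) = tsl (vpart (cone_chart x)).
  by rewrite height_pos /tsl cone_chartS eqxx invrK mulrC.
have yE : yc c (\val (act_pos act0 ti0 x)) = ysl (vpart (cone_chart x)).
  apply/rowP => b; rewrite yc_pos /ysl mxE cone_chartS exprVn mulrC.
  case: eqP => [->|//]; rewrite rtX // invfM mulrCA.
  have y0 : yc c (\val x) 0 a != 0.
    by apply/eqP => y0; move: ya; rewrite y0 mulr0 ltxx.
  rewrite mulfV // mulr1; apply: (mulIf eps_neq0).
  by rewrite mulVf ?eps_neq0.
have Ux' : wdom c (base hM hW (\val (act_pos act0 ti0 x))) by rewrite base_pos.
have Vv : slice_dom (vpart (cone_chart x)).
  suff : Om (dil c (tsl (vpart (cone_chart x))) (ysl (vpart (cone_chart x)))) by [].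
  rewrite -hE -yE.
  exact: (dil_Om hc Ux').
split => //; exists ti0; have [Us ys hs] := sliceP Vv.
by apply/val_inj/chart_inj => //; rewrite ?ys ?hs.
Qed.

Lemma cone_chartK x : cone_dom x -> cone_inv (cone_chart x) = x.
Proof.
move=> Dx; have [_ [ti0 e]] := slice_cone Dx.
rewrite /cone_inv e cone_chart0 (act_totalE (rt_gt0 x)) act_posK // mulfV //.
by rewrite gt_eqF // rt_gt0.
Qed.

Lemma slice_cone_dom v : slice_dom v -> cone_dom (slice v).
Proof. by move=> /sliceP[U y h]; split => //; rewrite y mxE eqxx eps2. Qed.

Lemma rt_slice v : slice_dom v -> rt (slice v) = 1.
Proof.
move=> /sliceP[_ y _]; rewrite /rt /root_of tyS y mxE eqxx eps2 ln1 mul0r.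
exact: expR0.
Qed.

Lemma vpart_slice v : slice_dom v -> vpart (cone_chart (slice v)) = v.
Proof.
move=> Vv; have [_ y h] := sliceP Vv; apply/rowP => b.
rewrite cone_chartS rt_slice // h y mxE expr1n divr1 mulr1.
by case: eqP => [->|].
Qed.

Lemma cone_inv_dom z : cone_im z -> cone_dom (cone_inv z).
Proof.
move=> [z0 Vz]; rewrite /cone_inv (act_totalE z0).
by apply: cone_dom_pos; exact: slice_cone_dom.
Qed.

Lemma cone_invK z : cone_im z -> cone_chart (cone_inv z) = z.
Proof.
move=> [z0 Vz]; have Ds := slice_cone_dom Vz.
rewrite /cone_inv (act_totalE z0); apply/rowP => j.
case: (unliftP ord0 j) => [b|] ->.
  have := congr1 (fun v : 'rV[R]_n => v 0 b) (vpart_pos z0 Ds).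
  by rewrite vpart_slice // mxE => ->; rewrite mxE.
by rewrite cone_chart0 rt_pos // rt_slice // mulr1.
Qed.

Lemma cone_imE : cone_chart @` cone_dom = cone_im.
Proof.
apply/seteqP; split=> [_ [x Dx <-]|z zP].
  by have [Vv _] := slice_cone Dx; split => //; rewrite cone_chart0 rt_gt0.
by exists (cone_inv z); [exact: cone_inv_dom|exact: cone_invK].
Qed.

Lemma open_cone_im : open cone_im.
Proof.
apply: openI.
  apply: (open_comp (f := fun z : 'rV[R]_n.+1 => z 0 ord0) (D := [set t : R | 0 < t])).
    by move=> z _; exact: coord_continuous.
  exact: open_gt.
apply: open_comp open_slice_dom => z _; apply: row_continuous_at => b.
rewrite (_ : (fun _ => _) = fun z : 'rV[R]_n.+1 => z 0 (lift ord0 b)).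
  exact: coord_continuous.
by apply/funext => w; rewrite mxE.
Qed.

(** By homogeneity the value of z^-i f at the translate by s of a point of the slice is s^i times
    its value on the slice, where [eval_exists] gives smoothness in v. *)
Lemma smooth_ev_cone b : smooth_on cone_im (fun z => ev b (\val (cone_inv z))).
Proof.
have oI := open_cone_im; have [s us b0] := rees_supp b.
apply: (smooth_on_eq oI (f := fun z => \sum_(i <- s) dgm (cone_inv z) i (\val b i))).
  by move=> z _; rewrite /ev (hom_seq (hm (\val (cone_inv z))) us b0).
apply: (smooth_sum oI) => i _; have Wb := rees_glob b i.
have [e [ex es]] := eval_exists hM hW hc Wb.
apply: (smooth_on_eq oI (f := fun z => z 0 ord0 ^ i * e (ysl (vpart z)) (tsl (vpart z)))).
  move=> z [z0 Vz]; rewrite /cone_inv (act_totalE z0) dgm_pos //.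
  by have [Us ys ts] := sliceP Vz; rewrite /dgm ex // ys ts.
have sv b' : smooth_on cone_im (fun z => vpart z 0 b').
  apply: (smooth_on_eq oI (f := fun z => z 0 (lift ord0 b'))); last exact: smooth_coord.
  by move=> z _; rewrite mxE.
apply: (smoothM oI).
  case: i {Wb e ex es} => i; first exact: (smoothX oI _ (smooth_coord _)).
  apply: (smoothV oI) => [z [z0 _]|]; first by rewrite expf_neq0 // gt_eqF.
  exact: (smoothX oI _ (smooth_coord _)).
apply: (es _ _ _ _ oI); [move=> b'|exact: sv|by move=> z []].
by apply: smooth_ysl oI sv.
Qed.

Lemma cone_inv_continuous z : cone_im z -> {for z, continuous cone_inv}.
Proof.
move=> Iz; apply: delta_minus_continuous_at => b.
exact: (smooth_on_continuous (smooth_ev_cone b) Iz).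
Qed.

Definition cone_ty : set 'rV[R]_n.+1 := [set q : 'rV[R]_n.+1 | 0 < eps * q 0 (lift ord0 a)].

Lemma smooth_eps : smooth_on setT (fun q : 'rV[R]_n.+1 => eps * q 0 (lift ord0 a)).
Proof. exact: (smoothM openT (smooth_cst _) (smooth_coord _)). Qed.

Lemma open_cone_ty : open cone_ty.
Proof.
apply: (open_comp (f := fun q : 'rV[R]_n.+1 => eps * q 0 (lift ord0 a))
  (D := [set t : R | 0 < t])); last exact: open_gt.
by move=> q _; exact: (smooth_on_continuous smooth_eps I).
Qed.

Lemma smooth_to_cone j : smooth_on cone_ty (fun q => to_cone q 0 j).
Proof.
have oQ := open_cone_ty.
have sr : smooth_on cone_ty root_of.
  apply: (smooth_expR oQ); apply: (smoothM oQ); last exact: smooth_cst.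
  by apply: (smooth_ln oQ) => //; exact: smooth_onW smooth_eps.
case: (unliftP ord0 j) => [b|] ->; last first.
  by apply: (smooth_on_eq oQ _ sr) => q _; rewrite mxE unlift_none.
case ba : (b == a).
  apply: (smooth_on_eq oQ (f := fun q => q 0 ord0 * root_of q)).
    by move=> q _; rewrite mxE liftK ba.
  exact: (smoothM oQ (smooth_coord _) sr).
apply: (smooth_on_eq oQ (f := fun q => q 0 (lift ord0 b) * (root_of q ^+ wt c b)^-1)).
  by move=> q _; rewrite mxE liftK ba.
apply: (smoothM oQ (smooth_coord _)); apply: (smoothV oQ); last exact: (smoothX oQ _ sr).
by move=> q _; rewrite expf_neq0 // gt_eqF // expR_gt0.
Qed.

Lemma continuous_ty : continuous (fun x : T => ty (\val x)).
Proof.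
move=> x; apply: row_continuous_at => j.
rewrite (_ : (fun _ => _) = fun x : T => ev (generators j) (\val x)).
  apply: (@continuous_comp _ _ _ (fun x : T => \val x) (@ev _ _ _ W (generators j))).
    exact: continuous_val.
  exact: continuous_ev.
by apply/funext => y; rewrite mxE.
Qed.

Lemma cone_ty_dom x : cone_dom x -> cone_ty (ty (\val x)).
Proof. by move=> [_]; rewrite /cone_ty /= tyS. Qed.

Lemma to_cone_continuous q : cone_ty q -> {for q, continuous to_cone}.
Proof.
by move=> Qq; apply: row_continuous_at => j; exact: (smooth_on_continuous (smooth_to_cone j) Qq).
Qed.

Lemma cone_chart_continuous x : cone_dom x -> {for x, continuous cone_chart}.
Proof.
move=> Dx; apply: (@continuous_comp _ _ _ (fun x : T => ty (\val x)) to_cone).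
  exact: continuous_ty.
by apply: to_cone_continuous; exact: cone_ty_dom.
Qed.

Lemma open_cone_dom : open cone_dom.
Proof.
have -> : cone_dom = [set x : T | wdom c (base hM hW (\val x))] `&`
    (fun x : T => ty (\val x)) @^-1` cone_ty.
  by apply/seteqP; split=> x [Ux H]; split => //; move: H; rewrite /cone_ty /= tyS.
apply: openI; last first.
  by apply: open_comp open_cone_ty => x _; exact: continuous_ty.
apply: (open_comp (f := fun x : T => \val x)
   (D := [set y : dspace W | wdom c (base hM hW y)])).
  by move=> x _; exact: continuous_val.
by apply: open_base; exact: (ad_open hc).
Qed.

(** In one direction f is locally a smooth function of evaluations, which are smooth in (s, v). In
    the other, f is locally [f \o cone_inv \o to_cone] applied to the evaluations of
    [generators]. *)
Lemma cone_chart_smooth (V : set T) f : open V -> V `<=` cone_dom ->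
  (delta_minus_smooth W N V f <-> smooth_on (cone_chart @` V) (f \o cone_inv)).
Proof.
move=> oV VD; split=> [Sf|Sf].
- apply: smooth_on_local => _ [x Vx <-].
  have [V1 [g [oV1 V1x Sg fg]]] := Sf x Vx.
  have [k [al [F [sF gF]]]] := Sg (\val x) V1x.
  have nA : \forall y \near x, f y = F (\row_i ev (al i) (\val y)).
    have gF' : \forall y \near x, g (\val y) = F (\row_i ev (al i) (\val y)).
      exact: (continuous_val gF).
    by apply: filterS2 fg gF' => y -> ->.
  pose A := interior [set y | f y = F (\row_i ev (al i) (\val y))].
  pose O1 := cone_im `&` cone_inv @^-1` A.
  have Ix : cone_im (cone_chart x) by rewrite -cone_imE; exists x => //; exact: VD.
  have O1x : O1 (cone_chart x).
    split => //=; rewrite cone_chartK; last exact: VD.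
    exact: nbhs_singleton (nbhs_interior nA).
  have oO1 : open O1.
    apply: open_of_nbhs => z [Iz Az]; apply: filterI.
      by apply: open_nbhs_nbhs; split => //; exact: open_cone_im.
    apply: (cone_inv_continuous Iz); apply: open_nbhs_nbhs; split => //.
    exact: open_interior.
  exists O1; split => //.
  apply: (smooth_on_eq oO1 (f := fun z => F (\row_i ev (al i) (\val (cone_inv z))))).
    by move=> z [_ /interior_subset /= ->].
  apply: (@smooth_comp _ _ _ oO1 _ setT F
    (fun z => \row_i ev (al i) (\val (cone_inv z))) openT) => //.
  move=> i; apply: (smooth_on_eq oO1 (f := fun z => ev (al i) (\val (cone_inv z)))).
    by move=> z _; rewrite mxE.
  by apply: smooth_onW (smooth_ev_cone (al i)) => z [].
- move=> x Vx; have Dx := VD _ Vx.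
  pose O1 := cone_ty `&` to_cone @^-1` (cone_im `&` cone_inv @^-1` V).
  have oIV : open (cone_im `&` cone_inv @^-1` V).
    apply: open_of_nbhs => z [Iz Vz]; apply: filterI.
      by apply: open_nbhs_nbhs; split => //; exact: open_cone_im.
    by apply: (cone_inv_continuous Iz); apply: open_nbhs_nbhs; split.
  have oO1 : open O1.
    apply: open_of_nbhs => q [Qq Vq]; apply: filterI.
      by apply: open_nbhs_nbhs; split => //; exact: open_cone_ty.
    by apply: (to_cone_continuous Qq); apply: open_nbhs_nbhs; split.
  have O1x y : V y -> O1 (ty (\val y)).
    move=> Vy; have Dy := VD _ Vy; split; first exact: cone_ty_dom.
    split; first by rewrite -cone_imE; exists y.
    by rewrite /= -/(cone_chart y) cone_chartK.
  have S1 : smooth_on O1 ((f \o cone_inv) \o to_cone).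
    apply: (@smooth_comp _ _ _ oO1 _ _ (f \o cone_inv) to_cone oIV).
    + by move=> q [].
    + apply: smooth_onW Sf => z [Iz Vz]; exists (cone_inv z) => //; exact: cone_invK.
    + by move=> j; apply: smooth_onW (smooth_to_cone j) => q [].
  (* This function of (t, y) is smooth only on O1; near the image of x it is replaced by one that is
     smooth everywhere. *)
  have [F sF Fx] := smooth_extension oO1 (O1x _ Vx) S1.
  exists setT, (fun y : dspace W => F (ty y)); split => //; first exact: openT.
    move=> y _; exists n.+1, generators, F; split => //.
    by near=> y'.
  have nV : \forall y \near x, V y by exact: open_nbhs_nbhs.
  have nF : \forall y \near x, F (ty (\val y)) = (f \o cone_inv \o to_cone) (ty (\val y)).
    exact: (continuous_ty Fx).
  apply: filterS2 nV nF => y Vy ->.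
  by rewrite /= -/(cone_chart y) cone_chartK //; exact: VD.
Unshelve. all: by end_near. Qed.

Lemma cone_is_chart : is_chart (delta_minus_smooth W N) cone_dom cone_chart cone_inv.
Proof.
split.
- exact: open_cone_dom.
- by rewrite cone_imE; exact: open_cone_im.
- exact: cone_chartK.
- exact: cone_chart_continuous.
- by rewrite cone_imE; exact: cone_inv_continuous.
- exact: cone_chart_smooth.
Qed.

End SliceChart.

(** * The quotient manifold *)

Section RationalBalls.
Context {R : realType} {n : nat}.

Definition rat_ball (q : 'rV[rat]_n * rat) : set 'rV[R]_n :=
  ball (map_mx (@ratr R) q.1) (ratr q.2).

Lemma rat_ball_open q : open (rat_ball q).
Proof.
have [r0|r0] := ltP 0 (@ratr R q.2); first exact: ball_open.
rewrite (_ : rat_ball q = set0); first exact: open0.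
apply/seteqP; split=> // y; rewrite /rat_ball -ball_normE /= => /lt_le_trans /(_ r0).
by rewrite normr_lt0.
Qed.

Lemma rat_ball_basis (x : 'rV[R]_n) (A : set 'rV[R]_n) : nbhs x A ->
  exists q, rat_ball q x /\ rat_ball q `<=` A.
Proof.
move=> /nbhs_ballP[e /= e0 eA].
(* A rational radius s < e/2 and a rational center within s of x: the ball contains x, and by the
   triangle inequality it lies in the ball of radius e. *)
have e2 : 0 < e / 2 by rewrite divr_gt0.
have [s] := rat_in_itvoo e2; rewrite in_itv /= => /andP[s0 se].
have /choice[q qP] (j : 'I_n) : exists q : rat, `|ratr q - x 0 j| < ratr s :> R.
  have lt : x 0 j - ratr s < x 0 j + ratr s.
    by rewrite ltrD2l (lt_trans _ s0) // oppr_lt0.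
  have [q] := rat_in_itvoo lt; rewrite in_itv /= => /andP[q1 q2].
  by exists q; rewrite ltr_norml ltrBrDl q1 ltrBlDl q2.
have qx : `|map_mx (@ratr R) (\row_j q j) - x| < ratr s.
  rewrite {1}/Num.Def.normr/= mx_normrE.
  by apply: bigmax_lt => // -[i j] _ /=; rewrite ord1 !mxE; exact: qP.
exists (\row_j q j, s); rewrite /rat_ball -ball_normE /=; split; first exact: qx.
move=> y /= qy; apply: eA; rewrite -ball_normE /=.
rewrite -(subrKA (map_mx (@ratr R) (\row_j q j))); apply: le_lt_trans (ler_normD _ _) _.
rewrite (splitr e); apply: ltrD; last exact: lt_trans qy se.
by rewrite -normrN opprB; exact: lt_trans qx se.
Qed.

End RationalBalls.

(** * Charts of the quotient and the projection *)

Section BlowupManifold.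
Context {R : realType} {n r : nat} {M : topologicalType} {C : fun_family R M}.
Context {W : ideal_filtration C} {N : set M}.
Hypotheses (hM : is_manifold n C) (hW : is_weighted_pair n r W N).

Local Notation T := (delta_minus W N).
Local Notation act0 := (delta_minus_act W N).
Local Notation bl := (blowup W N).
Local Notation pr := (blowup_proj W N).

Definition blow_dom (c : @wchart R n M) a eps : set bl := pr @` cone_dom hM hW c a eps.

(** Defined through the representative of the orbit; over [blow_dom] the choice does not matter, by
    [vpart_pos]. *)
Definition blow_chart (c : @wchart R n M) a eps (z : bl) : 'rV[R]_n :=
  vpart (cone_chart c a eps (repr z : T)).

Lemma proj_repr (x : T) : exists (t : R) (t0 : 0 < t), repr (pr x) = act_pos act0 t0 x.
Proof. by apply/blowup_projE; rewrite /blowup_proj /orbit_proj reprK. Qed.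

Lemma proj_act t (t0 : 0 < t) (x : T) : pr (act_pos act0 t0 x) = pr x.
Proof. by apply/esym/blowup_projE; exists t, t0. Qed.

Section OneBlowupChart.
Variable c : @wchart R n M.
Hypothesis hc : @adapted R n M C W c.
Variables (a : 'I_n) (eps : R).
Hypotheses (wa : (0 < wt c a)%N) (eps2 : eps * eps = 1).

Local Notation D := (cone_dom hM hW c a eps).
Local Notation BD := (blow_dom c a eps).

Lemma blow_dom_proj x : BD (pr x) -> D x.
Proof.
move=> [y Dy /blowup_projE[t [t0 ->]]].
exact: (cone_dom_pos hc).
Qed.

Lemma blow_chart_proj x : D x -> blow_chart c a eps (pr x) = vpart (cone_chart c a eps x).
Proof.
by move=> Dx; rewrite /blow_chart; have [t [t0 ->]] := proj_repr x; exact: (vpart_pos hc wa t0 Dx).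
Qed.

Lemma blow_dom_open : open BD.
Proof. by apply: (open_blowup_proj); exact: open_cone_dom. Qed.

Lemma blow_chart_continuous z : BD z -> {for z, continuous (blow_chart c a eps)}.
Proof.
move=> [x Dx <-] A; rewrite blow_chart_proj // => nA.
have cv : {for x, continuous (vpart \o cone_chart c a eps)}.
  apply: continuous_comp; first exact: (cone_chart_continuous Dx).
  apply: row_continuous_at => b.
  rewrite (_ : (fun _ => _) = fun z : 'rV[R]_n.+1 => z 0 (lift ord0 b)).
    exact: coord_continuous.
  by apply/funext => w; rewrite mxE.
have nx : nbhs x (D `&` [set y | A (vpart (cone_chart c a eps y))]).
  apply: filterI; last exact: cv nA.
  by apply: open_nbhs_nbhs; split => //; exact: open_cone_dom.
have ni : nbhs (pr x) (pr @` interior (D `&` [set y | A (vpart (cone_chart c a eps y))])).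
  apply: open_nbhs_nbhs; split; first by apply: open_blowup_proj; exact: open_interior.
  by exists x => //; exact: nbhs_singleton (nbhs_interior nx).
apply: filterS ni => _ [y /interior_subset[Dy Ay] <-].
by rewrite /= blow_chart_proj.
Qed.

Variable x0 : T.

Local Notation S := (slice hM hW hc wa eps2 x0).

Definition blow_inv (v : 'rV[R]_n) : bl := pr (S v).

Lemma blow_imE : blow_chart c a eps @` BD = slice_dom c a eps.
Proof.
apply/seteqP; split=> [_ [_ [x Dx <-] <-]|v Vv].
  by rewrite blow_chart_proj //; have [] := slice_cone hc wa eps2 x0 Dx.
have Ds := slice_cone_dom hM hW hc wa eps2 x0 Vv.
exists (pr (S v)); first by exists (S v).
by rewrite blow_chart_proj // vpart_slice.
Qed.

Lemma blow_chartK z : BD z -> blow_inv (blow_chart c a eps z) = z.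
Proof.
move=> [x Dx <-]; rewrite blow_chart_proj // /blow_inv.
by have [_ [ti0 ->]] := slice_cone hc wa eps2 x0 Dx; exact: proj_act.
Qed.

Lemma proj_cone_inv (z : 'rV[R]_n.+1) : 0 < z 0 ord0 ->
  pr (cone_inv hM hW hc wa eps2 x0 z) = blow_inv (vpart z).
Proof. by move=> z0; rewrite /cone_inv (act_totalE z0) proj_act. Qed.

(** The section s = 1 of [vpart], whose image under [cone_inv] is the slice. *)
Definition vlift (v : 'rV[R]_n) : 'rV[R]_n.+1 :=
  \row_j if unlift ord0 j is Some b then v 0 b else 1.

Lemma vliftK v : vpart (vlift v) = v.
Proof. by apply/rowP => b; rewrite !mxE liftK. Qed.

Lemma vlift0 v : vlift v 0 ord0 = 1.
Proof. by rewrite mxE unlift_none. Qed.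

Lemma smooth_vlift (V : set 'rV[R]_n) j : open V -> smooth_on V (fun v => vlift v 0 j).
Proof.
move=> oV; case: (unliftP ord0 j) => [b|] ->.
  apply: (smooth_on_eq oV (f := fun v => v 0 b)); last exact: smooth_coord.
  by move=> v _; rewrite mxE liftK.
apply: (smooth_on_eq oV (f := fun=> 1)); last exact: smooth_cst.
by move=> v _; rewrite vlift0.
Qed.

Lemma smooth_vpart (V : set 'rV[R]_n.+1) b : open V -> smooth_on V (fun z => vpart z 0 b).
Proof.
move=> oV; apply: (smooth_on_eq oV (f := fun z => z 0 (lift ord0 b))); last exact: smooth_coord.
by move=> z _; rewrite mxE.
Qed.

Lemma cone_inv_vlift v : cone_inv hM hW hc wa eps2 x0 (vlift v) = S v.
Proof.
have z0 : 0 < vlift v 0 ord0 by rewrite vlift0.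
by rewrite /cone_inv (act_totalE z0) vliftK act_pos1 // vlift0.
Qed.

Lemma vlift_im v : slice_dom c a eps v -> cone_im c a eps (vlift v).
Proof. by move=> Vv; split; rewrite ?vlift0 ?vliftK. Qed.

Lemma blow_inv_continuous v : slice_dom c a eps v -> {for v, continuous blow_inv}.
Proof.
move=> Vv; have -> : blow_inv = pr \o (cone_inv hM hW hc wa eps2 x0 \o vlift).
  by apply/funext => w /=; rewrite cone_inv_vlift.
apply: continuous_comp; last exact: continuous_blowup_proj.
apply: continuous_comp; last by apply: cone_inv_continuous; exact: vlift_im.
apply: row_continuous_at => j.
exact: (smooth_on_continuous (smooth_vlift j openT) I).
Qed.

(** In conical coordinates a function f pulled back from the quotient is (f read in v) composed with
    [vpart], which gives one direction; restriction to s = 1 along [vlift] gives the other. *)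
Lemma blow_chart_smooth (V : set bl) f : open V -> V `<=` BD ->
  (blowup_smooth W N V f <-> smooth_on (blow_chart c a eps @` V) (f \o blow_inv)).
Proof.
move=> oV VBD.
have chT := cone_is_chart hM hW hc wa eps2 x0.
have oV' : open (pr @^-1` V) by apply: open_comp oV => x _; exact: continuous_blowup_proj.
have V'D : pr @^-1` V `<=` D by move=> x /VBD; exact: blow_dom_proj.
have imV : blow_chart c a eps @` V = [set v | slice_dom c a eps v /\ V (blow_inv v)].
  apply/seteqP; split=> [_ [z Vz <-]|v [Vv Vb]].
    by split; [rewrite -blow_imE; exists z => //; exact: VBD|rewrite blow_chartK //; exact: VBD].
  have Ds := slice_cone_dom hM hW hc wa eps2 x0 Vv.
  by exists (blow_inv v) => //; rewrite /blow_inv blow_chart_proj // vpart_slice.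
have oim : open (blow_chart c a eps @` V).
  rewrite imV; apply: open_of_nbhs => v [Vv Vb]; apply: filterI.
    by apply: open_nbhs_nbhs; split => //; exact: (open_slice_dom hc).
  by apply: (blow_inv_continuous Vv); apply: open_nbhs_nbhs.
have imV' : cone_chart c a eps @` (pr @^-1` V) =
    [set z : 'rV[R]_n.+1 | 0 < z 0 ord0 /\ (blow_chart c a eps @` V) (vpart z)].
  apply/seteqP; split=> [_ [x Vx <-]|z [z0]].
    split; first by rewrite cone_chart0 rt_gt0.
    by exists (pr x) => //; rewrite blow_chart_proj //; exact: V'D.
  rewrite imV => -[Vv Vb]; exists (cone_inv hM hW hc wa eps2 x0 z).
    by rewrite /= proj_cone_inv.
  by rewrite cone_invK.
have oim' : open (cone_chart c a eps @` (pr @^-1` V)) by exact: (chart_im_open chT).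
rewrite /blowup_smooth /orbit_smooth.
apply: (iff_trans (chart_smooth chT _ oV' V'D)); split=> [Sf|Sf].
- apply: (smooth_on_eq oim
     (f := ((f \o pr) \o cone_inv hM hW hc wa eps2 x0) \o vlift)).
    by move=> v _; rewrite /= cone_inv_vlift.
  apply: (smooth_comp oim oim' _ Sf) => [v Vv|j]; last exact: smooth_vlift.
  by rewrite imV'; split; rewrite ?vlift0 ?vliftK.
- apply: (smooth_on_eq oim' (f := (f \o blow_inv) \o vpart)).
    by move=> z; rewrite imV' => -[z0 _] /=; rewrite -proj_cone_inv.
  apply: (smooth_comp oim' oim _ Sf) => [z|b]; last exact: smooth_vpart.
  by rewrite imV' => -[].
Qed.

Lemma blow_is_chart : is_chart (blowup_smooth W N) BD (blow_chart c a eps) blow_inv.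
Proof.
split.
- exact: blow_dom_open.
- by rewrite blow_imE; exact: (open_slice_dom hc).
- exact: blow_chartK.
- exact: blow_chart_continuous.
- by rewrite blow_imE; exact: blow_inv_continuous.
- exact: blow_chart_smooth.
Qed.

End OneBlowupChart.

Lemma cone_cover (x : T) (c : @wchart R n M) : @adapted R n M C W c ->
  wdom c (base hM hW (\val x)) -> exists (a : 'I_n) (sg : bool),
  (0 < wt c a)%N /\ cone_dom hM hW c a ((-1) ^+ sg) x.
Proof.
move=> hc Ux; have [a [wa ya]] := off_center_yc hc Ux.
exists a, (yc c (\val x) 0 a < 0); split => //; split => //.
by rewrite -normrEsign normr_gt0.
Qed.

Lemma sgM (sg : bool) : (-1) ^+ sg * (-1) ^+ sg = 1 :> R.
Proof. by rewrite -signr_addb addbb. Qed.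

Lemma blowup_sheaf : is_fun_sheaf (blowup_smooth W N).
Proof.
have oP (U : set bl) : open U -> open (pr @^-1` U).
  by move=> oU; apply: open_comp oU => x _; exact: continuous_blowup_proj.
split.
- move=> U f g oU fg Sf x Ux; have [V [h [oV Vx Sh fh]]] := Sf x Ux.
  exists V, h; split => //.
  have nU : \forall y \near x, (pr @^-1` U) y by apply: open_nbhs_nbhs; split => //; exact: oP.
  by apply: filterS2 nU fh => y Uy <-; rewrite /= fg.
- by move=> U V f _ _ VU Sf x Vx; apply: Sf; exact: VU.
- move=> Us f H x [U UsU Ux].
  by have [_ /(_ x Ux)] := H U UsU.
Qed.

Lemma countable_image (A B : Type) (f : A -> B) (D : set A) :
  countable D -> countable (f @` D).
Proof. by move=> cD; apply: sub_countable cD; exact: card_image_le. Qed.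

(** The basis consists of rational balls in the quotient charts attached to countably many adapted
    charts of M, each chart carrying finitely many choices of a coordinate and a sign. *)
Lemma second_countable_blowup : @second_countable bl.
Proof.
(* The inverse charts need a default point, so the case of an empty quotient is treated apart. *)
have [[x0 _]|nT] := pselect (exists x : T, True); last first.
  exists set0; first exact: countable0.
  split=> // z; have [x _] := blowup_surj z.
  by case: nT; exists x.
have [B cB [oB bB]] := manifold_countable hM.
have [c0 _] := adapted_exists hM hW (base hM hW (\val x0)).
(* One adapted chart for each basic open set contained in the domain of some adapted chart. *)
have /choice[cw cwP] (b : set M) : exists c, (exists c', @adapted R n M C W c' /\ b `<=` wdom c') ->
    @adapted R n M C W c /\ b `<=` wdom c.
  by have [[c' ?]|?] := pselect (exists c', @adapted R n M C W c' /\ b `<=` wdom c');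
    [exists c'|exists c0].
pose F b (j : 'I_n * bool * ('rV[rat]_n * rat)) : set bl :=
  [set z | [/\ (0 < wt (cw b) j.1.1)%N, blow_dom (cw b) j.1.1 ((-1) ^+ j.1.2) z &
     rat_ball j.2 (blow_chart (cw b) j.1.1 ((-1) ^+ j.1.2) z)]].
(* For the remaining basic sets [cw] is arbitrary; those where it is not adapted are dropped, as
   their F need not be open. *)
pose B' := B `&` [set b | @adapted R n M C W (cw b)].
have oF b j : B' b -> open (F b j).
  move=> [_ hc]; have [wa|nwa] := boolP (0 < wt (cw b) j.1.1)%N; last first.
    rewrite (_ : F b j = set0); first exact: open0.
    by apply/seteqP; split=> // z []; rewrite (negPf nwa).
  rewrite (_ : F b j = blow_dom (cw b) j.1.1 ((-1) ^+ j.1.2) `&`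
     blow_chart (cw b) j.1.1 ((-1) ^+ j.1.2) @^-1` rat_ball j.2).
    apply: (chart_preim_open (blow_is_chart hc wa (sgM j.1.2) x0)).
    exact: rat_ball_open.
  by apply/seteqP; split=> z [] //; split.
exists (\bigcup_(b in B') (F b @` setT)).
  apply: bigcup_countable => [|b _]; last by apply: countable_image; exact: countableP.
  by apply: sub_countable cB; apply: subset_card_le => b [].
split=> [_ [b Bb [j _ <-]]|z A nA]; first exact: oF.
have [x xE] := blowup_surj z.
have [c [hc cx]] := adapted_exists hM hW (base hM hW (\val x)).
have ncx : nbhs (base hM hW (\val x)) (wdom c).
  by apply: open_nbhs_nbhs; split => //; exact: (ad_open hc).
have [b [Bb bx] bc] := bB _ _ ncx.
have [hcw bcw] : @adapted R n M C W (cw b) /\ b `<=` wdom (cw b) by apply: cwP; exists c.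
have [a [sg [wa Dx]]] := cone_cover hcw (bcw _ bx).
have Dz : blow_dom (cw b) a ((-1) ^+ sg) z by exists x.
have ch := blow_is_chart hcw wa (sgM sg) x0.
have zim : (blow_chart (cw b) a ((-1) ^+ sg) @` blow_dom (cw b) a ((-1) ^+ sg))
   (blow_chart (cw b) a ((-1) ^+ sg) z) by exists z.
have nA' : nbhs (blow_inv hcw wa (sgM sg) x0 (blow_chart (cw b) a ((-1) ^+ sg) z)) A.
  by rewrite (chart_K ch).
have [q [qz qA]] := rat_ball_basis (chart_inv_cont ch zim nA').
exists (F b (a, sg, q)); first by split => //; exists b => //; exists (a, sg, q).
move=> y [_ /= Dy qy]; have := qA _ qy; by rewrite /= (chart_K ch).
Qed.

Lemma blowup_manifold : is_manifold n (blowup_smooth W N).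
Proof.
split.
- exact: (hausdorff_blowup hM hW).
- exact: second_countable_blowup.
- exact: blowup_sheaf.
- move=> z; have [x <-] := blowup_surj z.
  have [c [hc cx]] := adapted_exists hM hW (base hM hW (\val x)).
  have [a [sg [wa Dx]]] := cone_cover hc cx.
  exists (blow_dom c a ((-1) ^+ sg)), (blow_chart c a ((-1) ^+ sg)),
    (blow_inv hc wa (sgM sg) x).
  by split; [exists x|exact: blow_is_chart].
Qed.

(** In a conical chart and the quotient chart below it the projection is the linear map [vpart], so
    it equals its derivative there, and [vlift] provides preimages. *)
Lemma blowup_submersion :
  is_submersion n.+1 n (delta_minus_smooth W N) (blowup_smooth W N) pr.
Proof.
split.
  split; first exact: continuous_blowup_proj.
  by move=> V g oV.
move=> x; have [c [hc cx]] := adapted_exists hM hW (base hM hW (\val x)).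
have [a [sg [wa Dx]]] := cone_cover hc cx.
have chT := cone_is_chart hM hW hc wa (sgM sg) x.
exists (cone_dom hM hW c a ((-1) ^+ sg)), (cone_chart c a ((-1) ^+ sg)),
  (cone_inv hM hW hc wa (sgM sg) x), (blow_dom c a ((-1) ^+ sg)),
  (blow_chart c a ((-1) ^+ sg)), (blow_inv hc wa (sgM sg) x).
split => //; [by exists x|exact: blow_is_chart|].
set z := cone_chart c a ((-1) ^+ sg) x.
have Iz : cone_im c a ((-1) ^+ sg) z.
  by rewrite -(cone_imE hM hW hc wa (sgM sg) x); exists x.
have lin : linear (vpart : 'rV[R]_n.+1 -> 'rV[R]_n).
  by move=> u v w; apply/rowP => b; rewrite !mxE.
have [L LE] := linear_pack lin.
have nz : \forall h \near (0 : 'rV[R]_n.+1), cone_im c a ((-1) ^+ sg) (h + z).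
  have oI : open (cone_im c a ((-1) ^+ sg)) by exact: (open_cone_im hc).
  have := open_nbhs_nbhs (conj oI Iz).
  move=> /nbhs_ballP[d /= d0 dI]; apply/nbhs_ballP; exists d => // h.
  rewrite -!ball_normE /= sub0r normrN => hd; apply: dI; rewrite -ball_normE /=.
  by rewrite opprD addrCA subrr addr0 normrN.
have E y : cone_im c a ((-1) ^+ sg) y ->
    (blow_chart c a ((-1) ^+ sg) \o pr \o cone_inv hM hW hc wa (sgM sg) x) y = vpart y.
  move=> Iy /=; rewrite blow_chart_proj //; last exact: cone_inv_dom.
  by rewrite cone_invK.
have Lc : continuous L.
  move=> v; rewrite (_ : (L : _ -> _) = vpart); last by apply/funext.
  apply: row_continuous_at => b.
  exact: (smooth_on_continuous (smooth_vpart b openT) I).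
have dL : is_diff z (blow_chart c a ((-1) ^+ sg) \o pr \o cone_inv hM hW hc wa (sgM sg) x) L.
  apply: is_diff_bound Lc _ => e e0; apply: filterS nz => h Ih.
  rewrite E // E // LE (_ : vpart (h + z) - vpart z - vpart h = 0).
    by rewrite normr0 mulr_ge0 // ltW.
  by apply/rowP => b; rewrite !mxE addrK subrr.
split; first by [].
rewrite diff_val; apply/seteqP; split=> // v _.
by exists (vlift v) => //; rewrite LE vliftK.
Qed.

End BlowupManifold.

(** * The three pieces *)

Section Pieces.
Context {R : realType} {n r : nat} {M : topologicalType} {C : fun_family R M}.
Context {W : ideal_filtration C} {N : set M}.
Hypotheses (hM : is_manifold n C) (hW : is_weighted_pair n r W N).

Local Notation T := (delta_minus W N).
Local Notation act0 := (delta_minus_act W N).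
Local Notation bl := (blowup W N).
Local Notation pr := (blowup_proj W N).
Local Notation hgt x := (height (\val (x : T))).

Lemma dgm_act u (u0 : u != 0) (x : T) i f : glob W i f ->
  dgm (act act0 u0 x) i f = u ^ i * dgm x i f.
Proof. by move=> Wf; rewrite /dgm dg_scale. Qed.

Lemma act_comm u v (u0 : u != 0) (v0 : v != 0) (x : T) :
  act act0 u0 (act act0 v0 x) = act act0 v0 (act act0 u0 x).
Proof. by apply: T_ext => i f Wf; rewrite !dgm_act // mulrCA. Qed.

Lemma sign_neq0 (b : bool) : (-1) ^+ b != 0 :> R.
Proof. by rewrite signr_eq0. Qed.

Definition flip (b : bool) (z : bl) : bl := pr (act act0 (sign_neq0 b) (repr z)).

Lemma flip_proj b x : flip b (pr x) = pr (act act0 (sign_neq0 b) x).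
Proof.
rewrite /flip; have [t [t0 ->]] := proj_repr x.
by rewrite {1}/act_pos act_comm; exact: (proj_act t0).
Qed.

(** u is |u| times its sign, and the positive factor |u| is lost in the quotient. *)
Lemma flip_act (u : R) (u0 : u != 0) x : flip (u < 0) (pr x) = pr (act act0 u0 x).
Proof.
have t0 : 0 < `|u| by rewrite normr_gt0.
rewrite flip_proj -(proj_act t0); congr pr; apply: T_ext => i f Wf.
by rewrite dgm_pos // !dgm_act // mulrA -expfzMl [`|u| * _]mulrC -realEsign ?num_real.
Qed.

Lemma flip_Z2 : is_Z2_action flip.
Proof.
split=> [z|b b' z]; have [x <-] := blowup_surj z.
  rewrite flip_proj; congr pr; apply: T_ext => i f Wf.
  by rewrite dgm_act // exp1rz mul1r.
rewrite /= !flip_proj; congr pr; apply: T_ext => i f Wf.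
by rewrite !dgm_act // signr_addb expfzMl mulrA.
Qed.

Lemma continuous_flip b : continuous (flip b).
Proof.
apply/quotient_continuous.
rewrite (_ : _ \o _ = pr \o act act0 (sign_neq0 b)); last first.
  by apply/funext => x; exact: flip_proj.
move=> x; apply: continuous_comp; first exact: continuous_act.
exact: continuous_blowup_proj.
Qed.

Lemma continuous_delta_scale u (u0 : u != 0) :
  continuous (fun x : dspace W => delta_scale u0 x).
Proof.
move=> x; apply: delta_continuous_at => b.
exact: (@continuous_ev _ _ _ W (rees_scale u b) x).
Qed.

(** The action permutes the generating evaluations: composing the one at b with u gives the one at
    [rees_scale u b]. *)
Lemma delta_minus_smooth_act u (u0 : u != 0) (O : set T) f :
  delta_minus_smooth W N O f ->
  delta_minus_smooth W N (act act0 u0 @^-1` O) (f \o act act0 u0).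
Proof.
move=> Sf x Ox; have [V [g [oV Vx Sg fg]]] := Sf _ Ox.
exists ((fun y : dspace W => delta_scale u0 y) @^-1` V), (g \o (fun y : dspace W => delta_scale u0 y)).
split => //.
- by apply: open_comp oV => y _; exact: continuous_delta_scale.
- move=> y Vy; have [k [al [F [sF gF]]]] := Sg _ Vy.
  exists k, (fun i => rees_scale u (al i)), F; split => //.
  exact: (continuous_delta_scale gF).
- exact: (continuous_act fg).
Qed.

Lemma smooth_flip b : smooth_map (blowup_smooth W N) (blowup_smooth W N) (flip b).
Proof.
split; first exact: continuous_flip.
move=> V g oV Sg; have := @delta_minus_smooth_act _ (sign_neq0 b) _ _ Sg.
rewrite /blowup_smooth /orbit_smooth.
have E : flip b \o pr = pr \o act act0 (sign_neq0 b).
  by apply/funext => x; exact: flip_proj.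
have -> : orbit_proj act0 @^-1` (flip b @^-1` V) = (flip b \o pr) @^-1` V by [].
have -> : (g \o flip b) \o orbit_proj act0 = g \o (flip b \o pr) by [].
by rewrite E.
Qed.

Lemma hgt_pos (t : R) (t0 : 0 < t) (x : T) : hgt (act_pos act0 t0 x) = t^-1 * hgt x.
Proof. exact: (height_pos hM). Qed.

Lemma is_point_scale p t u (u0 : u != 0) (x : dspace W) :
  is_point p t x -> is_point p (u^-1 * t) (delta_scale u0 x).
Proof.
move=> /is_pointP px; apply/is_pointP => i f Wf.
by rewrite dg_scale // px // mulrA expfzMl exprz_inv opprK.
Qed.

(** A point of the center has its base in N, whereas the base of this point is m. *)
Lemma off_point_exists (m : set_type (~` N)) t : t != 0 ->
  exists x : T, is_point (\val m) t (\val x).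
Proof.
move=> t0; have [x px] := point_exists hM hW (\val m) t0.
have xP : delta_minus W N x.
  move=> [p [t' [Np px']]].
  have := set_valP m; apply.
  by rewrite -(is_point_base hM hW px) (is_point_base hM hW px').
by exists (subelt (A := delta_minus W N) xP).
Qed.

Definition off_point (m : set_type (~` N)) t (t0 : t != 0) : T :=
  sval (cid (off_point_exists m t0)).

Lemma off_pointP m t (t0 : t != 0) : is_point (\val m) t (\val (off_point m t0)).
Proof. by rewrite /off_point; case: cid. Qed.

(** u divides the height by u, so t / s is the factor that leads from height t to height s. *)
Lemma off_point_scale m t s (t0 : t != 0) (s0 : s != 0) (u0 : t / s != 0) :
  act act0 u0 (off_point m t0) = off_point m s0.
Proof.
apply/val_inj; apply: (is_point_inj (p := \val m) (t := s)); last exact: off_pointP.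
have := is_point_scale u0 (off_pointP m t0).
by rewrite invf_div divfK.
Qed.

Lemma proj_off_point m t s (t0 : t != 0) (s0 : s != 0) : 0 < t / s ->
  pr (off_point m t0) = pr (off_point m s0).
Proof.
move=> ts; rewrite -(proj_act ts); congr pr.
by rewrite /act_pos (off_point_scale m t0 s0).
Qed.

Lemma hgt_off_point m t (t0 : t != 0) : hgt (off_point m t0) = t.
Proof. exact: (is_point_heightE hM (off_pointP m t0)). Qed.

Lemma base_off_point m t (t0 : t != 0) : base hM hW (\val (off_point m t0)) = \val m.
Proof. exact: (is_point_base hM hW (off_pointP m t0)). Qed.

Lemma gr_hom0 (phi : rees W -> R) (a : rees W) : rees_hom phi ->
  (forall i x, \val a i x = 0) -> phi a = 0.
Proof.
move=> hphi a0; rewrite -[RHS](mul0r (phi a)); apply: (homZ hphi).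
by apply/funext => i; apply/funext => x; rewrite a0 mul0r.
Qed.

(** z has degree -1 with coefficient 1 in C_(0), so its class in the associated graded algebra is
    0. *)
Lemma height_normal_incl (psi : @normal_bundle _ _ _ W) : height (normal_incl psi) = 0.
Proof.
have W1 : glob W 0 (fun=> 1) by apply: C_glob0; exact: (C_cst hM 1).
have Wm : glob W (-1) (fun=> 1) by apply: glob_neg => //; exact: (C_cst hM 1).
have h0 : rees_hom (\val psi \o @gr_class _ _ _ W) := set_valP psi.
pose a : rees W := mono 0 (fun=> 0).
have aE i x : \val a i x = 0 by rewrite /a monoE; [case: eqP|exact: glob0].
rewrite -(gr_hom0 h0 aE) /height /dg /=; congr (\val psi _).
apply/eqmodP/asboolP => i.
rewrite (_ : (fun x => _) = \val (mono (W := W) (-1) (fun=> 1)) i); last first.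
  by apply/funext => x; rewrite aE subr0.
rewrite monoE //; case: eqP => [->|_]; last exact: glob0.
by rewrite addNr.
Qed.

(** A point of the center at height 0 evaluates only the coefficient of degree 0, as 0^-i = 0 for i
    != 0, so it would come from the zero section. *)
Lemma normal_incl_off (psi : normal_minus W N) :
  delta_minus W N (normal_incl (\val psi)).
Proof.
move=> [p [t [Np px]]]; have := set_valP psi; apply.
have t0 : t = 0 by rewrite -(is_point_heightE hM px) height_normal_incl.
exists p => // a.
have := px a; rewrite t0 (fsum1 (i0 := 0)) => [|i i0].
  by rewrite oppr0 expr0z mul1r.
by rewrite exp0rz oppr_eq0 (negPf i0) mul0r.
Qed.

Definition off_incl (psi : normal_minus W N) : T :=
  subelt (A := delta_minus W N) (@normal_incl_off psi).

Lemma off_incl_pos (t : R) (t0 : 0 < t) psi :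
  off_incl (act_pos (normal_minus_act W N) t0 psi) = act_pos act0 t0 (off_incl psi).
Proof.
apply/val_inj/val_inj/funext => a /=.
by rewrite gr_scaleE.
Qed.

Lemma off_incl_inj : injective off_incl.
Proof.
move=> psi psi' /(congr1 (fun x : T => \val (\val x))) /= e.
apply/val_inj/val_inj/funext => k; rewrite -[k]gr_class_repr.
exact: (congr1 (@^~ (repr k)) e).
Qed.

Lemma hgt_off_incl psi : hgt (off_incl psi) = 0.
Proof. exact: height_normal_incl. Qed.

(** If f lies in C_(i+1), its value in degree i is the height times its value in degree i + 1. At
    height 0 the morphism therefore factors through the associated graded algebra. *)
Lemma off_incl_surj (x : T) : hgt x = 0 -> exists psi, off_incl psi = x.
Proof.
move=> x0; pose phi := \val (\val x).
have hphi : rees_hom phi := hm (\val x).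
have phi_rel a b : gr_rel a b -> phi a = phi b.
  move=> /asboolP ab; rewrite (hom_fsum hphi a) (hom_fsum hphi b).
  apply: eq_fsbigr => i _; apply/eqP; rewrite -subr_eq0; apply/eqP.
  have Wa := rees_glob a i; have Wb := rees_glob b i.
  have -> : dg phi i (\val a i) - dg phi i (\val b i) =
      dg phi i (fun y => \val a i y - \val b i y).
    rewrite -[- _]mulN1r -(dgZ hphi) // -(dgD hphi) //; last exact: globZ.
    by congr dg; apply/funext => y; rewrite mulN1r.
  have := dg_down hM hW (\val x) 1 (ab i).
  by rewrite addrK x0 expr1 mul0r.
pose psi (k : @gr _ _ _ W) := phi (repr k).
have psiE : psi \o @gr_class _ _ _ W = phi.
  apply/funext => a; rewrite /psi /=; apply: phi_rel.
  by apply/eqmodP; rewrite reprK.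
have hpsi : normal_bundle psi by rewrite /normal_bundle /= psiE.
pose psi1 := subelt (A := @normal_bundle _ _ _ W) hpsi.
have nz : normal_minus W N psi1.
  move=> [p Np pE]; have := set_valP x; apply; exists p, 0; split => // a.
  have -> : \val (\val x) a = \val a 0 p.
    by rewrite -pE -[LHS]/(phi a) -psiE.
  rewrite (fsum1 (i0 := 0)) => [|i i0]; first by rewrite oppr0 expr0z mul1r.
  by rewrite exp0rz oppr_eq0 (negPf i0) mul0r.
exists (subelt (A := normal_minus W N) nz).
by apply/val_inj/val_inj; rewrite /= psiE.
Qed.

(** The outer pieces are represented at heights 1 and -1; by [pieces_pos] and [pieces_neg] any
    height of the same sign gives the same orbit. *)
Definition pieces (k : set_type (~` N) + sphere_bundle W N + set_type (~` N)) : bl :=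
  match k with
  | inl (inl m) => pr (off_point m (oner_neq0 R))
  | inl (inr s) => pr (off_incl (repr s))
  | inr m => pr (off_point m (sign_neq0 true))
  end.

Lemma sphere_repr psi : exists (t : R) (t0 : 0 < t),
  repr (sphere_proj psi) = act_pos (normal_minus_act W N) t0 psi.
Proof.
have : orbit_rel (normal_minus_act W N) psi (repr (sphere_proj psi)).
  by apply/eqmodP; rewrite reprK.
by move=> /asboolP.
Qed.

Lemma pieces_sphere psi : pieces (inl (inr (sphere_proj psi))) = pr (off_incl psi).
Proof. by rewrite /=; have [t [t0 ->]] := sphere_repr psi; rewrite off_incl_pos proj_act. Qed.

Lemma pieces_pos m (t : R) (t0 : t != 0) : 0 < t -> pieces (inl (inl m)) = pr (off_point m t0).
Proof. by move=> tp; apply: proj_off_point; rewrite div1r invr_gt0. Qed.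

Lemma pieces_neg m (t : R) (t0 : t != 0) : t < 0 -> pieces (inr m) = pr (off_point m t0).
Proof. by move=> tn; apply: proj_off_point; rewrite mulN1r oppr_gt0 invr_lt0. Qed.

(** Base point and sign of the height are constant on orbits, which separates the pieces and the
    points of the outer ones; on the sphere bundle equivariance and injectivity of [off_incl] carry
    the orbit relation back. *)
Lemma pieces_inj : injective pieces.
Proof.
have base_eq x y : pr x = pr y -> base hM hW (\val x) = base hM hW (\val y).
  by move=> /blowup_projE[t [t0 ->]]; rewrite base_pos.
have sg_eq x y : pr x = pr y -> Num.sg (hgt x) = Num.sg (hgt y).
  move=> /blowup_projE[t [t0 ->]]; rewrite hgt_pos sgrM (gtr0_sg (x := t^-1)) ?mul1r //.
  by rewrite invr_gt0.
move=> [[m|s]|m] [[m'|s']|m'] //= e.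
- congr (inl (inl _)); apply/val_inj.
  by have := base_eq _ _ e; rewrite !base_off_point.
- by have /eqP := sg_eq _ _ e; rewrite hgt_off_point hgt_off_incl sgr1 sgr0 oner_eq0.
- have /eqP := sg_eq _ _ e; rewrite !hgt_off_point sgr1 expr1 sgrN1 -subr_eq0 opprK.
  by rewrite -mulr2n pnatr_eq0.
- by have /eqP := sg_eq _ _ e; rewrite hgt_off_point hgt_off_incl sgr1 sgr0 eq_sym oner_eq0.
- congr (inl (inr _)); have /blowup_projE[t [t0]] := e.
  rewrite -off_incl_pos => /off_incl_inj e'.
  rewrite -[s]reprK -[s']reprK; apply/eqmodP/asboolP.
  by exists t, t0.
- have /eqP := sg_eq _ _ e; rewrite hgt_off_point hgt_off_incl expr1 sgrN1 sgr0.
  by rewrite eq_sym oppr_eq0 oner_eq0.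
- have /eqP := sg_eq _ _ e; rewrite !hgt_off_point sgr1 expr1 sgrN1 eq_sym -subr_eq0 opprK.
  by rewrite -mulr2n pnatr_eq0.
- have /eqP := sg_eq _ _ e; rewrite hgt_off_point hgt_off_incl expr1 sgrN1 sgr0.
  by rewrite oppr_eq0 oner_eq0.
- congr (inr _); apply/val_inj.
  by have := base_eq _ _ e; rewrite !base_off_point.
Qed.

Lemma point_off_N (x : T) : hgt x != 0 ->
  exists m : set_type (~` N), \val m = base hM hW (\val x).
Proof.
move=> x0; have nN : (~` N) (base hM hW (\val x)).
  move=> Nb; have := set_valP x; apply.
  by exists (base hM hW (\val x)), (hgt x); split => //; exact: is_point_height.
by exists (subelt (A := ~` N) nN).
Qed.

Lemma off_point_base (x : T) (x0 : hgt x != 0) m : \val m = base hM hW (\val x) ->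
  off_point m x0 = x.
Proof.
move=> mE; apply/val_inj; apply: (is_point_inj (off_pointP m x0)).
by rewrite mE; exact: is_point_height.
Qed.

Lemma pieces_surj z : exists k, pieces k = z.
Proof.
have [x <-] := blowup_surj z.
have [xn|xp|x0] := ltgtP (hgt x) 0.
- have x0 : hgt x != 0 by rewrite lt_eqF.
  have [m mE] := point_off_N x0; exists (inr m).
  by rewrite (pieces_neg m x0 xn) (off_point_base x0 mE).
- have x0 : hgt x != 0 by rewrite gt_eqF.
  have [m mE] := point_off_N x0; exists (inl (inl m)).
  by rewrite (pieces_pos m x0 xp) (off_point_base x0 mE).
- have [psi <-] := off_incl_surj x0.
  by exists (inl (inr (sphere_proj psi))); exact: pieces_sphere.
Qed.

Lemma pieces_bij : bijective pieces.
Proof.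
have /choice[g gK] := pieces_surj.
by exists g => // k; apply: pieces_inj; rewrite gK.
Qed.

Lemma range_sphere z : range (fun s => pieces (inl (inr s))) z <->
  exists2 x, pr x = z & hgt x = 0.
Proof.
split=> [[s _ <-]|[x <- x0]].
  by exists (off_incl (repr s)) => //; exact: hgt_off_incl.
have [psi <-] := off_incl_surj x0.
by exists (sphere_proj psi) => //; exact: pieces_sphere.
Qed.

Lemma flip_sphere : flip true @` range (fun s => pieces (inl (inr s))) =
  range (fun s => pieces (inl (inr s))).
Proof.
have sub z : range (fun s => pieces (inl (inr s))) z ->
    range (fun s => pieces (inl (inr s))) (flip true z).
  move=> /range_sphere[x <- x0]; apply/range_sphere.
  rewrite flip_proj; exists (act act0 (sign_neq0 true) x) => //.
  by rewrite [LHS](height_scale hM) x0 mulr0.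
apply/seteqP; split=> [_ [z /sub + <-] //|z /sub zs].
exists (flip true z) => //.
by have [f0 fM] := flip_Z2; rewrite -[LHS]/((flip true \o flip true) z) -fM f0.
Qed.

Lemma flip_off_point m : flip true (pieces (inl (inl m))) = pieces (inr m) /\
  flip true (pieces (inr m)) = pieces (inl (inl m)).
Proof.
have E : flip true (pieces (inl (inl m))) = pieces (inr m).
  rewrite /= flip_proj; congr pr; apply/val_inj.
  apply: (is_point_inj (p := \val m) (t := -1)); last exact: off_pointP.
  have := is_point_scale (sign_neq0 true) (off_pointP m (oner_neq0 R)).
  have -> : ((-1) ^+ true)^-1 * 1 = -1 :> R by rewrite mulr1 expr1 invrN1.
  exact.
split => //; rewrite -E; have [f0 fM] := flip_Z2.
by rewrite -[LHS]/((flip true \o flip true) _) -fM f0.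
Qed.

End Pieces.

Theorem proposition6p2 (R : realType) (n r : nat) (M : topologicalType)
    (C : fun_family R M) (W : ideal_filtration C) (N : set M)
    (hM : is_manifold n C) (hW : is_weighted_pair n r W N) :
  [/\ free_action (delta_minus_act W N),
      proper_action (delta_minus_act W N),
      is_manifold n (blowup_smooth W N),
      is_submersion n.+1 n (delta_minus_smooth W N) (blowup_smooth W N)
        (blowup_proj W N) &
      exists (pieces : set_type (~` N) + sphere_bundle W N + set_type (~` N) ->
                       blowup W N)
             (rho : bool -> blowup W N -> blowup W N),
        let pos m := pieces (inl (inl m)) in
        let sph s := pieces (inl (inr s)) in
        let neg m := pieces (inr m) in
        [/\ bijective pieces,
            (forall (m : set_type (~` N)) (t : R), 0 < t ->
              exists2 phi : set_type (delta_minus W N),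
                is_point (\val m) t (\val phi) & pos m = blowup_proj W N phi),
            (forall psi : set_type (normal_minus W N),
              exists2 phi : set_type (delta_minus W N),
                \val phi = normal_incl (\val psi) &
                sph (sphere_proj psi) = blowup_proj W N phi),
            (forall (m : set_type (~` N)) (t : R), t < 0 ->
              exists2 phi : set_type (delta_minus W N),
                is_point (\val m) t (\val phi) & neg m = blowup_proj W N phi) &
            [/\ is_Z2_action rho,
                (forall b,
                  smooth_map (blowup_smooth W N) (blowup_smooth W N) (rho b)),
                (forall (u : R) (u0 : u != 0) (phi : set_type (delta_minus W N)),
                  rho (u < 0) (blowup_proj W N phi) =
                  blowup_proj W N (act (delta_minus_act W N) u0 phi)),
                (forall m, rho true (pos m) = neg m /\ rho true (neg m) = pos m) &
                rho true @` range sph = range sph]]].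
Proof.
split.
- exact: free_minus hM hW.
- exact: proper_minus hM hW.
- exact: blowup_manifold hM hW.
- exact: blowup_submersion hM hW.
exists (pieces hM hW), flip; split.
- exact: pieces_bij.
- move=> m t tp; have t0 : t != 0 by rewrite gt_eqF.
  by exists (off_point hM hW m t0); [exact: off_pointP|exact: pieces_pos].
- by move=> psi; exists (off_incl hM psi) => //; exact: pieces_sphere.
- move=> m t tn; have t0 : t != 0 by rewrite lt_eqF.
  by exists (off_point hM hW m t0); [exact: off_pointP|exact: pieces_neg].
split.
- exact: flip_Z2.
- exact: smooth_flip.
- exact: flip_act.
- exact: flip_off_point.
- exact: flip_sphere.
Qed.
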